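(* Let $p=p(n)$ and $N=N(n)$ be positive integers and $\alpha_n>0$ constants. For each $n$, let $\mathbf{X}_n=(x_{ij})_{p\times n}$ and $\mathbb{X}_N=(\mathbbm{x}_{kl})_{p\times N}$ be independent random matrices (on a common probability space), and set $\mathbf{S}_n=n^{-1}\mathbf{X}_n\mathbf{X}_n^*$, $\mathbf{T}_N=N^{-1}\mathbb{X}_N\mathbb{X}_N^*$ and $$\mathbf{B}_n=\mathbf{S}_n(\mathbf{S}_n+\alpha_n\mathbf{T}_N)^{-1}.$$ Assume: (i) for each $n$, the entries $x_{ij}=x_{nij}$ are i.i.d. with $\mathbb{E}x_{11}=0$, $\mathbb{E}|x_{11}|^2=1$; (ii) $\alpha_n\to\alpha>0$ and $y_n=p/n\to y>0$; (iii) for each $N$, the entries $\mathbbm{x}_{kl}=\mathbbm{x}_{Nkl}$ are i.i.d. with $\mathbb{E}\mathbbm{x}_{11}=0$, $\mathbb{E}|\mathbbm{x}_{11}|^2=1$; (iv) $Y_N=p/N\to Y>0$ and $\frac{p}{n+N}\to\frac{yY}{y+Y}\in(0,1)$; (v) $\sup_n\mathbb{E}|x_{11}|^4<\infty$ and $\sup_N\mathbb{E}|\mathbbm{x}_{11}|^4<\infty$. Then, with probability $1$, $F^{\mathbf{B}_n}\to F$ weakly, where $F$ is a non-random distribution function described as follows. Put $$t_l,t_r=\frac{2\alpha-(1-y)[\alpha(1-Y)-1+y]\mp2\alpha\sqrt{y-yY+Y}}{(\alpha(1-Y)-1+y)^2+4\alpha}$$ (with $-$ for $t_l$ and $+$ for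 $t_r$). Apart from the point masses described below, $F$ has density $$\frac{\sqrt{((\alpha(1-Y)-1+y)^2+4\alpha)(t_r-t)(t-t_l)}}{2\pi t(1-t)(y(1-t)+\alpha tY)}\quad\text{for } t_l<t<t_r,$$ and density $0$ otherwise. In addition, when $y>1$, $F$ has a point mass $1-1/y$ at $t=0$, and when $Y>1$, $F$ has a point mass $1-1/Y$ at $t=1$.
   Context: For a $p\times p$ matrix $\mathbf{A}$ with only real eigenvalues $\lambda_1^{\mathbf{A}}\le\dots\le\lambda_p^{\mathbf{A}}$, its empirical spectral distribution function is $F^{\mathbf{A}}(x)=\frac1p\sum_{i=1}^pI(\lambda_i^{\mathbf{A}}\le x)$. The superscript $^*$ denotes conjugate transpose; entries may be real or complex. *)

(* Defs.v *)
From HB Require Import structures.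
From mathcomp Require Import all_boot all_order all_algebra.
From mathcomp Require Import all_classical all_reals all_analysis.
From mathcomp.real_closed Require Import complex.
Set Implicit Arguments. Unset Strict Implicit. Unset Printing Implicit Defensive.
Import Order.TTheory GRing.Theory Num.Theory.
Import numFieldNormedType.Exports.
Local Open Scope classical_set_scope.
Local Open Scope ring_scope.

Section Defs.
Context (R : realType).

Definition adjmx (m n : nat) (A : 'M[R[i]]_(m, n)) : 'M[R[i]]_(n, m) :=
  (map_mx (@conjc R) A)^T.

(** The eigenvalues of A, listed with algebraic multiplicity: a sequence s with
    char_poly A = \prod_(z <- s) ('X - z).  Such an s exists (R[i] is
    algebraically closed) and is unique up to permutation, so everything below
    that only counts elements of s is independent of the choice. *)
Definition eigseq (m : nat) (A : 'M[R[i]]_m) : seq R[i] :=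
  match pselect (exists s : seq R[i], char_poly A = \prod_(z <- s) ('X - z%:P)) with
  | left h => proj1_sig (cid h)
  | right _ => [::]
  end.

(** Empirical spectral distribution F^A(x) = (1/m) #{i : lambda_i(A) <= x}
    (eigenvalues counted with multiplicity; only real eigenvalues are counted,
    which for matrices with only real eigenvalues is all of them). *)
Definition esd (m : nat) (A : 'M[R[i]]_m) (x : R) : R :=
  (count (fun z : R[i] => (complex.Im z == 0) && (complex.Re z <= x)) (eigseq A))%:R / m%:R.

Definition cmx (T : Type) (m n : nat) (re im : 'I_m -> 'I_n -> T -> R) (w : T)
  : 'M[R[i]]_(m, n) :=
  \matrix_(i, j) Complex (re i j w) (im i j w).

(** B = S (S + a T)^{-1}, S = n^{-1} X X^*, T = N^{-1} XX XX^*.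
    (invmx is MathComp's inverse; it is only used where the matrix is invertible
    in the paper's reading.) *)
Definition Bmat (p n N : nat) (X : 'M[R[i]]_(p, n)) (XX : 'M[R[i]]_(p, N)) (a : R)
  : 'M[R[i]]_p :=
  let S := (n%:R)^-1 *: (X *m adjmx X) in
  let TT := (N%:R)^-1 *: (XX *m adjmx XX) in
  S *m invmx (S + real_complex R a *: TT).

(** * Probability: complex random variables are pairs (Re, Im) of real r.v.'s *)

Section Prob.
Context (d : measure_display) (T : measurableType d) (P : probability T R).

(** Mutual independence of a finite family of complex random variables
    Z_k = Zc k true + i * Zc k false : the joint law of the family is the product
    of the marginal laws (checked on the generating pi-system of product sets). *)
Definition mutually_independent (I : finType) (Zc : I -> bool -> T -> R) : Prop :=
  forall A : I -> bool -> set R, (forall k b, measurable (A k b)) ->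
    P (\bigcap_(k in [set: I]) \bigcap_(b in [set: bool]) (Zc k b @^-1` A k b)) =
    (\prod_(k : I) P (\bigcap_(b in [set: bool]) (Zc k b @^-1` A k b)))%E.

(** Two complex random variables x1 = X1 + i Y1, x2 = X2 + i Y2 have the same law
    (checked on the generating pi-system of rectangles of R x R). *)
Definition same_law (X1 Y1 X2 Y2 : T -> R) : Prop :=
  forall A B : set R, measurable A -> measurable B ->
    P (X1 @^-1` A `&` Y1 @^-1` B) = P (X2 @^-1` A `&` Y2 @^-1` B).

End Prob.

Definition all_entries (T : Type) (p n N : nat)
  (xr xi : 'I_p -> 'I_n -> T -> R) (zr zi : 'I_p -> 'I_N -> T -> R)
  (k : ('I_p * 'I_n) + ('I_p * 'I_N)) (b : bool) : T -> R :=
  match k with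
  | inl (i, j) => if b then xr i j else xi i j
  | inr (i, j) => if b then zr i j else zi i j
  end.

Definition cst (a y Y : R) : R := (a * (1 - Y) - 1 + y) ^+ 2 + 4 * a.

Definition t_l (a y Y : R) : R :=
  (2 * a - (1 - y) * (a * (1 - Y) - 1 + y) - 2 * a * Num.sqrt (y - y * Y + Y))
  / cst a y Y.

Definition t_r (a y Y : R) : R :=
  (2 * a - (1 - y) * (a * (1 - Y) - 1 + y) + 2 * a * Num.sqrt (y - y * Y + Y))
  / cst a y Y.

Definition dens (a y Y : R) (t : R) : R :=
  if (t_l a y Y < t) && (t < t_r a y Y) then
    Num.sqrt (cst a y Y * (t_r a y Y - t) * (t - t_l a y Y))
    / (2 * pi * t * (1 - t) * (y * (1 - t) + a * t * Y))
  else 0.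

Definition Flim (a y Y : R) (x : R) : R :=
  (if (1 < y) && (0 <= x) then 1 - y^-1 else 0)
  + (if (1 < Y) && (1 <= x) then 1 - Y^-1 else 0)
  + fine (\int[@lebesgue_measure R]_(t in `]-oo, x]) (dens a y Y t)%:E)%E.

Definition distribution_function (F : R -> R) : Prop :=
  [/\ {homo F : u v / u <= v},
      (forall x, F @ at_right x --> F x),
      F x @[x --> -oo] --> (0 : R) &
      F x @[x --> +oo] --> (1 : R)].

End Defs.

(* Main.v *)
(** Put the two samples side by side in a p x (n + N) matrix M and weight the columns: with
    d_k = (1 + x) / n on the first n columns and x alpha_n / N on the others,
    S + x (S + alpha_n T) = M diag(d) M^h, so that for x > 0 the sum of 1 / (lambda + x) over the
    eigenvalues of B_n is (p - s / (1 + x)) / x, where s is the sum of the d_k m_k^h G m_k over the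
    first n columns m_k and G = (M diag(d) M^h)^-1.  Only real x > 0 is needed.

    After adding e I to the matrix, s and tr G change by a bounded amount when one column is
    replaced, hence concentrate exponentially around their means, and Sherman-Morrison with the
    variance of quadratic forms shows that d_k m_k^h G m_k is close to d_k tau / (1 + d_k tau),
    tau = E tr G.  Summing over all columns gives an equation for tau / p which, as n grows and then
    e decreases to 0, forces s / p to converge.  Removing e requires M M^h to be invertible
    eventually: its singularity probability is exponentially small, because the entries have atoms
    of mass at most q < 1 and p / (n + N) stays away from 1.

    By Borel-Cantelli the averages of 1 / (lambda + k) converge almost surely for all large integers
    k.  Their limits are computed for F by an explicit antiderivative, and they determine the
    moments, hence the limit of the distribution functions at continuity points. *)

Require Import Defs.
From HB Require Import structures.
From mathcomp Require Import all_boot all_order all_algebra.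
From mathcomp Require Import all_classical all_reals all_analysis.
From mathcomp.real_closed Require Import complex.
From mathcomp Require Import measurable_realfun.
From mathcomp Require Import ring lra.
Import Order.TTheory GRing.Theory Num.Theory.
Import numFieldNormedType.Exports.
Local Open Scope classical_set_scope.
Local Open Scope ring_scope.
Set Implicit Arguments.
Unset Strict Implicit.
Unset Printing Implicit Defensive.

(** * Weighted Gram matrices and their resolvents *)

(** The entries have only four moments, so exponential concentration cannot come from their tails.
    It comes from removing one column at a time: this is a rank-one change, and its effect on tr G
    and on the column sums is bounded whatever the size of the column. Exponential rates are wanted
    because nothing links different n, so that only summable probabilities give almost sure
    statements. The ridge e keeps tr G bounded even where M M^h is singular, which has positive
    probability when entries have atoms. In the limit tau / p becomes a number g > 0 with [c1 g / (1
    + c1 y g) + c2 g / (1 + c2 Y g) = 1], where c1 = 1 + x and c2 = x a. This is a quadratic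
    equation whose leading coefficient is positive exactly when y Y < y + Y, the same condition that
    keeps p below n + N. Its discriminant is the radicand in the transform of the density, and this
    is where the empirical side and the explicit law meet. The transform is computed by partial
    fractions, two of whose poles collide when x (a Y - y) = y; large integers x avoid this. *)

Section HermitianForms.
Context (R : realType).
Local Notation C := R[i].
Local Notation "x %:C" := (real_complex R x).
Local Notation Re := (@complex.Re R).
Local Notation Im := (@complex.Im R).
Local Notation "A ^h" := (adjmx A) (at level 8, format "A ^h").

Lemma ReD (x y : C) : Re (x + y) = Re x + Re y. Proof. by case: x y => [? ?] [? ?]. Qed.
Lemma ReN (x : C) : Re (- x) = - Re x. Proof. by case: x. Qed.
Lemma ReB (x y : C) : Re (x - y) = Re x - Re y. Proof. by rewrite ReD ReN. Qed.
Lemma Re_rmul (a : R) (x : C) : Re (a%:C * x) = a * Re x.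
Proof. by case: x => u v /=; rewrite mul0r subr0. Qed.
Lemma Re_sum (I : Type) (s : seq I) (Q : pred I) (f : I -> C) :
  Re (\sum_(i <- s | Q i) f i) = \sum_(i <- s | Q i) Re (f i).
Proof. by apply: (big_morph Re ReD). Qed.
Lemma conjc_real_Re (x : C) : conjc x = x -> x = (Re x)%:C.
Proof.
by case: x => u v [] /eqP; rewrite eq_sym -addr_eq0 -mulr2n mulrn_eq0 /= => /eqP ->.
Qed.
Definition normc2 (x : C) : R := Re x ^+ 2 + Im x ^+ 2.
Lemma normc2E (x : C) : conjc x * x = (normc2 x)%:C.
Proof.
case: x => u v; rewrite /normc2 /=; apply/eqP; rewrite eq_complex /=.
by apply/andP; split; apply/eqP; ring.
Qed.
Lemma normc2_ge0 x : 0 <= normc2 x.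
Proof. by rewrite /normc2 addr_ge0 // sqr_ge0. Qed.

Lemma adjmxE m n (A : 'M[C]_(m, n)) i j : A^h i j = conjc (A j i).
Proof. by rewrite !mxE. Qed.
Lemma adjmxM m n k (A : 'M[C]_(m, n)) (B : 'M[C]_(n, k)) : (A *m B)^h = B^h *m A^h.
Proof. by rewrite /adjmx map_mxM trmx_mul. Qed.
Lemma adjmxK m n (A : 'M[C]_(m, n)) : A^h^h = A.
Proof. by apply/matrixP => i j; rewrite !adjmxE conjcK. Qed.
Lemma adjmxD m n (A B : 'M[C]_(m, n)) : (A + B)^h = A^h + B^h.
Proof. by rewrite /adjmx map_mxD linearD. Qed.
Lemma adjmxZ m n a (A : 'M[C]_(m, n)) : (a *: A)^h = conjc a *: A^h.
Proof. by rewrite /adjmx map_mxZ linearZ. Qed.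
Lemma adjmx_scalar n (a : C) : (a%:M : 'M[C]_n)^h = (conjc a)%:M.
Proof. by rewrite /adjmx map_scalar_mx tr_scalar_mx. Qed.
Lemma adjmx_invmx n (A : 'M[C]_n) : (invmx A)^h = invmx (A^h).
Proof. by rewrite /adjmx map_invmx trmx_inv. Qed.
Lemma adjmx_diag n (d : 'rV[C]_n) : (diag_mx d)^h = diag_mx (map_mx (@conjc R) d).
Proof. by rewrite /adjmx map_diag_mx tr_diag_mx. Qed.

(** The real part makes the form real-valued for every A; for Hermitian A nothing is lost, by
    [qformE]. *)
Definition qform n (A : 'M[C]_n) (v : 'cV[C]_n) : R := Re ((v^h *m A *m v) 0 0).
Definition vnorm2 n (v : 'cV[C]_n) : R := \sum_i normc2 (v i 0).

Lemma vnorm2E n (v : 'cV[C]_n) : (v^h *m v) 0 0 = (vnorm2 v)%:C.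
Proof.
rewrite mxE /vnorm2 rmorph_sum; apply: eq_bigr => i _.
by rewrite adjmxE normc2E.
Qed.
Lemma vnorm2_ge0 n (v : 'cV[C]_n) : 0 <= vnorm2 v.
Proof. by apply: sumr_ge0 => i _; exact: normc2_ge0. Qed.
Lemma vnorm2_eq0 n (v : 'cV[C]_n) : vnorm2 v = 0 -> v = 0.
Proof.
move=> /psumr_eq0P h; apply/matrixP => i j; rewrite ord1 mxE.
have := h (fun i _ => normc2_ge0 (v i 0)) i isT.
rewrite /normc2; case: (v i 0) => a b /= /eqP.
by rewrite paddr_eq0 ?sqr_ge0 // !sqrf_eq0 => /andP[/eqP-> /eqP->].
Qed.

Lemma qformE n (A : 'M[C]_n) v : A^h = A -> (v^h *m A *m v) 0 0 = (qform A v)%:C.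
Proof.
move=> hA; apply: conjc_real_Re; rewrite -adjmxE.
by rewrite !adjmxM adjmxK hA mulmxA.
Qed.
Lemma qformD n (A B : 'M[C]_n) v : qform (A + B) v = qform A v + qform B v.
Proof. by rewrite /qform mulmxDr mulmxDl mxE ReD. Qed.
Lemma qformN n (A : 'M[C]_n) v : qform (- A) v = - qform A v.
Proof. by rewrite /qform mulmxN mulNmx mxE ReN. Qed.
Lemma qformZ n a (A : 'M[C]_n) v : qform (a%:C *: A) v = a * qform A v.
Proof. by rewrite /qform -scalemxAr -scalemxAl mxE Re_rmul. Qed.
Lemma qform_scalar n a (v : 'cV[C]_n) : qform (a%:C%:M) v = a * vnorm2 v.
Proof. by rewrite /qform -scalemx1 -scalemxAr mulmx1 -scalemxAl mxE vnorm2E Re_rmul. Qed.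
Lemma qform_gram n m (A : 'M[C]_(m, n)) v : qform (A^h *m A) v = vnorm2 (A *m v).
Proof. by rewrite /qform mulmxA -mulmxA -adjmxM vnorm2E. Qed.
Lemma qform_inner n (G A : 'M[C]_n) v : G^h = G -> qform (G *m A *m G) v = qform A (G *m v).
Proof. by move=> hG; rewrite /qform adjmxM hG !mulmxA. Qed.

End HermitianForms.

(* Locked to keep unification from comparing pencils with different weights by unfolding. *)
HB.lock Definition pencil (R : realType) p m (X : 'M[R[i]]_(p, m)) (d : 'I_m -> R) (e : R)
  : 'M[R[i]]_p :=
  X *m diag_mx (\row_j (real_complex R (d j))) *m adjmx X + (real_complex R e)%:M.

Section Resolvent.
Context (R : realType).
Local Notation C := R[i].
Local Notation "x %:C" := (real_complex R x).
Local Notation Re := (@complex.Re R).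
Local Notation Im := (@complex.Im R).
Local Notation "A ^h" := (adjmx A) (at level 8, format "A ^h").

Definition resolvent p m (X : 'M[C]_(p, m)) d e := invmx (pencil X d e).
Definition restrace p m (X : 'M[C]_(p, m)) d e : R := Re (\tr (resolvent X d e)).
Definition resform p m (X : 'M[C]_(p, m)) d e j : R := qform (resolvent X d e) (col j X).
Definition ressum p m (X : 'M[C]_(p, m)) d e (J : pred 'I_m) : R :=
  \sum_(j | J j) d j * resform X d e j.
(** A column is removed by giving it weight 0, so that all matrices keep their format and the column
    indices stay fixed. *)
Definition drop_wt m (d : 'I_m -> R) j : 'I_m -> R := fun k => if k == j then 0 else d k.

Lemma pencil_sum p m (X : 'M[C]_(p, m)) d e :
  pencil X d e = \sum_j (d j)%:C *: (col j X *m (col j X)^h) + e%:C%:M.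
Proof.
rewrite pencil.unlock; congr (_ + _); apply/matrixP => i k; rewrite mxE summxE; apply: eq_bigr => j _.
rewrite mxE (bigD1 j) //= big1 ?addr0; last first.
  by move=> l lj; rewrite !mxE (negbTE lj) mulr0n mulr0.
by rewrite !mxE eqxx mulr1n big_ord1 !mxE; ring.
Qed.

Lemma pencil_herm p m (X : 'M[C]_(p, m)) d e : (pencil X d e)^h = pencil X d e.
Proof.
rewrite pencil.unlock adjmxD adjmx_scalar conjc_real !adjmxM adjmxK adjmx_diag mulmxA.
suff -> : map_mx (@conjc R) (\row_j (d j)%:C) = \row_j (d j)%:C by [].
by apply/matrixP => i k; rewrite !mxE conjc_real.
Qed.

Lemma resolvent_herm p m (X : 'M[C]_(p, m)) d e : (resolvent X d e)^h = resolvent X d e.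
Proof. by rewrite /resolvent adjmx_invmx pencil_herm. Qed.

Lemma qform_pencil p m (X : 'M[C]_(p, m)) d e v :
  qform (pencil X d e) v = \sum_j d j * normc2 (((col j X)^h *m v) 0 0) + e * vnorm2 v.
Proof.
rewrite pencil_sum qformD qform_scalar; congr (_ + _).
rewrite /qform mulmx_sumr mulmx_suml summxE Re_sum; apply: eq_bigr => j _.
rewrite -scalemxAr -scalemxAl mxE Re_rmul; congr (_ * _).
set a := _^h *m v.
have -> : v^h *m (col j X *m (col j X)^h) *m v = a^h *m a.
  by rewrite /a adjmxM adjmxK !mulmxA.
by rewrite vnorm2E /= /vnorm2 big_ord1.
Qed.

Section Nonneg.
Context (p m : nat) (X : 'M[C]_(p, m)) (d : 'I_m -> R) (e : R).
Hypothesis d0 : forall j, 0 <= d j.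
Local Notation G := (resolvent X d e).
Local Notation H := (pencil X d e).

Lemma qform_pencil_ge v : e * vnorm2 v <= qform H v.
Proof.
rewrite qform_pencil lerDr sumr_ge0 // => j _.
by rewrite mulr_ge0 ?d0 ?normc2_ge0.
Qed.

(** A left kernel vector, conjugated, makes the quadratic form vanish, whereas the form is at least
    e times the squared norm. *)
Lemma pencil_unit : 0 < e -> H \in unitmx.
Proof.
move=> e0; rewrite -row_free_unit -kermx_eq0; apply/rowV0P => v /sub_kermxP hv.
have hw : H *m v^h = 0 by rewrite -(pencil_herm X d e) -adjmxM hv /adjmx map_mx0 trmx0.
have := qform_pencil_ge v^h.
rewrite /qform -mulmxA hw mulmx0 mxE /= => h.
have /vnorm2_eq0 : vnorm2 v^h = 0.
  apply/eqP; rewrite eq_le vnorm2_ge0 andbT.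
  by rewrite -(pmulr_rle0 _ e0).
by move/(congr1 (@adjmx R _ _)); rewrite adjmxK => ->; rewrite /adjmx map_mx0 trmx0.
Qed.

Hypothesis Hu : H \in unitmx.

Lemma mul_pencil_resolvent : H *m G = 1%:M.
Proof. exact: mulmxV. Qed.

Lemma mul_resolvent_pencil : G *m H = 1%:M.
Proof. exact: mulVmx. Qed.

(** This is [G = G H G]; it carries lower bounds on the pencil over to the resolvent. *)
Lemma qform_resolvent v : qform G v = qform H (G *m v).
Proof.
by rewrite -qform_inner ?resolvent_herm // mul_resolvent_pencil mul1mx.
Qed.

Lemma qform_resolvent_ge v : e * vnorm2 (G *m v) <= qform G v.
Proof. by rewrite qform_resolvent qform_pencil_ge. Qed.

(** Take the trace of [H G = 1]: by cyclicity each column contributes its weighted form and the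
    ridge contributes e tr G. This conservation law later closes the equation for the mean trace. *)
Lemma ressum_all : ressum X d e xpredT + e * restrace X d e = p%:R.
Proof.
have : Re (\tr (H *m G)) = p%:R by rewrite mul_pencil_resolvent mxtrace1 -(rmorph_nat (real_complex R)).
rewrite pencil_sum mulmxDl mxtraceD ReD => <-; congr (_ + _).
  rewrite mulmx_suml (raddf_sum (@mxtrace _ p)) Re_sum; apply: eq_bigr => j _ /=.
  rewrite -scalemxAl mxtraceZ Re_rmul; congr (_ * _).
  by rewrite -mulmxA mxtrace_mulC /mxtrace big_ord1.
by rewrite mul_scalar_mx mxtraceZ Re_rmul.
Qed.

Lemma resolvent_diag i : G i i = (qform G (delta_mx i 0))%:C.
Proof.
rewrite -qformE ?resolvent_herm // mxE (bigD1 i) //= big1 ?addr0; last first.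
  by move=> k ki; rewrite [delta_mx _ _ k _]mxE (negbTE ki) mulr0.
rewrite mxE (bigD1 i) //= big1 ?addr0; last first.
  by move=> k ki; rewrite adjmxE !mxE (negbTE ki) conjc0 mul0r.
by rewrite adjmxE !mxE !eqxx conjc1 mul1r mulr1.
Qed.

Lemma mul_delta_col n k (A : 'M[C]_(n, k)) i : A *m delta_mx i 0 = col i A.
Proof. by rewrite colE. Qed.

Lemma resform_ge0 j : 0 <= e -> 0 <= resform X d e j.
Proof.
move=> e0; apply: le_trans (qform_resolvent_ge _).
by rewrite mulr_ge0 ?vnorm2_ge0.
Qed.

End Nonneg.

Section Positive.
Context (p m : nat) (X : 'M[C]_(p, m)) (d : 'I_m -> R) (e : R).
Hypothesis d0 : forall j, 0 <= d j.
Hypothesis e0 : 0 < e.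
Local Notation G := (resolvent X d e).
Local Notation H := (pencil X d e).

Lemma resform_ge0' j : 0 <= resform X d e j.
Proof. by apply: resform_ge0 => //; [exact: pencil_unit | exact: ltW]. Qed.

(** [G i i] is a value q of the form of G, so q is at least e times the squared norm of column i of
    G, hence at least e q^2, because q is itself a coordinate of that column. *)
Lemma resolvent_diag_bound i : 0 <= Re (G i i) <= e^-1.
Proof.
have Hu := pencil_unit X d0 e0.
have h := qform_resolvent_ge d0 Hu (delta_mx i 0).
rewrite resolvent_diag /=.
set q := qform _ _ in h *.
have hq : normc2 (G i i) <= vnorm2 (G *m delta_mx i 0).
  rewrite /vnorm2 (bigD1 i) //= mul_delta_col mxE lerDl sumr_ge0 // => k _.
  exact: normc2_ge0.
rewrite resolvent_diag -/q /normc2 /= expr0n addr0 in hq.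
have q0 : 0 <= q by apply: le_trans h; rewrite mulr_ge0 ?vnorm2_ge0 // ltW.
rewrite q0 /=; have [->|qn] := eqVneq q 0; first by rewrite invr_ge0 ltW.
have qp : 0 < q by rewrite lt_neqAle eq_sym qn.
rewrite -(ler_pM2l qp) -expr2 (le_trans hq) // -(ler_pM2l e0) (le_trans h) //.
by rewrite mulrCA divff ?mulr1 ?gt_eqF.
Qed.

Lemma restrace_bound : 0 <= restrace X d e <= p%:R / e.
Proof.
rewrite /restrace /mxtrace Re_sum; apply/andP; split.
  by apply: sumr_ge0 => i _; have /andP[] := resolvent_diag_bound i.
have -> : p%:R / e = \sum_(i < p) e^-1 by rewrite sumr_const card_ord mulr_natl.
 apply: ler_sum => i _.
by have /andP[] := resolvent_diag_bound i.
Qed.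

Lemma ressum_bound J : 0 <= ressum X d e J <= p%:R.
Proof.
have h j : 0 <= d j * resform X d e j by rewrite mulr_ge0 ?resform_ge0'.
apply/andP; split; first by apply: sumr_ge0.
have Hu := pencil_unit X d0 e0.
rewrite -(ressum_all Hu) -[leLHS]addr0 lerD //; last first.
  by rewrite mulr_ge0 ?(ltW e0)//; have /andP[] := restrace_bound.
rewrite /ressum [leRHS](bigID J) /= lerDl; exact: sumr_ge0.
Qed.

(** Write H = K + e I with K positive semidefinite. For w = G e_i the squared norm of H w, which is
    1, expands into three non-negative terms, the last of which is e^2 times the squared norm of
    w. *)
Lemma resolvent_col_bound i : \sum_k normc2 (G k i) <= e ^- 2.
Proof.
have Hu := pencil_unit X d0 e0.
pose w := G *m (delta_mx i 0 : 'cV_p).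
have hw : \sum_k normc2 (G k i) = vnorm2 w.
  by apply: eq_bigr => k _; rewrite /w mul_delta_col mxE.
have hv : H *m w = delta_mx i 0 by rewrite /w mulmxA mul_pencil_resolvent // mul1mx.
have n1 : vnorm2 (H *m w) = 1.
  rewrite hv /vnorm2 (bigD1 i) //= big1 ?addr0 => [|k ki].
    by rewrite mxE !eqxx /normc2 /= expr1n expr0n addr0.
  by rewrite mxE (negbTE ki) /normc2 /= expr0n addr0.
rewrite hw; suff : e ^+ 2 * vnorm2 w <= 1.
  by rewrite -ler_pdivlMl ?exprn_gt0 // mulr1.
pose K := pencil X d 0.
have HK : H = K + e%:C%:M by rewrite /K pencil.unlock [in RHS]/real_complex_def /= raddf0 addr0.
have hK : K^h = K by exact: pencil_herm.
have hK0 : 0 <= qform K w by have := qform_pencil_ge X 0 d0 w; rewrite mul0r.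
move: K HK hK hK0 => K HK hK hK0.
rewrite -n1 HK mulmxDl mul_scalar_mx.
have -> : vnorm2 (K *m w + e%:C *: w) =
   vnorm2 (K *m w) + 2 * e * qform K w + e ^+ 2 * vnorm2 w.
  suff -> : vnorm2 (K *m w + e%:C *: w) = qform (K *m K + (2 * e)%:C *: K + (e ^+ 2)%:C%:M) w.
    have -> : K *m K = K^h *m K by rewrite hK.
    by rewrite !qformD qformZ qform_scalar qform_gram.
  rewrite -mul_scalar_mx -mulmxDl -qform_gram adjmxD hK adjmx_scalar conjc_real.
  congr qform; rewrite mulmxDl !mulmxDr -!addrA; congr (_ + _).
  rewrite mul_mx_scalar mul_scalar_mx addrA -scalerDl -rmorphD /= -scalar_mxM -rmorphM /=.
  by rewrite -mulr2n mulr_natl expr2.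
by rewrite lerDr addr_ge0 ?vnorm2_ge0 // mulr_ge0 ?mulr_ge0 // ?(ltW e0).
Qed.

End Positive.

End Resolvent.

(** * Removing one column: rank-one updates and bounded differences *)

Section RankOneUpdate.
Context (R : realType).
Local Notation C := R[i].
Local Notation "x %:C" := (real_complex R x).
Local Notation Re := (@complex.Re R).
Local Notation "A ^h" := (adjmx A) (at level 8, format "A ^h").

Lemma invmx_unique n (A B : 'M[C]_n) : A *m B = 1%:M -> invmx A = B.
Proof.
move=> AB; have [Au _] := mulmx1_unit AB.
by rewrite -[LHS]mulmx1 -AB mulmxA mulVmx // mul1mx.
Qed.

Lemma pencil_off_col p m (X X' : 'M[C]_(p, m)) (d : 'I_m -> R) e j : d j = 0 ->
  (forall i k, k != j -> X i k = X' i k) -> pencil X d e = pencil X' d e.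
Proof.
move=> dj h; rewrite !pencil_sum.
suff -> : \sum_k (d k)%:C *: (col k X *m (col k X)^h) =
  \sum_k (d k)%:C *: (col k X' *m (col k X')^h) by [].
apply: eq_bigr => k _; have [->|kj] := eqVneq k j; first by rewrite dj !scale0r.
have -> // : col k X = col k X' by apply/matrixP => i l; rewrite !mxE h.
Qed.

Lemma drop_wt_ge0 m (d : 'I_m -> R) j : (forall k, 0 <= d k) -> forall k, 0 <= drop_wt d j k.
Proof. by move=> d0 k; rewrite /drop_wt; case: ifP. Qed.
Lemma drop_wt_id m (d : 'I_m -> R) j : drop_wt d j j = 0.
Proof. by rewrite /drop_wt eqxx. Qed.

Lemma pencil_drop p m (X : 'M[C]_(p, m)) (d : 'I_m -> R) e j :
  pencil X d e = pencil X (drop_wt d j) e + (d j)%:C *: (col j X *m (col j X)^h).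
Proof.
rewrite !pencil_sum addrAC; congr (_ + _).
rewrite (bigD1 j) //= [in RHS](bigD1 j) //= drop_wt_id scale0r add0r addrC.
by congr (_ + _); apply: eq_bigr => k kj; rewrite /drop_wt (negbTE kj).
Qed.

Section Update.
Context (p m : nat) (X : 'M[C]_(p, m)) (d : 'I_m -> R) (e : R) (j : 'I_m).
Hypothesis d0 : forall k, 0 <= d k.
Hypothesis e0 : 0 < e.
Local Notation G' := (resolvent X (drop_wt d j) e).
Local Notation x := (col j X).
Local Notation q := (resform X (drop_wt d j) e j).
Local Notation c := (d j / (1 + d j * q)).

Let d'0 := drop_wt_ge0 j d0.
Let q0 : 0 <= q := resform_ge0' X d'0 e0 j.
Let dq1 : 0 < 1 + d j * q.
Proof. by rewrite ltr_pwDl // mulr_ge0. Qed.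
Let c0 : 0 <= c.
Proof. by rewrite divr_ge0 // ltW. Qed.
Let Hu' := pencil_unit X d'0 e0.

(** Sherman-Morrison, checked by multiplying out: the product of the two rank-one terms collapses
    because x^h G' x is the scalar q. *)
Lemma resolvent_update :
  resolvent X d e = G' - c%:C *: (G' *m (x *m x^h) *m G').
Proof.
apply: invmx_unique; rewrite (pencil_drop _ _ _ j) mulmxDl !mulmxBr.
rewrite mul_pencil_resolvent // -!scalemxAr -!scalemxAl.
rewrite [in X in 1%:M - X](mulmxA (pencil _ _ _)) (mulmxA (pencil _ _ _)) mul_pencil_resolvent // mul1mx.
have -> : x *m x^h *m (G' *m (x *m x^h) *m G') = q%:C *: (x *m x^h *m G').
  have -> : x *m x^h *m (G' *m (x *m x^h) *m G') = x *m (x^h *m G' *m x) *m (x^h *m G').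
    by rewrite !mulmxA.
  have -> : x^h *m G' *m x = q%:C%:M.
    by rewrite [LHS]mx11_scalar qformE // resolvent_herm.
  by rewrite mul_mx_scalar -scalemxAl mulmxA.
rewrite !scalerA -!addrA -[RHS]addr0; congr (_ + _).
rewrite -scaleNr -scalerBl -scalerDl -!rmorphM -rmorphB -rmorphN -rmorphD /=.
suff -> : - c + (d j - c * d j * q) = 0 by rewrite rmorph0 scale0r.
by field; rewrite gt_eqF.
Qed.

Lemma resform_update k : resform X d e k =
  resform X (drop_wt d j) e k - c * normc2 (((col k X)^h *m (G' *m x)) 0 0).
Proof.
rewrite {1}/resform resolvent_update qformD qformN qformZ; congr (_ - _ * _).
rewrite qform_inner ?resolvent_herm // /qform.
set a := col k X; have -> : (G' *m a)^h *m (x *m x^h) *m (G' *m a) =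
  (a^h *m (G' *m x)) *m (a^h *m (G' *m x))^h.
  by rewrite !adjmxM adjmxK resolvent_herm !mulmxA.
by rewrite mxE big_ord1 adjmxE mulrC normc2E.
Qed.

(** The right side depends on G' only, which is built from the other columns and is therefore
    independent of column j. *)
Lemma resform_own : d j * resform X d e j = d j * q / (1 + d j * q).
Proof.
rewrite resform_update mulmxA.
have := @qformE R _ G' x; rewrite resolvent_herm => ->//.
rewrite -/(resform _ _ _ _) /normc2 /= expr0n addr0.
by field; rewrite gt_eqF.
Qed.

(** [G' = G' H' G'] evaluated at column j. It splits q into non-negative parts, so each of them is
    at most q; both removal estimates below rest on this. *)
Lemma qform_drop : \sum_k drop_wt d j k * normc2 (((col k X)^h *m (G' *m x)) 0 0) +
  e * vnorm2 (G' *m x) = q.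
Proof. by rewrite -qform_pencil -qform_resolvent. Qed.

Lemma restrace_update : restrace X d e = restrace X (drop_wt d j) e - c * vnorm2 (G' *m x).
Proof.
rewrite /restrace resolvent_update raddfB /= ReB mxtraceZ Re_rmul; congr (_ - _ * _).
have -> : G' *m (x *m x^h) *m G' = (G' *m x) *m (G' *m x)^h.
  by rewrite adjmxM resolvent_herm !mulmxA.
by rewrite mxtrace_mulC /mxtrace big_ord1 vnorm2E.
Qed.

Let cq1 : c * q <= 1.
Proof. by rewrite mulrAC ler_pdivrMr // mul1r lerDr. Qed.

(** The difference is c times the squared norm of G' x, while e times that norm is at most q and c q
    <= 1. The bound is uniform in the column, so unbounded entries still give bounded
    differences. *)
Lemma restrace_drop : 0 <= restrace X (drop_wt d j) e - restrace X d e <= e^-1.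
Proof.
rewrite restrace_update opprB addrC subrK mulr_ge0 ?vnorm2_ge0 //=.
rewrite -(ler_pM2l e0) mulfV ?gt_eqF // mulrCA (le_trans _ cq1) //.
rewrite ler_wpM2l // -qform_drop lerDr sumr_ge0 // => k _.
by rewrite mulr_ge0 ?normc2_ge0.
Qed.

(** Giving column j its weight back adds its own term t, in [0, 1], and lowers the other terms by c
    s in total, where c s <= c q <= 1. The two effects have opposite signs. *)
Lemma ressum_drop J : `|ressum X d e J - ressum X (drop_wt d j) e J| <= 1.
Proof.
pose b k := normc2 (((col k X)^h *m (G' *m x)) 0 0).
pose s := \sum_(k | J k) drop_wt d j k * b k.
pose t := if J j then d j * q / (1 + d j * q) else 0.
have -> : ressum X d e J - ressum X (drop_wt d j) e J = t - c * s.
  rewrite -sumrB mulr_sumr /t.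
  rewrite big_mkcond (bigD1 j) //= [in RHS]big_mkcond [in RHS](bigD1 j) //=.
  have -> : (if J j then c * (drop_wt d j j * b j) else 0) = 0.
    by rewrite drop_wt_id mul0r mulr0 if_same.
  rewrite add0r; congr (_ + _).
    by case: (J j) => //; rewrite drop_wt_id mul0r subr0; apply: resform_own.
  rewrite -sumrN; apply: eq_bigr => k kj; case: ifP; rewrite ?oppr0// => _.
  rewrite resform_update /drop_wt (negbTE kj) -/(b k); rewrite -/c; ring.
have s0 : 0 <= s by apply: sumr_ge0 => k _; rewrite mulr_ge0 ?normc2_ge0.
have sq : s <= q.
  rewrite -[leRHS]qform_drop (bigID J) /= -addrA lerDl addr_ge0 //.
    by apply: sumr_ge0 => k _; rewrite mulr_ge0 ?normc2_ge0.
  by rewrite mulr_ge0 ?vnorm2_ge0 // ltW.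
have cs : c * s <= 1 by rewrite (le_trans _ cq1) // ler_wpM2l.
have cs0 : 0 <= c * s by rewrite mulr_ge0.
have : 0 <= t <= 1.
  rewrite /t; case: ifP => _; last by rewrite lexx ler01.
  by rewrite mulrAC mulr_ge0.
by rewrite ler_norml => /andP[? ?]; lra.
Qed.

End Update.

Section BoundedDifferences.
Context (p m : nat) (X X' : 'M[C]_(p, m)) (d : 'I_m -> R) (e : R) (j : 'I_m).
Hypothesis d0 : forall k, 0 <= d k.
Hypothesis e0 : 0 < e.
Hypothesis XX' : forall i k, k != j -> X i k = X' i k.

Let RR : resolvent X (drop_wt d j) e = resolvent X' (drop_wt d j) e.
Proof. by rewrite /resolvent (pencil_off_col _ _ XX') // drop_wt_id. Qed.

(** Both traces lie at most 1 / e below the trace with column j removed, which X and X' share. *)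
Lemma restrace_diff : `|restrace X d e - restrace X' d e| <= e^-1.
Proof.
have /andP[] := restrace_drop X j d0 e0; have /andP[] := restrace_drop X' j d0 e0.
have -> : restrace X (drop_wt d j) e = restrace X' (drop_wt d j) e by rewrite /restrace RR.
move: (restrace X d e) (restrace X' d e) (restrace X' _ e) => u v w.
by move=> ? ? ? ?; rewrite ler_norml; lra.
Qed.

Lemma ressum_diff J : `|ressum X d e J - ressum X' d e J| <= 2.
Proof.
have := ressum_drop X j d0 e0 J; have := ressum_drop X' j d0 e0 J.
suff -> : ressum X' (drop_wt d j) e J = ressum X (drop_wt d j) e J.
  move: (ressum X d e J) (ressum X' d e J) (ressum X _ e J) => u v w.
  by rewrite !ler_norml => /andP[? ?] /andP[? ?]; lra.
apply: eq_bigr => k _; have [->|kj] := eqVneq k j; first by rewrite drop_wt_id !mul0r.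
rewrite /resform -RR; congr (_ * qform _ _).
by apply/matrixP => i l; rewrite !mxE XX'.
Qed.

End BoundedDifferences.

(** Every summand decreases when the ridge is added, so the loss over J is at most the loss over all
    columns, and by [ressum_all] at 0 and at e the latter is exactly e tr G. The estimate asks for
    no bound on the smallest eigenvalue. *)
Lemma ressum_reg p m (X : 'M[C]_(p, m)) d e J : (forall k, 0 <= d k) -> 0 < e ->
  pencil X d 0 \in unitmx ->
  0 <= ressum X d 0 J - ressum X d e J <= e * restrace X d e.
Proof.
move=> d0 e0 u0; have ue := pencil_unit X d0 e0.
have main k : 0 <= d k * resform X d 0 k - d k * resform X d e k.
  rewrite -mulrBr mulr_ge0 //.
  pose G0 := resolvent X d 0; pose G := resolvent X d e.
  have HH : pencil X d e = pencil X d 0 + e%:C%:M.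
    have z : (0%:C)%:M = 0 :> 'M[C]_p by apply/matrixP => i l; rewrite !mxE mul0rn.
    by rewrite pencil.unlock z addr0.
  (* The resolvent identity, used twice, gives [G0 - G = e (G G + e G G0 G)], where both summands
     are positive semidefinite. *)
  have E1 : G0 = G + e%:C *: (G *m G0).
    rewrite -{1}[G0]mul1mx -(mul_resolvent_pencil ue) HH mulmxDr mulmxDl -/G.
    rewrite -mulmxA mul_pencil_resolvent // mulmx1; congr (_ + _).
    by rewrite mul_mx_scalar -scalemxAl.
  have E2 : G0 = G + e%:C *: (G0 *m G).
    have := congr1 (@adjmx R _ _) E1.
    by rewrite adjmxD adjmxZ adjmxM !resolvent_herm conjc_real.
  have E3 : G0 *m G = G *m G + e%:C *: (G *m G0 *m G).
    by have := congr1 (mulmx^~ G) E1; rewrite mulmxDl -scalemxAl; apply.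
  rewrite /resform -/G0 -/G {1}E2 qformD qformZ addrAC subrr add0r mulr_ge0 ?(ltW e0) //.
  rewrite E3 qformD qformZ addr_ge0 //.
    rewrite -[X in X *m _](resolvent_herm X d e) qform_gram; exact: vnorm2_ge0.
  rewrite mulr_ge0 ?(ltW e0) // qform_inner ?resolvent_herm //.
  by apply: le_trans (qform_resolvent_ge d0 u0 _); rewrite mul0r.
rewrite -sumrB sumr_ge0 //=.
have h0 := ressum_all u0; have he := ressum_all ue.
rewrite mul0r addr0 in h0.
have -> : e * restrace X d e = ressum X d 0 xpredT - ressum X d e xpredT.
  by rewrite h0 -he addrC addKr.
rewrite -sumrB [leRHS](bigID J) /= lerDl; exact: sumr_ge0.
Qed.

End RankOneUpdate.

(** * The spectrum of S A^-1 for ordered positive semidefinite S and A *)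

Section Eigenvalues.
Context (R : realType).
Local Notation C := R[i].
Local Notation "x %:C" := (real_complex R x).
Local Notation Re := (@complex.Re R).
Local Notation Im := (@complex.Im R).
Local Notation "A ^h" := (adjmx A) (at level 8, format "A ^h").

Lemma eigseqP n (A : 'M[C]_n) : char_poly A = \prod_(z <- eigseq A) ('X - z%:P).
Proof.
rewrite /eigseq; case: pselect => [h|]; first by case: (cid h).
case; have [r hr] := closed_field_poly_normal (char_poly A).
by exists r; rewrite {1}hr (monicP (char_poly_monic A)) scale1r.
Qed.

Lemma size_eigseq n (A : 'M[C]_n) : size (eigseq A) = n.
Proof.
by have := size_char_poly A; rewrite (eigseqP A) size_prod_XsubC => -[].
Qed.

Lemma char_poly_similar (F : comUnitRingType) n (P A : 'M[F]_n) : P \in unitmx ->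
  char_poly (P *m A *m invmx P) = char_poly A.
Proof.
move=> Pu; rewrite /char_poly /char_poly_mx !map_mxM.
set Q := map_mx _ P; set Q' := map_mx _ (invmx P).
have QQ : Q *m Q' = 1%:M by rewrite -map_mxM mulmxV // map_mx1.
have -> : 'X%:M - Q *m map_mx polyC A *m Q' = Q *m ('X%:M - map_mx polyC A) *m Q'.
  by rewrite mulmxBr mulmxBl scalar_mxC -(mulmxA 'X%:M Q) QQ mulmx1.
by rewrite !det_mulmx mulrAC -det_mulmx QQ det1 mul1r.
Qed.

Lemma trig_mul_diag (F : fieldType) n (L K : 'M[F]_n) : is_trig_mx L ->
  (forall i, L i i != 0) -> L *m K = 1%:M -> forall i, K i i = (L i i)^-1.
Proof.
move=> /is_trig_mxP Lt L0 LK.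
(* The inverse of a lower triangular matrix is lower triangular, by strong induction on the row; [k]
   bounds the row. *)
have Kt : forall k (i j : 'I_n), (i < k)%N -> (i < j)%N -> K i j = 0.
  elim=> // k IH i j ik ij.
  have : (L *m K) i j = 0 by rewrite LK mxE -val_eqE (ltn_eqF ij).
  rewrite mxE (bigD1 i) //= big1 ?addr0 => [/eqP|l li].
    by rewrite mulf_eq0 (negbTE (L0 i)) => /eqP.
  have [il|/ltnW li'|/val_inj e] := ltngtP i l; first by rewrite Lt ?mul0r.
    have li2 : (l < i)%N by rewrite ltn_neqAle li' andbT; apply: contra li => /eqP/val_inj ->.
    by rewrite IH ?mulr0 // (leq_trans li2) // ltnW.
  by rewrite e eqxx in li.
move=> i; have : (L *m K) i i = 1 by rewrite LK mxE eqxx.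
rewrite mxE (bigD1 i) //= big1 ?addr0 => [h|l li].
  by apply: (mulfI (L0 i)); rewrite h mulfV.
have [il|li'|/val_inj e] := ltngtP i l; first by rewrite Lt ?mul0r.
  by rewrite (Kt l.+1) ?mulr0.
by rewrite e eqxx in li.
Qed.

(** B need not be Hermitian, so it is brought to triangular form by Schur's theorem: the eigenvalues
    are then the diagonal entries, and the inverse of a triangular matrix has the reciprocal
    diagonal. *)
Lemma trace_resolvent_eigseq n (B : 'M[C]_n) (x : C) : (0 < n)%N ->
  (forall z, z \in eigseq B -> z + x != 0) ->
  \tr (invmx (B + x%:M)) = \sum_(z <- eigseq B) (z + x)^-1.
Proof.
move=> n0 hx; have [P Pu] := Schur B n0.
have {}Pu := unitarymx_unit Pu.
rewrite /similar_to conjumx //; set T := P *m B *m _ => Tt.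
have hperm : perm_eq (eigseq B) [seq T i i | i <- enum 'I_n].
  apply: prod_XsubC_eq; rewrite -eigseqP -(char_poly_similar B Pu) char_poly_trig //.
  by rewrite big_map big_enum.
have T0 i : (T + x%:M) i i != 0.
  rewrite !mxE eqxx mulr1n hx // (perm_mem hperm); apply/mapP.
  by exists i; rewrite ?mem_enum // mxE.
have Tt' : is_trig_mx (T + x%:M).
  by apply/is_trig_mxP => i j ij; rewrite mxE (is_trig_mxP Tt) // mxE -val_eqE (ltn_eqF ij) addr0.
have Tu : T + x%:M \in unitmx.
  rewrite unitmxE det_trig // unitfE; apply/prodf_neq0 => i _; exact: T0.
have BT : B + x%:M = invmx P *m (T + x%:M) *m P.
  rewrite mulmxDr mulmxDl /T !mulmxA mulVmx // mul1mx mulmxKV //.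
  by rewrite scalar_mxC mulmxKV.
have -> : invmx (B + x%:M) = invmx P *m invmx (T + x%:M) *m P.
  apply: invmx_unique; rewrite BT -!mulmxA (mulmxA P) mulmxV // mul1mx.
  by rewrite (mulmxA (T + _)) mulmxV // mul1mx mulVmx.
rewrite -mulmxA mxtrace_mulC -mulmxA mulmxV // mulmx1.
rewrite (perm_big _ hperm) big_map big_enum /mxtrace /=.
apply: eq_bigr => i _; rewrite (trig_mul_diag Tt' T0 (mulmxV Tu)).
by rewrite !mxE eqxx mulr1n.
Qed.

Lemma generalized_eigenvector p (S A : 'M[C]_p) (v : 'rV[C]_p) z : S^h = S -> A^h = A ->
  v *m S = z *: (v *m A) -> (qform S v^h)%:C = z * (qform A v^h)%:C.
Proof. by move=> hS hA hv; rewrite -!qformE // adjmxK hv -scalemxAl mxE. Qed.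

Lemma eigen_row p (S A : 'M[C]_p) (v : 'rV[C]_p) z : A \in unitmx ->
  v *m (S *m invmx A) = z *: v -> v *m S = z *: (v *m A).
Proof. by move=> Au hv; rewrite scalemxAl -hv -!mulmxA mulVmx // mulmx1. Qed.

Section Pencils.
Context (p m : nat) (M : 'M[C]_(p, m)) (dS dA : 'I_m -> R).
Hypothesis dS0 : forall j, 0 <= dS j.
Hypothesis dSA : forall j, dS j <= dA j.
Local Notation S := (pencil M dS 0).
Local Notation A := (pencil M dA 0).
Hypothesis Au : A \in unitmx.

Let dA0 j : 0 <= dA j. Proof. exact: le_trans (dSA j). Qed.

(** If the form vanishes at v, then every column of positive weight is orthogonal to v, so the
    pencil itself annihilates v. *)
Lemma qform_unit_gt0 (d : 'I_m -> R) v : (forall j, 0 <= d j) ->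
  pencil M d 0 \in unitmx -> v != 0 -> 0 < qform (pencil M d 0) v.
Proof.
move=> d0 Du v0; rewrite lt_neqAle; apply/andP; split; last first.
  by apply: le_trans (qform_pencil_ge M 0 d0 v); rewrite mul0r.
apply: contra v0 => /eqP/esym; rewrite qform_pencil mul0r addr0.
move/psumr_eq0P => h.
have {}h j : (d j)%:C *: (col j M *m ((col j M)^h *m v)) = 0.
  have /eqP := h (fun j _ => mulr_ge0 (d0 j) (normc2_ge0 _)) j isT.
  rewrite mulf_eq0 => /orP[/eqP ->|hn]; first by rewrite scale0r.
  suff -> : (col j M)^h *m v = 0 by rewrite mulmx0 scaler0.
  by apply: vnorm2_eq0; rewrite /vnorm2 big_ord1; exact/eqP.
have hv : pencil M d 0 *m v = 0.
  rewrite pencil_sum mulmxDl mulmx_suml big1 => [|j _]; last by rewrite -scalemxAl -mulmxA h.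
  by apply/matrixP => i k; rewrite add0r mul_scalar_mx scale0r.
by rewrite -[v]mul1mx -(mulVmx Du) -mulmxA hv mulmx0.
Qed.

Lemma pencilD (d d' : 'I_m -> R) x :
  pencil M (fun j => d j + x * d' j) 0 = pencil M d 0 + x%:C *: pencil M d' 0.
Proof.
have z : (0%:C)%:M = 0 :> 'M[C]_p by apply/matrixP => i l; rewrite !mxE mul0rn.
rewrite !pencil_sum z !addr0 scaler_sumr -big_split /=; apply: eq_bigr => j _.
by rewrite rmorphD rmorphM /= scalerDl scalerA.
Qed.

Lemma pencil_add_unit x : 0 < x -> pencil M (fun j => dS j + x * dA j) 0 \in unitmx.
Proof.
move=> x0; set H := pencil _ _ _.
rewrite -row_free_unit -kermx_eq0; apply/rowV0P => v /sub_kermxP hv.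
have hw : H *m v^h = 0 by rewrite -[H]pencil_herm -adjmxM hv /adjmx map_mx0 trmx0.
apply/eqP; apply/negPn/negP => v0.
have v0' : v^h != 0.
  by apply: contra v0 => /eqP h; rewrite -[v]adjmxK h /adjmx map_mx0 trmx0.
have : 0 < qform H v^h.
  rewrite /H pencilD qformD qformZ ltr_wpDl //; last first.
    by rewrite mulr_gt0 // qform_unit_gt0.
  by apply: le_trans (qform_pencil_ge M 0 dS0 _); rewrite mul0r.
by rewrite /qform -mulmxA hw mulmx0 mxE ltxx.
Qed.

(** At a left eigenvector z is the Rayleigh quotient of S with respect to A, and the forms satisfy 0
    <= S <= A because the weights do. *)
Lemma eigseq_unit_interval z : z \in eigseq (S *m invmx A) ->
  [/\ Im z = 0, 0 <= Re z & Re z <= 1].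
Proof.
move=> zE.
have : root (char_poly (S *m invmx A)) z by rewrite eigseqP root_prod_XsubC.
rewrite -eigenvalue_root_char => /eigenvalueP [v hv v0].
have {}hv := eigen_row Au hv.
have v0' : v^h != 0.
  by apply: contra v0 => /eqP h; rewrite -[v]adjmxK h /adjmx map_mx0 trmx0.
have hA := qform_unit_gt0 dA0 Au v0'.
have E := generalized_eigenvector (pencil_herm M dS 0) (pencil_herm M dA 0) hv.
have hS : 0 <= qform S v^h.
  by apply: le_trans (qform_pencil_ge M 0 dS0 _); rewrite mul0r.
have hSA : qform S v^h <= qform A v^h.
  rewrite (qform_pencil M dS) (qform_pencil M dA) lerD2r; apply: ler_sum => j _.
  by rewrite ler_wpM2r ?normc2_ge0.
move: E hA hS hSA; move: (qform S v^h) => s; move: (qform A v^h) => t E hA hS hSA.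
move: E hA hS hSA.
case: z {zE hv} => a b /= [E1 E2] t0 s0 st.
have b0 : b = 0.
  have : b * t = 0 by lra.
  by move/eqP; rewrite mulf_eq0 (gt_eqF t0) orbF => /eqP.
have {}E1 : s = a * t by rewrite E1; ring.
split => //; first by rewrite -(pmulr_lge0 _ t0) -E1.
by rewrite -(ler_pM2r t0) -E1 mul1r.
Qed.

(** With H = S + x A one has B + x = H A^-1, so the resolvent of B is A H^-1; substituting x A = H -
    S turns x times its trace into p minus the trace of S H^-1. *)
Lemma sum_eigseq x : (0 < p)%N -> 0 < x ->
  x * \sum_(z <- eigseq (S *m invmx A)) (Re z + x)^-1 =
  p%:R - \sum_j dS j * resform M (fun j => dS j + x * dA j) 0 j.
Proof.
move=> p0 x0; set B := S *m invmx A; set D := fun j : 'I_m => _.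
have Hu := pencil_add_unit x0; rewrite -/D in Hu.
have rE z : z \in eigseq B -> z + x%:C = (Re z + x)%:C.
  move=> /eigseq_unit_interval[]; case: z => a b /= -> _ _.
  by rewrite rmorphD.
have nz z : z \in eigseq B -> z + x%:C != 0.
  move=> zE; rewrite rE // fmorph_eq0 gt_eqF //.
  by have [_ ? _] := eigseq_unit_interval zE; rewrite ltr_wpDl.
have H := trace_resolvent_eigseq p0 nz.
have -> : \sum_(z <- eigseq B) (Re z + x)^-1 = Re (\tr (invmx (B + x%:C%:M))).
  rewrite H Re_sum big_seq_cond [RHS]big_seq_cond; apply: eq_bigr => z /andP[zE _].
  by rewrite rE // -fmorphV.
have HB : pencil M D 0 = (B + x%:C%:M) *m A.
  by rewrite pencilD mulmxDl -mulmxA mulVmx // mulmx1 mul_scalar_mx.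
have -> : invmx (B + x%:C%:M) = A *m resolvent M D 0.
  apply: invmx_unique.
  by rewrite mulmxA -HB mul_pencil_resolvent.
have HS : Re (\tr (S *m resolvent M D 0)) = \sum_j dS j * resform M D 0 j.
  have z : (0%:C)%:M = 0 :> 'M[C]_p by apply/matrixP => i l; rewrite !mxE mul0rn.
  rewrite pencil_sum z addr0 mulmx_suml (raddf_sum (@mxtrace _ p)) Re_sum; apply: eq_bigr => j _ /=.
  rewrite -scalemxAl mxtraceZ Re_rmul; congr (_ * _).
  by rewrite -mulmxA mxtrace_mulC /mxtrace big_ord1.
rewrite -Re_rmul -mxtraceZ scalemxAl -HS.
have -> : x%:C *: A = pencil M D 0 - S by rewrite pencilD addrAC subrr add0r.
rewrite mulmxBl mul_pencil_resolvent // raddfB /= ReB mxtrace1; congr (_ - _).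
by rewrite -(rmorph_nat (real_complex R)).
Qed.

End Pencils.

End Eigenvalues.

(** * Resampling and bounded differences *)

Section Configurations.
Context (R : realType) (I : Type).

Definition rectangle (A : I -> bool -> set R) : set (I -> bool -> R) :=
  [set z | forall i b, A i b (z i b)].
Definition rectangles : set (set (I -> bool -> R)) :=
  [set B | exists2 A, (forall i b, measurable (A i b)) & B = rectangle A].
(* A copy of I -> bool -> R measured by the rectangles on which mutual independence is stated. *)
Definition config := g_sigma_algebraType rectangles.

Lemma setI_closed_rectangles : setI_closed rectangles.
Proof.
move=> _ _ [A mA ->] [B mB ->]; exists (fun i b => A i b `&` B i b).
  by move=> i b; apply: measurableI.
apply/seteqP; split => z /=; first by move=> [hA hB] i b.
by move=> h; split => i b; case: (h i b).
Qed.

Lemma measurable_rectangle A : (forall i b, measurable (A i b)) ->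
  measurable (rectangle A : set config).
Proof. by move=> mA; apply: sub_sigma_algebra; exists A. Qed.

End Configurations.

Arguments config R I : clear implicits.
HB.instance Definition _ (R : realType) I :=
  Measurable.copy (config R I) (g_sigma_algebraType (@rectangles R I)).

Section ConfigurationMaps.
Context (R : realType) (I : finType).

Lemma measurable_coord (i : I) b : measurable_fun setT (fun z : config R I => z i b).
Proof.
move=> _ B mB; rewrite setTI; apply: sub_sigma_algebra.
exists (fun i' b' => if (i' == i) && (b' == b) then B else setT).
  by move=> i' b'; case: ifP => _ //; exact: measurableT.
apply/seteqP; split => z /=.
  by move=> Bz i' b'; case: ifP => // /andP[/eqP -> /eqP ->].
by move=> /(_ i b); rewrite !eqxx.
Qed.

Lemma measurable_config d (T : measurableType d) (f : T -> config R I) :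
  (forall i b, measurable_fun setT (fun w => f w i b)) -> measurable_fun setT f.
Proof.
move=> mf; apply: (@measurability _ _ _ _ setT f (@rectangles R I)) => //.
move=> _ [_ [A mA ->] <-]; rewrite setTI.
have -> : f @^-1` rectangle A =
    \bigcap_(i in [set: I]) \bigcap_(b in [set: bool]) ((fun w => f w i b) @^-1` A i b).
  apply/seteqP; split => w /=; first by move=> h i _ b _; exact: h.
  by move=> h i b; exact: (h i Logic.I b Logic.I).
apply: fin_bigcap_measurable => // i _.
apply: fin_bigcap_measurable => // b _.
by rewrite -[X in measurable X]setTI; exact: mf.
Qed.

Definition mix (J : pred I) (z z' : config R I) : config R I :=
  fun i b => if J i then z' i b else z i b.

Lemma measurable_mix (J : pred I) d (T : measurableType d) (f g : T -> config R I) :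
  measurable_fun setT f -> measurable_fun setT g ->
  measurable_fun setT (fun w => mix J (f w) (g w)).
Proof.
move=> mf mg; apply: measurable_config => i b; rewrite /mix; case: (J i).
  exact: (measurableT_comp (measurable_coord i b) mg).
exact: (measurableT_comp (measurable_coord i b) mf).
Qed.

End ConfigurationMaps.

Section Resampling.
Context (R : realType) d (T : measurableType d) (P : probability T R).
Context (I : finType) (Z : I -> bool -> T -> R).
Hypothesis mZ : forall i b, measurable_fun setT (Z i b).
Hypothesis indepZ : mutually_independent P Z.
Local Open Scope ereal_scope.

Definition sample (w : T) : config R I := fun i b => Z i b w.
(** A version of the conditional expectation given the coordinates outside J: those in J are
    integrated out over a second copy of the sample. *)
Definition resample (J : pred I) (f : config R I -> \bar R) (z : config R I) : \bar R :=
  \int[P]_w f (mix J z (sample w)).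

Lemma measurable_sample : measurable_fun setT sample.
Proof. by apply: measurable_config => i b; exact: mZ. Qed.

Let mix2 J (ww : T * T) := mix J (sample ww.1) (sample ww.2).

Let measurable_mix2 J : measurable_fun setT (mix2 J).
Proof.
apply: measurable_mix.
  exact: (measurableT_comp measurable_sample measurable_fst).
exact: (measurableT_comp measurable_sample measurable_snd).
Qed.

Lemma sample_rectangle A : (forall i b, measurable (A i b)) ->
  P (sample @^-1` rectangle A) =
  \prod_(i : I) P (\bigcap_(b in [set: bool]) (Z i b @^-1` A i b)).
Proof.
move=> mA; rewrite -indepZ //; congr (P _).
apply/seteqP; split => w /=; first by move=> h i _ b _; exact: h.
by move=> h i b; exact: (h i Logic.I b Logic.I).
Qed.

(** Independence in the form in which it is used: drawing the coordinates in J from an independent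
    copy does not change the law. On a rectangle both sides factor over the coordinates, and the
    rectangles are a generating pi-system. *)
Lemma resample_law J (B : set (config R I)) : measurable B ->
  pushforward P sample B = pushforward (P \x P) (mix2 J) B.
Proof.
move=> mB.
pose m1 := pushforward P sample.
pose m2 := pushforward (P \x P) (mix2 J).
pose m1m := isMeasurableFun.Build _ _ _ _ _ measurable_sample.
pose f1 : {mfun T >-> config R I} := HB.pack sample m1m.
pose m2m := isMeasurableFun.Build _ _ _ _ _ (measurable_mix2 J).
pose f2 : {mfun (T * T)%type >-> config R I} := HB.pack (mix2 J) m2m.
have Hm : [set X | rectangles X /\ X `<=` setT] `<=` @measurable _ (config R I).
  by move=> X [[A mA ->] _]; exact: measurable_rectangle.
have HI : setI_closed [set X | @rectangles R I X /\ X `<=` setT].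
  by move=> X Y' [hX _] [hY _]; split => //; exact: setI_closed_rectangles.
have HT : pushforward P f1 setT = pushforward (P \x P) f2 setT.
  have PT : P setT = 1 by exact: probability_setT.
  transitivity (P setT * P setT); first by rewrite PT mule1.
  by rewrite -product_measure1E // setXTT.
have Hoo : pushforward P f1 setT < +oo.
  by rewrite /pushforward preimage_setT probability_setT ltry.
have HG : [set X | @rectangles R I X /\ X `<=` setT] = @rectangles R I.
  by apply/seteqP; split => X //= -[].
have HR X : [set X | @rectangles R I X /\ X `<=` setT] X ->
    pushforward P f1 X = pushforward (P \x P) f2 X.
  move=> [[A mA ->] _].
  rewrite /pushforward /= sample_rectangle //.
  pose A1 i b := if J i then setT else A i b.
  pose A2 i b := if J i then A i b else setT.
  have mA1 i b : measurable (A1 i b) by rewrite /A1; case: ifP => _ //; exact: measurableT.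
  have mA2 i b : measurable (A2 i b) by rewrite /A2; case: ifP => _ //; exact: measurableT.
  have -> : mix2 J @^-1` rectangle A =
      (sample @^-1` rectangle A1) `*` (sample @^-1` rectangle A2).
    apply/seteqP; split => [[w w']|[w w']] /=.
      move=> h; split => i b; have := h i b; rewrite /mix2 /mix /A1 /A2 /sample /=;
      by case: (J i).
    move=> [h1 h2] i b; have := h1 i b; have := h2 i b.
    by rewrite /mix2 /mix /A1 /A2 /sample /=; case: (J i).
  have ms B' : measurable B' -> measurable (sample @^-1` B').
    by move=> mB'; rewrite -[X in measurable X]setTI; exact: measurable_sample.
  transitivity (P (sample @^-1` rectangle A1) * P (sample @^-1` rectangle A2)); last first.
    by rewrite -product_measure1E //; apply: ms; exact: measurable_rectangle.
  rewrite !sample_rectangle // -big_split /=; apply: eq_bigr => i _.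
  have pT : P (\bigcap_(b in [set: bool]) (Z i b @^-1` setT)) = 1.
    rewrite (_ : \bigcap_(b in _) _ = setT) ?probability_setT //.
    by apply/seteqP; split.
  by rewrite /A1 /A2; case: (J i) => /=; rewrite pT ?mul1e ?mule1.
have H := @g_sigma_algebra_measure_unique_trace _ _ (config R I) (@rectangles R I) setT measurableT Hm HI _ _ HT HR Hoo.
by apply: H => //; rewrite HG.
Qed.

Section Fubini.
Variables (J : pred I) (f : config R I -> \bar R).
Hypotheses (mf : measurable_fun setT f) (f0 : forall z, 0 <= f z).

Lemma measurable_resample : measurable_fun setT (resample J f).
Proof.
apply: (@measurable_fun_fubini_tonelli_F _ _ _ _ _ P
  (fun zw : config R I * T => f (mix J zw.1 (sample zw.2)))) => //.
apply: (measurableT_comp mf); apply: measurable_mix => //.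
exact: (measurableT_comp measurable_sample measurable_snd).
Qed.

Lemma resample_ge0 z : 0 <= resample J f z.
Proof. by apply: integral_ge0 => w _. Qed.

(** The tower property, from [resample_law] and Tonelli's theorem. *)
Lemma integral_resample :
  \int[P]_w f (sample w) = \int[P]_w resample J f (sample w).
Proof.
transitivity (\int[pushforward P sample]_z f z).
  by rewrite ge0_integral_pushforward //; exact: measurable_sample.
transitivity (\int[pushforward (P \x P) (mix2 J)]_z f z).
  apply: eq_measure_integral => [|ms B mB _]; first exact: measurable_sample.
  exact: (resample_law J mB).
rewrite ge0_integral_pushforward //= fubini_tonelli1 //.
exact: (measurableT_comp mf (measurable_mix2 J)).
Qed.

End Fubini.

End Resampling.

(** * Bounded random variables and their exponential moments *)

Section BoundedVariables.
Context (R : realType) d (T : measurableType d) (P : probability T R).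

Lemma prob_setT : (P : {measure set T -> \bar R}) [set: T] = 1%E.
Proof. exact: probability_setT. Qed.

(** For x > 1/2 the argument grows, x <= 2 x^2. For x <= 1/2 one has [expR x * (1 - x) <= 1] and 1 /
    (1 - x) <= 1 + x + 2 x^2. *)
Lemma expR_le_quadratic (x : R) : expR x <= x + expR (2 * x ^+ 2).
Proof.
have h1 : 1 + 2 * x ^+ 2 <= expR (2 * x ^+ 2) by exact: expR_ge1Dx.
have [xh|xh] := lerP x 2^-1; last first.
  have : expR x <= expR (2 * x ^+ 2) by rewrite ler_expR expr2; nra.
  by move: (expR x) (expR _) => u v ?; lra.
have x1 : 0 < 1 - x by lra.
have h2 : expR x * (1 - x) <= 1.
  have : 1 - x <= expR (- x) by have := expR_ge1Dx (- x); lra.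
  rewrite -(ler_pM2l (expR_gt0 x)) -expRD subrr expR0.
  by move: (expR x) => u; lra.
suff : expR x <= 1 + x + 2 * x ^+ 2 by move: (expR x) (expR _) h1 => u v ? ?; lra.
rewrite -(ler_pM2r x1) (le_trans h2) // expr2.
have -> : (1 + x + 2 * (x * x)) * (1 - x) = 1 + x * x * (1 - 2 * x) by ring.
by rewrite lerDl mulr_ge0 ?sqr_ge0 // -?expr2 ?sqr_ge0 //; lra.
Qed.

Lemma bounded_integrable (X : T -> R) B : measurable_fun setT X ->
  (forall w, `|X w| <= B) -> P.-integrable setT (EFin \o X).
Proof.
move=> mX bX; apply: measurable_bounded_integrable => //.
  by rewrite prob_setT ltry.
exists B; split; first by rewrite num_real.
by move=> M BM w _ /=; rewrite (le_trans (bX w)) // ltW.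
Qed.

Lemma EFin_integrableD (f g : T -> R) :
  P.-integrable setT (EFin \o f) -> P.-integrable setT (EFin \o g) ->
  P.-integrable setT (EFin \o (fun w => f w + g w)).
Proof.
move=> hf hg; rewrite (_ : _ \o _ = ((EFin \o f) \+ (EFin \o g))%E).
  exact: integrableD.
by apply/funext => w; rewrite /= EFinD.
Qed.

Lemma EFin_integrableZ c (f : T -> R) : P.-integrable setT (EFin \o f) ->
  P.-integrable setT (EFin \o (fun w => c * f w)).
Proof.
move=> hf; rewrite (_ : _ \o _ = (fun w => c%:E * (EFin \o f) w)%E).
  exact: integrableZl.
by apply/funext => w; rewrite /= EFinM.
Qed.

Lemma Rintegral_prob_cst (r : R) : \int[P]_w r = r.
Proof. by rewrite Rintegral_cst // prob_setT /= mulr1. Qed.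

Lemma Rintegral_le_cst (X : T -> R) B b : measurable_fun setT X ->
  (forall w, `|X w| <= B) -> (forall w, X w <= b) -> \int[P]_w X w <= b.
Proof.
move=> mX bX Xb; rewrite -[leRHS]Rintegral_prob_cst; apply: le_Rintegral => //.
  exact: bounded_integrable bX.
exact: finite_measure_integrable_cst.
Qed.

Lemma Rintegral_ge_cst (X : T -> R) B b : measurable_fun setT X ->
  (forall w, `|X w| <= B) -> (forall w, b <= X w) -> b <= \int[P]_w X w.
Proof.
move=> mX bX Xb; rewrite -[leLHS]Rintegral_prob_cst; apply: le_Rintegral => //.
  exact: finite_measure_integrable_cst.
exact: bounded_integrable bX.
Qed.

Lemma Rintegral_norm_le (X : T -> R) B : measurable_fun setT X ->
  (forall w, `|X w| <= B) -> `|\int[P]_w X w| <= B.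
Proof.
move=> mX bX; rewrite ler_norml (Rintegral_ge_cst mX bX) => [|w].
  by apply: (Rintegral_le_cst mX bX) => w; have := bX w; rewrite ler_norml => /andP[].
by have := bX w; rewrite ler_norml => /andP[].
Qed.

(** The offset a is arbitrary because in the induction below X is f with one block resampled: the
    mean of X varies with the other blocks, while a is the overall mean. *)
Lemma exp_moment_bound (X : T -> R) c a : measurable_fun setT X ->
  (forall w, `|X w - \int[P]_w X w| <= c) ->
  \int[P]_w expR (X w - a) <= expR (2 * c ^+ 2) * expR (\int[P]_w X w - a).
Proof.
move=> mX; set mu := \int[P]_w X w => hc.
have c0 : 0 <= c.
  have /set0P[w _] : [set: T] != set0.
    apply/eqP => T0; have := prob_setT.
    by rewrite T0 measure0 => /eqP; rewrite eq_sym onee_eq0.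
  by apply: le_trans (hc w).
have bX w : `|X w| <= `|mu| + c.
  by rewrite -[X w](subrK mu) (le_trans (ler_normD _ _)) // [leRHS]addrC lerD2r.
have iX := bounded_integrable mX bX.
have mXm : measurable_fun setT (fun w => X w - mu) by apply: measurable_funB.
have iXm : P.-integrable setT (EFin \o (fun w => X w - mu)) by apply: (bounded_integrable mXm hc).
pose K := expR (mu - a).
pose U w := K * ((X w - mu) + expR (2 * c ^+ 2)).
have mU : measurable_fun setT U by apply: measurable_funM => //; apply: measurable_funD.
have hle w : expR (X w - a) <= U w.
  rewrite /U /K (_ : X w - a = (mu - a) + (X w - mu)); last by ring.
  rewrite expRD ler_pM2l ?expR_gt0 // (le_trans (expR_le_quadratic _)) // lerD2l ler_expR.
  by rewrite ler_pM2l // -[leLHS]real_normK ?num_real // lerXn2r ?nnegrE.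
have -> : expR (2 * c ^+ 2) * K = \int[P]_w U w.
  rewrite RintegralZl //; last first.
    apply: (@bounded_integrable _ (c + expR (2 * c ^+ 2))); first exact: measurable_funD.
    by move=> w; rewrite (le_trans (ler_normD _ _)) // lerD // ger0_norm ?expR_ge0.
  rewrite RintegralD //; last exact: finite_measure_integrable_cst.
  rewrite RintegralB //; last exact: finite_measure_integrable_cst.
  by rewrite !Rintegral_prob_cst subrr add0r mulrC.
apply: le_Rintegral => //.
- apply: (@bounded_integrable _ (expR (`|mu| + c - a))).
    by apply: measurableT_comp => //; apply: measurable_funB.
  move=> w /=; rewrite ger0_norm ?expR_ge0 // ler_expR lerD2r.
  by rewrite (le_trans _ (bX w)) // ler_norm.
- apply: (@bounded_integrable _ (K * (c + expR (2 * c ^+ 2)))) => // w.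
  rewrite normrM (ger0_norm (expR_ge0 _)) ler_pM2l ?expR_gt0 //.
  by rewrite (le_trans (ler_normD _ _)) // lerD // ger0_norm ?expR_ge0.
Qed.

End BoundedVariables.

(** * The bounded difference inequality *)

Section BoundedDifferenceInequality.
Context (R : realType) d (T : measurableType d) (P : probability T R).
Context (I : finType) (Z : I -> bool -> T -> R).
Hypothesis mZ : forall i b, measurable_fun setT (Z i b).
Hypothesis indepZ : mutually_independent P Z.
Local Notation sample := (sample Z).

Definition average (J : pred I) (f : config R I -> R) (z : config R I) : R :=
  \int[P]_w f (mix J z (sample w)).

Section Average.
Variables (J : pred I) (f : config R I -> R) (B : R).
Hypotheses (mf : measurable_fun setT f) (bf : forall z, `|f z| <= B).

Lemma measurable_mix_sample z : measurable_fun setT (fun w => f (mix J z (sample w))).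
Proof.
apply: (measurableT_comp mf); apply: measurable_mix => //.
exact: measurable_sample.
Qed.

Let shift_ge0 z : (0 <= (f z + B)%:E)%E.
Proof. by rewrite lee_fin; have := bf z; rewrite ler_norml; lra. Qed.

Let mshift : measurable_fun setT (fun z => (f z + B)%:E).
Proof. by apply/measurable_EFinP; apply: measurable_funD. Qed.

(** Adding B makes f non-negative, so that the Tonelli statements about [resample] carry over to
    bounded functions of either sign. *)
Lemma resample_shift z :
  resample P Z J (fun z => (f z + B)%:E) z = (average J f z + B)%:E.
Proof.
rewrite /resample /average.
have i1 : P.-integrable setT (EFin \o (fun w => f (mix J z (sample w)))).
  apply: (@bounded_integrable _ _ _ _ _ B) => [|w]; last exact: bf.
  exact: measurable_mix_sample.
under eq_integral do rewrite EFinD.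
rewrite integralD //; last exact: finite_measure_integrable_cst.
rewrite integral_cst // prob_setT mule1 EFinD; congr (_ + _)%E.
by rewrite /Rintegral fineK //; exact: integrable_fin_num.
Qed.

Lemma measurable_average : measurable_fun setT (average J f).
Proof.
have -> : average J f = (fun z => fine (resample P Z J (fun z => (f z + B)%:E) z) - B).
  by apply/funext => z; rewrite resample_shift /= addrK.
apply: measurable_funB => //.
apply: measurableT_comp => //; exact: (measurable_resample P mZ J mshift shift_ge0).
Qed.

Lemma average_bound z : `|average J f z| <= B.
Proof.
exact: (Rintegral_norm_le P (measurable_mix_sample z) (fun w => bf _)).
Qed.

Lemma Rintegral_average : \int[P]_w f (sample w) = \int[P]_w average J f (sample w).
Proof.
have ms := measurable_sample mZ.
have h := integral_resample mZ indepZ J mshift shift_ge0.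
have h1 (g : config R I -> R) : measurable_fun setT g -> (forall z, `|g z| <= B) ->
    (\int[P]_w (g (sample w) + B)%:E = (\int[P]_w g (sample w) + B)%:E)%E.
  move=> mg bg; under eq_integral do rewrite EFinD.
  have ig : P.-integrable setT (EFin \o (fun w => g (sample w))).
    by apply: (@bounded_integrable _ _ _ _ _ B) => //; exact: measurableT_comp.
  rewrite integralD //; last exact: finite_measure_integrable_cst.
  rewrite integral_cst // prob_setT mule1 EFinD; congr (_ + _)%E.
  by rewrite /Rintegral fineK //; exact: integrable_fin_num.
have h2 : (\int[P]_w resample P Z J (fun z => (f z + B)%:E) (sample w) =
    \int[P]_w (average J f (sample w) + B)%:E)%E.
  by apply: eq_integral => w _; rewrite resample_shift.
rewrite h2 in h.
rewrite !h1 // in h; [|exact: measurable_average|exact: average_bound].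
by case: h => /addIr.
Qed.

End Average.

Context (K : finType) (block : I -> K).

Definition agree_off j (z z' : config R I) :=
  forall i b, block i != j -> z i b = z' i b.

(** The blocks are changed one at a time. It serves the base case of the induction below, where all
    constants vanish and f must be constant. *)
Lemma bounded_differences_sum (f : config R I -> R) (c : K -> R) :
  (forall j z z', agree_off j z z' -> `|f z - f z'| <= c j) ->
  forall z z', `|f z - f z'| <= \sum_j c j.
Proof.
move=> hc z z'.
pose zz (s : seq K) := mix (fun i => block i \in s) z z'.
have h s : `|f z - f (zz s)| <= \sum_(j <- s) c j.
  elim: s => [|j s IH]; first by rewrite big_nil subrr normr0.
  rewrite big_cons [leRHS]addrC (le_trans _ (lerD IH (hc j (zz s) (zz (j :: s)) _))) //.
    by rewrite (le_trans _ (ler_normD _ _)) // addrA subrK.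
  by move=> i b ij; rewrite /zz /mix in_cons (negbTE ij).
have := h (enum K); rewrite big_enum /= (_ : zz _ = z') //.
by apply/funext => i; apply/funext => b; rewrite /zz /mix mem_enum.
Qed.

(* McDiarmid, by averaging out one block at a time; the pointwise bound expR_le_quadratic replaces
   Hoeffding's lemma, since its linear term integrates to zero. *)
Lemma bounded_difference_exp_moment (s : seq K) (f : config R I -> R) (c : K -> R) B :
  measurable_fun setT f -> (forall z, `|f z| <= B) ->
  (forall j z z', agree_off j z z' -> `|f z - f z'| <= c j) ->
  uniq s -> (forall j, j \notin s -> c j = 0) ->
  \int[P]_w expR (f (sample w) - \int[P]_w f (sample w)) <=
    expR (2 * \sum_(j <- s) c j ^+ 2).
Proof.
have ms := measurable_sample mZ.
elim: s f c => [|j s IH] f c mf bf hc.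
  move=> _ c0; rewrite big_nil mulr0 expR0.
  have [w0 _] : [set: T] !=set0.
    apply/set0P/eqP => T0; have := prob_setT P.
    by rewrite T0 measure0 => /eqP; rewrite eq_sym onee_eq0.
  have fc w : f (sample w) = f (sample w0).
    have := bounded_differences_sum hc (sample w) (sample w0).
    rewrite big1 => [|k _]; last exact: c0.
    by rewrite normr_le0 subr_eq0 => /eqP.
  have -> : \int[P]_w f (sample w) = f (sample w0).
    by under eq_Rintegral do rewrite fc; rewrite Rintegral_prob_cst.
  under eq_Rintegral do rewrite fc subrr expR0.
  by rewrite Rintegral_prob_cst.
move=> /= /andP[js us] c0.
pose J : pred I := fun i => block i == j.
pose g := average J f.
have mg : measurable_fun setT g by exact: measurable_average bf.
have bg z : `|g z| <= B by exact: average_bound.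
set mu := \int[P]_w f (sample w).
have muE : mu = \int[P]_w g (sample w) by exact: Rintegral_average bf.
(* Block j has been averaged out, so g no longer depends on it and its constant drops to 0, as the
   induction hypothesis for the shorter list requires. *)
pose c' k := if k == j then 0 else c k.
have iB z : P.-integrable setT (EFin \o (fun w => f (mix J z (sample w)))).
  by apply: (@bounded_integrable _ _ _ _ _ B) => // ; exact: measurable_mix_sample.
have hg k z z' : agree_off k z z' -> `|g z - g z'| <= c' k.
  move=> zz; rewrite /g /average -RintegralB //.
  apply: Rintegral_norm_le.
    by apply: measurable_funB; exact: measurable_mix_sample.
  move=> w; rewrite /c'; case: eqP => [kj|_].
    rewrite (_ : mix J z _ = mix J z' (sample w)) ?subrr ?normr0 //.
    apply/funext => i; apply/funext => b; rewrite /mix /J.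
    by case: ifPn => // ij; apply: zz; rewrite kj.
  by apply: hc => i b ik; rewrite /mix; case: ifP => // _; exact: zz.
have step : \int[P]_w expR (f (sample w) - mu) <=
    \int[P]_w (expR (2 * c j ^+ 2) * expR (g (sample w) - mu)).
  have me (h : config R I -> R) : measurable_fun setT h ->
      measurable_fun setT (fun z => expR (h z - mu)).
    by move=> mh; apply: measurableT_comp => //; apply: measurable_funB.
  have be (h : config R I -> R) z : (forall z, `|h z| <= B) ->
      `|expR (h z - mu)| <= expR (B - mu).
    move=> bh; rewrite ger0_norm ?expR_ge0 // ler_expR lerD2r.
    by rewrite (le_trans _ (bh z)) // ler_norm.
  rewrite (Rintegral_average J (me _ mf) (fun z => be f z bf)).
  apply: le_Rintegral => //.
  - apply: (@bounded_integrable _ _ _ _ _ (expR (B - mu))).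
      apply: (measurableT_comp _ ms); exact: measurable_average (me _ mf) (fun z => be f z bf).
    by move=> w; exact: average_bound (me _ mf) (fun z => be f z bf) _.
  - apply: (@bounded_integrable _ _ _ _ _ (expR (2 * c j ^+ 2) * expR (B - mu))).
      by apply: measurable_funM => //; exact: (measurableT_comp (me _ mg) ms).
    by move=> w; rewrite normrM (ger0_norm (expR_ge0 _)) ler_pM2l ?expR_gt0 //; exact: be.
  move=> w _; apply: exp_moment_bound; first exact: measurable_mix_sample.
  move=> w1.
  rewrite -[X in `|X - _|](Rintegral_prob_cst P) -RintegralB //; last first.
    exact: finite_measure_integrable_cst.
  apply: Rintegral_norm_le.
    by apply: measurable_funB => //; exact: measurable_mix_sample.
  by move=> w2; apply: hc => i b ij; rewrite /mix /J (negbTE ij).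
apply: (le_trans step).
rewrite RintegralZl //; last first.
  apply: (@bounded_integrable _ _ _ _ _ (expR (B - mu))).
    apply: measurableT_comp => //; apply: measurable_funB => //.
    exact: (measurableT_comp mg ms).
  move=> w /=; rewrite ger0_norm ?expR_ge0 // ler_expR lerD2r.
  by rewrite (le_trans _ (bg (sample w))) // ler_norm.
rewrite big_cons mulrDr expRD ler_pM2l ?expR_gt0 // muE.
have -> : \sum_(k <- s) c k ^+ 2 = \sum_(k <- s) c' k ^+ 2.
  apply: eq_big_seq => k ks; rewrite /c'; case: eqP => // kj.
  by move: js; rewrite -kj ks.
apply: IH => // k ks; rewrite /c'; case: eqP => // /eqP kj.
by apply: c0; rewrite in_cons negb_or kj.
Qed.

End BoundedDifferenceInequality.

(** * Measurability of matrix functions *)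

Section ComplexMeasurability.
Context (R : realType) d (T : measurableType d).
Local Notation C := R[i].
Local Notation Re := (@complex.Re R).
Local Notation Im := (@complex.Im R).

Definition cmeasurable (f : T -> C) :=
  measurable_fun setT (fun w => Re (f w)) /\ measurable_fun setT (fun w => Im (f w)).
Definition mxmeasurable m n (A : T -> 'M[C]_(m, n)) :=
  forall i j, cmeasurable (fun w => A w i j).

Lemma cmeasurable_cst c : cmeasurable (fun=> c).
Proof. by split; exact: measurable_cst. Qed.

Lemma cmeasurableD f g : cmeasurable f -> cmeasurable g -> cmeasurable (fun w => f w + g w).
Proof.
move=> [f1 f2] [g1 g2]; split.
  rewrite (_ : (fun _ => _) = fun w => Re (f w) + Re (g w)); first exact: measurable_funD.
  by apply/funext => w; case: (f w) (g w) => [? ?] [? ?].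
rewrite (_ : (fun _ => _) = fun w => Im (f w) + Im (g w)); first exact: measurable_funD.
by apply/funext => w; case: (f w) (g w) => [? ?] [? ?].
Qed.

Lemma cmeasurableM f g : cmeasurable f -> cmeasurable g -> cmeasurable (fun w => f w * g w).
Proof.
move=> [f1 f2] [g1 g2]; split.
  rewrite (_ : (fun _ => _) = fun w => Re (f w) * Re (g w) - Im (f w) * Im (g w)).
    by apply: measurable_funB; exact: measurable_funM.
  by apply/funext => w; case: (f w) (g w) => [? ?] [? ?].
rewrite (_ : (fun _ => _) = fun w => Re (f w) * Im (g w) + Im (f w) * Re (g w)).
  by apply: measurable_funD; exact: measurable_funM.
by apply/funext => w; case: (f w) (g w) => [? ?] [? ?].
Qed.

Lemma cmeasurable_conj f : cmeasurable f -> cmeasurable (fun w => conjc (f w)).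
Proof.
move=> [f1 f2]; split.
  by rewrite (_ : (fun _ => _) = fun w => Re (f w)) //; apply/funext => w; case: (f w).
rewrite (_ : (fun _ => _) = fun w => - Im (f w)); last by apply/funext => w; case: (f w).
exact: measurableT_comp.
Qed.

Lemma cmeasurableV f : cmeasurable f -> cmeasurable (fun w => (f w)^-1).
Proof.
move=> [f1 f2].
pose N w := Re (f w) ^+ 2 + Im (f w) ^+ 2.
have mN : measurable_fun setT (fun w => (N w)^-1).
  (* On non-negative reals the inverse is the power -1, also at 0, where both are 0. *)
  rewrite (_ : (fun _ => _) = fun w => N w `^ (-1)).
    apply: (@measurableT_comp _ _ _ _ _ _ (@powR R ^~ (-1)) _ N) => //.
    by apply: measurable_funD; exact: measurable_funX.
  by apply/funext => w; rewrite powR_inv1 // addr_ge0 // sqr_ge0.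
split.
  rewrite (_ : (fun _ => _) = fun w => Re (f w) * (N w)^-1); first exact: measurable_funM.
  by apply/funext => w; rewrite /N; case: (f w).
rewrite (_ : (fun _ => _) = fun w => - (Im (f w) * (N w)^-1)).
  by apply: measurableT_comp => //; exact: measurable_funM.
by apply/funext => w; rewrite /N; case: (f w).
Qed.

Lemma cmeasurable_sum (I : Type) (s : seq I) (Q : pred I) (f : I -> T -> C) :
  (forall i, cmeasurable (f i)) -> cmeasurable (fun w => \sum_(i <- s | Q i) f i w).
Proof.
move=> mf; elim: s => [|i s IH].
  rewrite (_ : (fun _ => _) = fun=> 0); first exact: cmeasurable_cst.
  by apply/funext => w; rewrite big_nil.
rewrite (_ : (fun _ => _) = fun w => (if Q i then f i w else 0) + \sum_(i <- s | Q i) f i w).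
  by apply: cmeasurableD => //; case: (Q i) => //; exact: cmeasurable_cst.
by apply/funext => w; rewrite big_cons; case: (Q i); rewrite ?add0r.
Qed.

Lemma cmeasurable_prod (I : Type) (s : seq I) (f : I -> T -> C) :
  (forall i, cmeasurable (f i)) -> cmeasurable (fun w => \prod_(i <- s) f i w).
Proof.
move=> mf; elim: s => [|i s IH].
  rewrite (_ : (fun _ => _) = fun=> 1); first exact: cmeasurable_cst.
  by apply/funext => w; rewrite big_nil.
rewrite (_ : (fun _ => _) = fun w => f i w * \prod_(i <- s) f i w).
  by apply: cmeasurableM.
by apply/funext => w; rewrite big_cons.
Qed.

Lemma measurable_eq0 f : cmeasurable f -> measurable [set w | f w = 0].
Proof.
move=> [f1 f2].
have -> : [set w | f w = 0] = (fun w => Re (f w)) @^-1` [set 0] `&` (fun w => Im (f w)) @^-1` [set 0].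
  apply/seteqP; split => w /=; first by move=> ->.
  by case: (f w) => a b /= [-> ->].
apply: measurableI; rewrite -[X in measurable X]setTI; [exact: f1|exact: f2].
Qed.

Lemma cmeasurable_if f g h : cmeasurable f -> cmeasurable g -> cmeasurable h ->
  cmeasurable (fun w => if f w == 0 then g w else h w).
Proof.
move=> mf [g1 g2] [h1 h2].
have mb : measurable_fun setT (fun w => f w == 0).
  apply: (measurable_fun_bool true); rewrite setTI.
  rewrite (_ : _ @^-1` _ = [set w | f w = 0]); first exact: measurable_eq0.
  by apply/seteqP; split => w /= /eqP.
split.
  rewrite (_ : (fun _ => _) = fun w => if f w == 0 then Re (g w) else Re (h w)).
    exact: measurable_fun_ifT.
  by apply/funext => w; case: eqP.
rewrite (_ : (fun _ => _) = fun w => if f w == 0 then Im (g w) else Im (h w)).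
  exact: measurable_fun_ifT.
by apply/funext => w; case: eqP.
Qed.

Lemma mxmeasurable_mul m n k (A : T -> 'M[C]_(m, n)) (B : T -> 'M[C]_(n, k)) :
  mxmeasurable A -> mxmeasurable B -> mxmeasurable (fun w => A w *m B w).
Proof.
move=> mA mB i j; rewrite (_ : (fun _ => _) = fun w => \sum_k A w i k * B w k j).
  by apply: cmeasurable_sum => l; apply: cmeasurableM.
by apply/funext => w; rewrite mxE.
Qed.

Lemma mxmeasurable_adj m n (A : T -> 'M[C]_(m, n)) :
  mxmeasurable A -> mxmeasurable (fun w => adjmx (A w)).
Proof.
move=> mA i j; rewrite (_ : (fun _ => _) = fun w => conjc (A w j i)).
  exact: cmeasurable_conj.
by apply/funext => w; rewrite !mxE.
Qed.

Lemma mxmeasurable_add m n (A B : T -> 'M[C]_(m, n)) :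
  mxmeasurable A -> mxmeasurable B -> mxmeasurable (fun w => A w + B w).
Proof.
move=> mA mB i j; rewrite (_ : (fun _ => _) = fun w => A w i j + B w i j).
  exact: cmeasurableD.
by apply/funext => w; rewrite !mxE.
Qed.

Lemma mxmeasurable_cst m n (A : 'M[C]_(m, n)) : mxmeasurable (fun=> A).
Proof. by move=> i j; exact: cmeasurable_cst. Qed.

Lemma mxmeasurable_det n (A : T -> 'M[C]_n) : mxmeasurable A -> cmeasurable (fun w => \det (A w)).
Proof.
move=> mA; rewrite /determinant; apply: cmeasurable_sum => s.
apply: cmeasurableM; first exact: cmeasurable_cst.
by apply: cmeasurable_prod => i.
Qed.

(** Cramer's rule on invertible matrices; [invmx] returns its argument on singular ones, whence the
    case split on the determinant. *)
Lemma mxmeasurable_inv n (A : T -> 'M[C]_n) :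
  mxmeasurable A -> mxmeasurable (fun w => invmx (A w)).
Proof.
move=> mA i j; rewrite (_ : (fun _ => _) = fun w => if \det (A w) == 0 then A w i j else
    (\det (A w))^-1 * ((-1) ^+ (j + i) * \det (row' j (col' i (A w))))).
  apply: cmeasurable_if => //; first exact: mxmeasurable_det.
  apply: cmeasurableM; first by apply: cmeasurableV; exact: mxmeasurable_det.
  apply: cmeasurableM; first exact: cmeasurable_cst.
  apply: mxmeasurable_det => k l.
  by rewrite (_ : (fun _ => _) = fun w => A w (lift j k) (lift i l)) //; apply/funext => w; rewrite !mxE.
apply/funext => w; rewrite /invmx unitmxE unitfE.
by case: eqP => //= _; rewrite mxE mxE.
Qed.

Lemma measurable_trace n (A : T -> 'M[C]_n) : mxmeasurable A ->
  measurable_fun setT (fun w => Re (\tr (A w))).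
Proof. by move=> mA; have [] : cmeasurable (fun w => \tr (A w)) by exact: cmeasurable_sum. Qed.

Lemma mxmeasurable_resolvent p m (X : T -> 'M[C]_(p, m)) d' e :
  mxmeasurable X -> mxmeasurable (fun w => resolvent (X w) d' e).
Proof.
move=> mX; rewrite /resolvent; apply: mxmeasurable_inv.
rewrite pencil.unlock; apply: mxmeasurable_add; last exact: mxmeasurable_cst.
apply: mxmeasurable_mul; last exact: mxmeasurable_adj.
apply: mxmeasurable_mul => //; exact: mxmeasurable_cst.
Qed.

Lemma mxmeasurable_col p m (X : T -> 'M[C]_(p, m)) j :
  mxmeasurable X -> mxmeasurable (fun w => col j (X w)).
Proof.
move=> mX i k; rewrite (_ : (fun _ => _) = fun w => X w i j) //.
by apply/funext => w; rewrite mxE.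
Qed.

Lemma measurable_restrace p m (X : T -> 'M[C]_(p, m)) d' e :
  mxmeasurable X -> measurable_fun setT (fun w => restrace (X w) d' e).
Proof. by move=> mX; apply: measurable_trace; exact: mxmeasurable_resolvent. Qed.

Lemma measurable_resform p m (X : T -> 'M[C]_(p, m)) d' e j :
  mxmeasurable X -> measurable_fun setT (fun w => resform (X w) d' e j).
Proof.
move=> mX; rewrite /resform /qform.
have mC := mxmeasurable_col j mX.
have := mxmeasurable_mul (mxmeasurable_mul (mxmeasurable_adj mC) (mxmeasurable_resolvent d' e mX)) mC.
by move=> /(_ 0 0)[].
Qed.

Lemma measurable_ressum p m (X : T -> 'M[C]_(p, m)) d' e J :
  mxmeasurable X -> measurable_fun setT (fun w => ressum (X w) d' e J).
Proof.
move=> mX; rewrite /ressum.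
rewrite (_ : (fun _ => _) = fun w => \sum_j (if J j then d' j else 0) * resform (X w) d' e j).
  apply: measurable_sum => j; apply: measurable_funM => //; exact: measurable_resform.
apply/funext => w; rewrite big_mkcond; apply: eq_bigr => j _.
by case: (J j); rewrite ?mul0r.
Qed.

End ComplexMeasurability.

(** * Exponential concentration *)

Section Concentration.
Context (R : realType) d (T : measurableType d) (P : probability T R).
Context (I K : finType) (Z : I -> bool -> T -> R) (block : I -> K).
Hypothesis mZ : forall i b, measurable_fun setT (Z i b).
Hypothesis indepZ : mutually_independent P Z.
Variables (f : config R I -> R) (B : R) (c : K -> R).
Hypotheses (mf : measurable_fun setT f) (bf : forall z, `|f z| <= B).
Hypothesis hc : forall j z z', agree_off block j z z' -> `|f z - f z'| <= c j.
Local Notation X := (fun w => f (sample Z w)).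
Local Notation mu := (\int[P]_w X w).
Local Notation V := (\sum_j c j ^+ 2).

Let mX : measurable_fun setT X.
Proof. exact: (measurableT_comp mf (measurable_sample mZ)). Qed.

Let iX : P.-integrable setT (EFin \o X).
Proof. by apply: (@bounded_integrable _ _ _ _ _ B) => // w; exact: bf. Qed.

Lemma exp_deviation (l : R) : \int[P]_w expR (l * (X w - mu)) <= expR (2 * l ^+ 2 * V).
Proof.
have mlf : measurable_fun setT (fun z => l * f z) by exact: measurable_funM.
have blf z : `|l * f z| <= `|l| * B by rewrite normrM ler_wpM2l.
have hlf j z z' : agree_off block j z z' -> `|l * f z - l * f z'| <= `|l| * c j.
  by move=> h; rewrite -mulrBr normrM ler_wpM2l // hc.
have := bounded_difference_exp_moment mZ indepZ mlf blf hlf (index_enum_uniq K).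
have -> : \int[P]_w (l * X w) = l * mu by rewrite RintegralZl.
have -> : 2 * l ^+ 2 * V = 2 * \sum_j (`|l| * c j) ^+ 2.
  by rewrite -mulrA mulr_sumr; congr (_ * _); apply: eq_bigr => j _; rewrite exprMn real_normK ?num_real.
under eq_Rintegral do rewrite -mulrBr.
by apply => j; rewrite mem_index_enum.
Qed.

Let mexp (l : R) : measurable_fun setT (fun w => expR (l * (X w - mu))).
Proof.
by apply: measurableT_comp => //; apply: measurable_funM => //; apply: measurable_funB.
Qed.

Let iexp (l : R) : P.-integrable setT (EFin \o (fun w => expR (l * (X w - mu)))).
Proof.
apply: (@bounded_integrable _ _ _ _ _ (expR (`|l| * (B + `|mu|)))) => // w /=.
rewrite ger0_norm ?expR_ge0 // ler_expR (le_trans (ler_norm _)) // normrM ler_wpM2l //.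
by rewrite (le_trans (ler_normB _ _)) // lerD2r bf.
Qed.

Let exp_both (l : R) :
  \int[P]_w (expR (l * (X w - mu)) + expR (- l * (X w - mu))) <= 2 * expR (2 * l ^+ 2 * V).
Proof.
rewrite RintegralD // mulr_natl mulr2n lerD ?exp_deviation //.
by have := exp_deviation (- l); rewrite sqrrN.
Qed.

Let iboth (l : R) : P.-integrable setT
  (EFin \o (fun w => expR (l * (X w - mu)) + expR (- l * (X w - mu)))).
Proof.
by apply: EFin_integrableD.
Qed.

(** Integrate [l |u| <= expR (l u) + expR (- l u)]; the parameter l is left free for the
    application. *)
Lemma mean_deviation (l : R) : 0 < l ->
  \int[P]_w `|X w - mu| <= 2 * expR (2 * l ^+ 2 * V) / l.
Proof.
move=> l0; rewrite ler_pdivlMr // mulrC -RintegralZl //; last first.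
  apply: (@bounded_integrable _ _ _ _ _ (B + `|mu|)).
    by apply: measurableT_comp => //; apply: measurable_funB.
  by move=> w; rewrite normr_id (le_trans (ler_normB _ _)) // lerD2r bf.
apply: le_trans (exp_both l); apply: le_Rintegral => //.
  apply: (@bounded_integrable _ _ _ _ _ (l * (B + `|mu|))).
    by apply: measurable_funM => //; apply: measurableT_comp => //; apply: measurable_funB.
  move=> w /=; rewrite normrM normr_id (gtr0_norm l0) ler_pM2l //.
  by rewrite (le_trans (ler_normB _ _)) // lerD2r bf.
move=> w _; move: (X w - mu) => x.
have h1 := expR_ge1Dx (l * x); have h2 := expR_ge1Dx (- l * x).
have g1 := expR_ge0 (l * x); have g2 := expR_ge0 (- l * x).
rewrite mulNr in h2 g2 *; move: (expR _) (expR _) h1 h2 g1 g2 => u v.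
have -> : l * `|x| = `|l * x| by rewrite normrM (gtr0_norm l0).
move: (l * x) => y h1 h2 g1 g2.
by have [y0|y0] := ger0P y; lra.
Qed.

(** Chernoff's bound for both tails at once, again with l left free. *)
Lemma tail_deviation (l t : R) : 0 < l ->
  (P [set w | (t <= `|X w - mu|)%R] <= (2 * expR (2 * l ^+ 2 * V - l * t))%:E)%E.
Proof.
move=> l0; set A := [set w | _].
have mA : measurable A.
  rewrite /A (_ : [set w | _] = (fun w => `|X w - mu|) @^-1` `[t, +oo[).
    rewrite -[X in measurable X]setTI.
    have : measurable_fun setT (fun w => `|X w - mu|).
      by apply: measurableT_comp => //; apply: measurable_funB.
    by apply.
  by apply/seteqP; split => w /=; rewrite in_itv /= andbT.
have -> : P A = (\int[P]_w (\1_A w))%:E.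
  rewrite /Rintegral integral_indic // setIT fineK // ge0_fin_numE //.
  by rewrite (le_lt_trans (probability_le1 P mA)) ?ltry.
rewrite lee_fin expRD mulrA -ler_pdivrMr ?expR_gt0 // -expRN opprK.
apply: le_trans (exp_both l); rewrite mulrC -RintegralZl //; last first.
  apply: (@bounded_integrable _ _ _ _ _ 1) => // w /=.
  by rewrite indicE; case: (_ \in _); rewrite ?normr1 ?normr0.
apply: le_Rintegral => //.
  apply: (@bounded_integrable _ _ _ _ _ (expR (l * t))); first exact: measurable_funM.
  move=> w /=; rewrite normrM (ger0_norm (expR_ge0 _)) indicE.
  by case: (_ \in _); rewrite ?normr1 ?normr0 ?mulr1 ?mulr0 // expR_ge0.
move=> w _; rewrite indicE; case: (boolP (w \in A)) => [|_]; last first.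
  by rewrite mulr0 addr_ge0 ?expR_ge0.
rewrite inE /A /= mulr1 => tX.
have [x0|x0] := lerP 0 (X w - mu).
  rewrite (ger0_norm x0) in tX.
  by rewrite -[leLHS]addr0 lerD ?expR_ge0 // ler_expR ler_pM2l.
rewrite (ltr0_norm x0) in tX.
by rewrite -[leLHS]add0r lerD ?expR_ge0 // ler_expR mulNr -mulrN ler_pM2l.
Qed.

End Concentration.

(** * Quadratic forms with independent entries *)

Section OneEntry.
Context (R : realType) d (T : measurableType d) (P : probability T R).
Variables (U V : T -> R) (M : R).
Hypotheses (mU : measurable_fun setT U) (mV : measurable_fun setT V).
Hypotheses (U0 : (\int[P]_w (U w)%:E = 0)%E) (V0 : (\int[P]_w (V w)%:E = 0)%E).
Local Notation S := (fun w => U w ^+ 2 + V w ^+ 2).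
Hypothesis S1 : (\int[P]_w (S w)%:E = 1)%E.
Hypothesis S2 : (\int[P]_w (S w ^+ 2)%:E <= M%:E)%E.

Let mS : measurable_fun setT S.
Proof. by apply: measurable_funD; exact: measurable_funX. Qed.

Let S0 w : 0 <= S w.
Proof. by rewrite addr_ge0 // sqr_ge0. Qed.

Let ge0_integrable (f : T -> R) : measurable_fun setT f -> (forall w, 0 <= f w) ->
  (\int[P]_w (f w)%:E < +oo)%E -> P.-integrable setT (EFin \o f).
Proof.
move=> mf f0 fi; apply/integrableP; split; first exact/measurable_EFinP.
by rewrite (eq_integral (fun w => (f w)%:E)) // => w _; rewrite /= ger0_norm.
Qed.

Let iS : P.-integrable setT (EFin \o S).
Proof. by apply: ge0_integrable => //; rewrite S1 ltry. Qed.

Let iSS : P.-integrable setT (EFin \o (fun w => S w ^+ 2)).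
Proof.
apply: ge0_integrable => [|w|]; [exact: measurable_funX|exact: sqr_ge0|].
by rewrite (le_lt_trans S2) // ltry.
Qed.

Let i1 (c : R) : P.-integrable setT (EFin \o (fun=> c)).
Proof. exact: finite_measure_integrable_cst. Qed.

Let iadd := @EFin_integrableD _ _ _ P.
Let iscale := @EFin_integrableZ _ _ _ P.

Let idom (f : T -> R) : measurable_fun setT f -> (forall w, `|f w| <= 1 + S w) ->
  P.-integrable setT (EFin \o f).
Proof.
move=> mf hf; apply: (@le_integrable _ _ _ P setT measurableT _ (EFin \o (fun w => 1 + S w))).
- exact/measurable_EFinP.
- move=> w _; rewrite /= lee_fin [leRHS]ger0_norm //.
  by rewrite addr_ge0.
- exact: iadd.
Qed.

Let iU : P.-integrable setT (EFin \o U).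
Proof.
apply: idom => // w; have := sqr_ge0 (V w); have := sqr_ge0 (`|U w| - 1); have := sqr_ge0 `|U w|.
rewrite sqrrB mulr1 expr1n -[U w ^+ 2]real_normK ?num_real //.
by move: (V w ^+ 2) (`|U w| ^+ 2) (`|U w|) => *; lra.
Qed.

Let iV : P.-integrable setT (EFin \o V).
Proof.
apply: idom => // w; have := sqr_ge0 (U w); have := sqr_ge0 (`|V w| - 1); have := sqr_ge0 `|V w|.
rewrite sqrrB mulr1 expr1n -[V w ^+ 2]real_normK ?num_real //.
by move: (U w ^+ 2) (`|V w| ^+ 2) (`|V w|) => *; lra.
Qed.

(** Integrands are dominated by such combinations, whose integrals the hypotheses determine up to
    the second moment of S. *)
Let poly1 c u v s q w : R := c + (u * U w + (v * V w + (s * S w + q * S w ^+ 2))).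

Let ipoly c u v s q : P.-integrable setT (EFin \o poly1 c u v s q).
Proof.
apply: iadd => //; apply: iadd; first exact: iscale.
apply: iadd; first exact: iscale.
by apply: iadd; exact: iscale.
Qed.

Let Rint_poly c u v s q :
  \int[P]_w poly1 c u v s q w = c + s + q * \int[P]_w (S w ^+ 2).
Proof.
rewrite /poly1 RintegralD //; last first.
  apply: iadd; first exact: iscale.
  apply: iadd; first exact: iscale.
  by apply: iadd; exact: iscale.
rewrite RintegralD //; [|exact: iscale|]; last first.
  apply: iadd; first exact: iscale.
  by apply: iadd; exact: iscale.
rewrite RintegralD //; [|exact: iscale|by apply: iadd; exact: iscale].
rewrite RintegralD //; [|exact: iscale|exact: iscale].
rewrite !RintegralZl // Rintegral_prob_cst.
by rewrite {1}/Rintegral U0 {1}/Rintegral V0 {1}/Rintegral S1 /= !mulr0 !add0r mulr1 addrA.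
Qed.

Let eint_poly c u v s q :
  (\int[P]_w (poly1 c u v s q w)%:E = (c + s + q * \int[P]_w (S w ^+ 2))%:E)%E.
Proof. by rewrite -(Rint_poly c u v s q) /Rintegral fineK //; exact: (integrable_fin_num measurableT (ipoly c u v s q)). Qed.

Lemma entry_affine c u v s :
  (\int[P]_w (c + (u * U w + v * V w) + s * S w)%:E = (c + s)%:E)%E.
Proof.
rewrite -[c + s]addr0 -(mul0r (\int[P]_w (S w ^+ 2))) -(eint_poly c u v s 0).
by apply: eq_integral => w _; congr EFin; rewrite /poly1; ring.
Qed.

(** The moments of U^2, U V and S U are not prescribed, so the square is bounded instead of
    expanded: [(A + B)^2 <= 2 A^2 + 2 B^2] and Cauchy-Schwarz leave only moments of S, while the
    terms linear in W integrate to 0. The coefficient of W^2 stays 1, so that the bounds add up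
    along a column. *)
Lemma entry_square W g b1 b2 :
  (\int[P]_w ((W + g * (S w - 1) + 2 * (b1 * U w + b2 * V w)) ^+ 2)%:E <=
   (W ^+ 2 + 2 * M * g ^+ 2 + 8 * (b1 ^+ 2 + b2 ^+ 2))%:E)%E.
Proof.
have SM : \int[P]_w (S w ^+ 2) <= M.
  rewrite -lee_fin (le_trans _ S2) // /Rintegral fineK //; exact: (integrable_fin_num measurableT iSS).
pose c := W ^+ 2 - 2 * W * g + 2 * g ^+ 2.
pose s := 2 * W * g - 4 * g ^+ 2 + 8 * (b1 ^+ 2 + b2 ^+ 2).
apply: (@le_trans _ _ (\int[P]_w (poly1 c (4 * W * b1) (4 * W * b2) s (2 * g ^+ 2) w)%:E)%E).
  apply: ge0_le_integral => //.
  - by move=> w _; rewrite lee_fin sqr_ge0.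
  - apply/measurable_EFinP; apply: measurable_funX; apply: measurable_funD.
      by apply: measurable_funD => //; apply: measurable_funM => //; apply: measurable_funB.
    by apply: measurable_funM => //; apply: measurable_funD; apply: measurable_funM.
  - by have /integrableP[] := ipoly c (4 * W * b1) (4 * W * b2) s (2 * g ^+ 2).
  - move=> w _; rewrite lee_fin /poly1 /c /s; move: (U w) (V w) => x y.
    rewrite -subr_ge0.
    set E := (X in 0 <= X).
    have -> : E = (g * (x ^+ 2 + y ^+ 2 - 1) - 2 * (b1 * x + b2 * y)) ^+ 2 +
       8 * (b1 * y - b2 * x) ^+ 2 by rewrite /E; ring.
    by rewrite addr_ge0 ?sqr_ge0 // mulr_ge0 ?sqr_ge0.
rewrite eint_poly lee_fin /c /s.
have : 2 * g ^+ 2 * \int[P]_w (S w ^+ 2) <= 2 * g ^+ 2 * M.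
  by rewrite ler_wpM2l // mulr_ge0 // sqr_ge0.
have := sqr_ge0 g.
move: (\int[P]_w _) => z; rewrite -subr_ge0 => h1 h2; rewrite -subr_ge0.
move: (g ^+ 2) h1 h2 => t h1 h2.
have -> : 2 * M * t = 2 * t * M by ring.
by move: (2 * t * M) (2 * t * z) h2 => m1 m2; lra.
Qed.

(** Second moment method for the squared distance t to the atom: t > 0 has probability at least (E
    t)^2 / E t^2, where E t = 1 + a and E t^2 <= 8 (M + a^2). For M >= 1 the resulting ratio is at
    least 1 / (8 M), for every a >= 0. *)
Lemma entry_atom u v : 1 <= M ->
  (P (U @^-1` [set u] `&` V @^-1` [set v]) <= (1 - (8 * M)^-1)%:E)%E.
Proof.
move=> M1; set A := _ `&` _.
have mA : measurable A.
  by apply: measurableI; rewrite -[X in measurable X]setTI; [exact: mU|exact: mV].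
pose a := u ^+ 2 + v ^+ 2.
have a0 : 0 <= a by rewrite addr_ge0 ?sqr_ge0.
have Ma0 : 0 < M + a ^+ 2 by rewrite ltr_wpDr ?sqr_ge0 // (lt_le_trans ltr01).
(* The bound on E t^2 divided by E t, which is the optimal parameter in
   [t <= k / 2 + t^2 / (2 k)]. *)
pose k := 8 * (M + a ^+ 2) / (1 + a).
have a1 : 0 < 1 + a by rewrite ltr_wpDr.
have k0 : 0 < k by rewrite /k divr_gt0 // mulr_gt0.
have SM : \int[P]_w (S w ^+ 2) <= M.
  by rewrite -lee_fin (le_trans _ S2) // /Rintegral fineK //; exact: (integrable_fin_num measurableT iSS).
pose c := k / 2 + 4 * a ^+ 2 / k - a.
have hint : (\int[P]_w ((k / 2)%:E * (\1_A w)%:E) <=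
    \int[P]_w (poly1 c (2 * u) (2 * v) (- 1) (4 / k) w)%:E)%E.
  apply: ge0_le_integral => //.
  - by move=> w _; rewrite mule_ge0 // lee_fin // ltW // divr_gt0.
  - by apply: measurable_funeM; apply/measurable_EFinP; exact: measurable_indic.
  - by have /integrableP[] := ipoly c (2 * u) (2 * v) (- 1) (4 / k).
  move=> w _; rewrite -EFinM lee_fin /poly1 /c indicE.
  set x := U w; set y := V w.
  pose t := (x - u) ^+ 2 + (y - v) ^+ 2.
  have t2 : t ^+ 2 <= 8 * ((x ^+ 2 + y ^+ 2) ^+ 2 + a ^+ 2).
    rewrite -subr_ge0 /t /a.
    set E := (X in 0 <= X).
    pose S1' := x ^+ 2 + y ^+ 2; pose A1 := u ^+ 2 + v ^+ 2.
    (* By the parallelogram identity t + B = 2 (S1' + A1), so that 4 (S1' + A1)^2 - t^2 factors. *)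
    pose B := (x + u) ^+ 2 + (y + v) ^+ 2.
    have -> : E = 4 * (S1' - A1) ^+ 2 + B * (2 * (S1' + A1) + ((x - u) ^+ 2 + (y - v) ^+ 2)).
      by rewrite /E /S1' /A1 /B; ring.
    have B0 : 0 <= B by rewrite /B addr_ge0 ?sqr_ge0.
    have S0' : 0 <= S1' + A1 by rewrite /S1' /A1 !addr_ge0 ?sqr_ge0.
    have t0 : 0 <= (x - u) ^+ 2 + (y - v) ^+ 2 by rewrite addr_ge0 ?sqr_ge0.
    apply: addr_ge0; first by rewrite mulr_ge0 ?sqr_ge0.
    by apply: mulr_ge0 => //; rewrite addr_ge0 // mulr_ge0.
  have t0 : 0 <= t by rewrite /t addr_ge0 ?sqr_ge0.
  set b := (w \in A)%:R.
  have bt : b * t = 0.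
    rewrite /b; have [|_] := boolP (w \in A); last by rewrite mul0r.
    by rewrite inE => -[/= xu yv]; rewrite /t /x /y xu yv !subrr expr0n addr0 mulr0.
  have b1 : b <= 1 by rewrite /b; case: (_ \in _).
  have b0 : 0 <= b by rewrite /b; case: (_ \in _).
  (* Off the atom this is the arithmetic-geometric mean inequality; on the atom t = 0. *)
  have key : k / 2 * b + t <= k / 2 + t ^+ 2 / (2 * k).
    have [bz|bz] := eqVneq b 0.
      rewrite bz mulr0 add0r -subr_ge0 (_ : _ - t = (k - t) ^+ 2 / (2 * k)).
        by rewrite divr_ge0 ?sqr_ge0 // mulr_ge0 // ltW.
      by field; rewrite gt_eqF.
    have tz : t = 0 by move/eqP: bt; rewrite mulf_eq0 (negbTE bz) => /eqP.
    by rewrite tz expr0n mul0r !addr0 ler_piMr // divr_ge0 // ltW.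
  have h2 : t ^+ 2 / (2 * k) <= 4 * ((x ^+ 2 + y ^+ 2) ^+ 2 + a ^+ 2) / k.
    rewrite (_ : 4 * _ / k = 8 * ((x ^+ 2 + y ^+ 2) ^+ 2 + a ^+ 2) / (2 * k)).
      by rewrite ler_wpM2r // invr_ge0 mulr_ge0 // ltW.
    by field; rewrite gt_eqF.
  have tE : t = x ^+ 2 + y ^+ 2 - 2 * u * x - 2 * v * y + a by rewrite /t /a; ring.
  have h3 : k / 2 * b <= k / 2 + 4 * ((x ^+ 2 + y ^+ 2) ^+ 2 + a ^+ 2) / k - t.
    by rewrite lerBrDr (le_trans key) // lerD2l.
  rewrite (le_trans h3) // tE le_eqVlt; apply/orP; left; apply/eqP.
  by field; rewrite gt_eqF.
rewrite ge0_integralZl ?lee_fin // in hint; last 2 first.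
- by apply/measurable_EFinP; exact: measurable_indic.
- by rewrite divr_ge0 // ltW.
rewrite integral_indic // setIT eint_poly in hint.
have PA : P A = (fine (P A))%:E.
  by rewrite fineK // ge0_fin_numE // (le_lt_trans (probability_le1 P mA)) ?ltry.
have {}hint : ((k / 2)%:E * P A <= (c + -1 + 4 / k * \int[P]_w (S w ^+ 2))%:E)%E by exact: hint.
rewrite PA -EFinM lee_fin in hint; rewrite PA lee_fin.
move: (fine (P A)) hint => pA; rewrite /c => hint {PA}.
have hM : 4 / k * \int[P]_w (S w ^+ 2) <= 4 / k * M.
  by rewrite ler_wpM2l // divr_ge0 // ltW.
have e1 : 4 * a ^+ 2 / k + 4 / k * M = (1 + a) / 2.
  by rewrite /k; field; rewrite !gt_eqF.
have h4 : k / 2 * pA <= k / 2 - (1 + a) / 2.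
  move: hint hM e1; move: (\int[P]_w _) => z.
  by move: (4 * a ^+ 2 / k) (4 / k * M) (4 / k * z) (k / 2 * pA) => z1 z2 z3 z4; lra.
have h5 : pA <= 1 - (1 + a) / k.
  rewrite -(ler_pM2l (divr_gt0 k0 (ltr0n R 2))) (le_trans h4) // le_eqVlt; apply/orP; left; apply/eqP.
  by field; rewrite gt_eqF.
rewrite (le_trans h5) // lerD2l lerN2.
have -> : (1 + a) / k = (1 + a) ^+ 2 / (8 * (M + a ^+ 2)).
  by rewrite /k; field; rewrite !gt_eqF.
have Mp : 0 < M by rewrite (lt_le_trans ltr01).
rewrite ler_pdivlMr ?mulr_gt0 // mulrC ler_pdivrMr ?mulr_gt0 //.
have : a ^+ 2 <= M * a ^+ 2 by rewrite ler_peMl // sqr_ge0.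
have : 0 <= M * a by rewrite mulr_ge0 // (le_trans ler01).
by rewrite !expr2; move: (M * a) => Ma; nra.
Qed.

End OneEntry.

Section QuadraticForm.
Context (R : realType).
Local Notation C := R[i].
Local Notation "x %:C" := (real_complex R x).
Local Notation Re := (@complex.Re R).
Local Notation Im := (@complex.Im R).
Local Notation "A ^h" := (adjmx A) (at level 8, format "A ^h").

Lemma qform_addv n (A : 'M[C]_n) (u v : 'cV[C]_n) : A^h = A ->
  qform A (u + v) = qform A u + 2 * Re ((v^h *m (A *m u)) 0 0) + qform A v.
Proof.
move=> hA; rewrite /qform adjmxD !(mulmxDl, mulmxDr).
have E1 (B D : 'M[C]_1) : (B + D) 0 0 = B 0 0 + D 0 0 by rewrite mxE.
rewrite !E1 !ReD.
have -> : Re ((u^h *m A *m v) 0 0) = Re ((v^h *m (A *m u)) 0 0).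
  have -> : u^h *m A *m v = (v^h *m (A *m u))^h.
    by rewrite !adjmxM adjmxK hA.
  by rewrite adjmxE; move: (_ 0 0) => [].
rewrite -(mulmxA v^h A u).
by move: (Re _) (Re _) (Re _) => a b c; ring.
Qed.

Section Deterministic.
Context (p m : nat) (j : 'I_m) (d : 'I_m -> R) (e : R).
Local Notation G X := (resolvent X (drop_wt d j) e).

(* Revealing the entries of column j one at a time splits its centered quadratic form into
   orthogonal increments. *)
Definition truncated_col k (X : 'M[C]_(p, m)) : 'cV[C]_p :=
  \col_i (if (i < k)%N then X i j else 0).
Definition centered_form k (X : 'M[C]_(p, m)) : R :=
  qform (G X) (truncated_col k X) - \sum_(i < p | (i < k)%N) Re (G X i i).
(** The coefficient through which entry i of the column is coupled, in the quadratic form, to the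
    entries already revealed. *)
Definition partial_row (i : 'I_p) k (X : 'M[C]_(p, m)) : C := (G X *m truncated_col k X) i 0.

Lemma truncated_colS (k : 'I_p) X :
  truncated_col k.+1 X = truncated_col k X + X k j *: delta_mx k 0.
Proof.
apply/matrixP => i l; rewrite !mxE ltnS leq_eqVlt val_eqE.
rewrite ord1 eqxx andbT.
have [->|ik] := eqVneq i k; first by rewrite ltnn /= add0r mulr1.
by rewrite /= mulr0 addr0.
Qed.

Lemma partial_rowS i (k : 'I_p) X :
  partial_row i k.+1 X = partial_row i k X + G X i k * X k j.
Proof.
rewrite /partial_row truncated_colS mulmxDr mxE -scalemxAr mul_delta_col !mxE.
by rewrite mulrC.
Qed.

Lemma centered_formS (k : 'I_p) X : centered_form k.+1 X =
  centered_form k X + Re (G X k k) * (normc2 (X k j) - 1) +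
  2 * (Re (partial_row k k X) * Re (X k j) + Im (partial_row k k X) * Im (X k j)).
Proof.
rewrite /centered_form truncated_colS qform_addv ?resolvent_herm //.
have -> : \sum_(i < p | (i < k.+1)%N) Re (G X i i) =
    \sum_(i < p | (i < k)%N) Re (G X i i) + Re (G X k k).
  rewrite (bigD1 k) //= addrC; congr (_ + _); apply: eq_bigl => i.
  by rewrite ltnS ltn_neqAle andbC val_eqE.
have -> : qform (G X) (X k j *: delta_mx k 0) = normc2 (X k j) * Re (G X k k).
  rewrite resolvent_diag /= /qform adjmxZ -scalemxAl -scalemxAl -scalemxAr scalerA.
  by rewrite mxE normc2E Re_rmul.
have -> : ((X k j *: (delta_mx k 0 : 'cV[C]_p))^h *m (G X *m truncated_col k X)) 0 0 =
    conjc (X k j) * partial_row k k X.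
  rewrite adjmxZ -scalemxAl mxE; congr (_ * _).
  rewrite mxE (bigD1 k) //= big1 ?addr0 => [|i ik].
    by rewrite adjmxE mxE !eqxx conjc1 mul1r.
  by rewrite adjmxE mxE (negbTE ik) conjc0 mul0r.
move: (partial_row k k X) (X k j) => [b1 b2] [x1 x2] /=.
move: (qform _ _) (\sum_(i < p | _) _) (Re _) (normc2 _) => q s g n; ring.
Qed.

Lemma centered_form_full X : centered_form p X = resform X (drop_wt d j) e j - restrace X (drop_wt d j) e.
Proof.
rewrite /centered_form /resform; congr (qform _ _ - _).
  by apply/matrixP => i l; rewrite !mxE ltn_ord.
by rewrite /restrace /mxtrace Re_sum; apply: eq_bigl => i; rewrite ltn_ord.
Qed.

Lemma centered_form0 X : centered_form 0 X = 0.
Proof.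
rewrite /centered_form big_pred0 // subr0.
have -> : truncated_col 0 X = 0 by apply/matrixP => i l; rewrite !mxE.
by rewrite /qform mulmx0 mxE.
Qed.

Lemma partial_row0 i X : partial_row i 0 X = 0.
Proof.
have -> : partial_row i 0 X = (G X *m truncated_col 0 X) i 0 by [].
have -> : truncated_col 0 X = 0 by apply/matrixP => k l; rewrite !mxE.
by rewrite mulmx0 mxE.
Qed.

Section OffEntry.
Variables (X X' : 'M[C]_(p, m)) (k : 'I_p).
Hypothesis XX' : forall i l, (i, l) != (k, j) -> X i l = X' i l.

Lemma resolvent_off_entry : G X = G X'.
Proof.
rewrite /resolvent (@pencil_off_col _ _ _ X X' _ _ j) ?drop_wt_id // => i l lj.
by apply: XX'; rewrite xpair_eqE negb_and lj orbT.
Qed.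

Lemma truncated_col_off_entry n : (n <= k)%N -> truncated_col n X = truncated_col n X'.
Proof.
move=> nk; apply/matrixP => i l; rewrite !mxE; case: ifP => // ik.
apply: XX'; rewrite xpair_eqE eqxx andbT -val_eqE /=.
by rewrite ltn_eqF // (leq_trans ik).
Qed.

Lemma centered_form_off_entry : centered_form k X = centered_form k X'.
Proof. by rewrite /centered_form resolvent_off_entry truncated_col_off_entry. Qed.

Lemma partial_row_off_entry i : partial_row i k X = partial_row i k X'.
Proof. by rewrite /partial_row resolvent_off_entry truncated_col_off_entry. Qed.

End OffEntry.

End Deterministic.

Context d' (T : measurableType d') (P : probability T R).
Context (p m : nat) (Z : 'I_p * 'I_m -> bool -> T -> R).
Hypothesis mZ : forall i b, measurable_fun setT (Z i b).
Hypothesis indepZ : mutually_independent P Z.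

Definition config_mx (z : config R ('I_p * 'I_m)%type) : 'M[C]_(p, m) :=
  \matrix_(i, j) Complex (z (i, j) true) (z (i, j) false).

Lemma mxmeasurable_config : mxmeasurable config_mx.
Proof.
move=> i j; split.
  rewrite (_ : (fun _ => _) = fun z => z (i, j) true); first exact: measurable_coord.
  by apply/funext => z; rewrite mxE.
rewrite (_ : (fun _ => _) = fun z => z (i, j) false); first exact: measurable_coord.
by apply/funext => z; rewrite mxE.
Qed.

Section Moments.
Variables (j : 'I_m) (d : 'I_m -> R) (e M : R).
Hypotheses (d0 : forall k, 0 <= d k) (e0 : 0 < e) (M0 : 0 <= M).
Hypothesis Z0 : forall i b, (\int[P]_w (Z (i, j) b w)%:E = 0)%E.
Hypothesis Z1 : forall i, (\int[P]_w (Z (i, j) true w ^+ 2 + Z (i, j) false w ^+ 2)%:E = 1)%E.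
Hypothesis Z2 : forall i,
  (\int[P]_w ((Z (i, j) true w ^+ 2 + Z (i, j) false w ^+ 2) ^+ 2)%:E <= M%:E)%E.
Local Notation G X := (resolvent X (drop_wt d j) e).
Local Notation sample := (sample Z).
Local Notation Mw w := (config_mx (sample w)).
Let dj0 := drop_wt_ge0 j d0.

Let mG : mxmeasurable (fun z => G (config_mx z)).
Proof. by apply: mxmeasurable_resolvent; exact: mxmeasurable_config. Qed.

Let mtrunc k : mxmeasurable (fun z => truncated_col j k (config_mx z)).
Proof.
move=> i l; rewrite (_ : (fun _ => _) = fun z => if (i < k)%N then config_mx z i j else 0).
  by case: (i < k)%N; [exact: mxmeasurable_config|exact: cmeasurable_cst].
by apply/funext => z; rewrite !mxE.
Qed.

Let mpartial i k : cmeasurable (fun z => partial_row j d e i k (config_mx z)).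
Proof. exact: (mxmeasurable_mul mG (mtrunc k)). Qed.

Let mcentered k : measurable_fun setT (fun z => centered_form j d e k (config_mx z)).
Proof.
rewrite /centered_form; apply: measurable_funB.
  by have [] := mxmeasurable_mul (mxmeasurable_mul (mxmeasurable_adj (mtrunc k)) mG) (mtrunc k) 0 0.
rewrite (_ : (fun _ => _) = fun z => \sum_(i < p) (if (i < k)%N then Re (G (config_mx z) i i) else 0)).
  by apply: measurable_sum => i; case: (i < k)%N => //; have [] := mG i i.
by apply/funext => z; rewrite big_mkcond.
Qed.

Let mnormc2 (f : config R ('I_p * 'I_m)%type -> C) : cmeasurable f ->
  measurable_fun setT (fun z => normc2 (f z)).
Proof. by move=> [f1 f2]; apply: measurable_funD; exact: measurable_funX. Qed.

Let resample_entry (k : 'I_p) (F : C -> config R ('I_p * 'I_m)%type -> R) z :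
  (forall z', (forall i b, i != (k, j) -> z i b = z' i b) -> forall x, F x z' = F x z) ->
  resample P Z (pred1 (k, j)) (fun z => (F (config_mx z k j) z)%:E) z =
  (\int[P]_w (F (Complex (Z (k, j) true w) (Z (k, j) false w)) z)%:E)%E.
Proof.
move=> hF; rewrite /resample; apply: eq_integral => w _; congr EFin.
rewrite mxE /mix /= eqxx.
rewrite hF // => i b ik; by rewrite /mix /= (negbTE ik).
Qed.

Let off_entry (k : 'I_p) z z' : (forall i b, i != (k, j) -> z i b = z' i b) ->
  forall i l, (i, l) != (k, j) -> config_mx z i l = config_mx z' i l.
Proof. by move=> h i l il; rewrite !mxE !h. Qed.

Let ms := measurable_sample mZ.

Let row_bound X i k : \sum_(l < p | (l < k)%N) normc2 (G X i l) <= e ^- 2.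
Proof.
apply: le_trans (resolvent_col_bound X dj0 e0 i).
rewrite [leRHS](bigID (fun l : 'I_p => (l < k)%N)) /=.
rewrite (eq_bigr (fun l => normc2 (G X l i))) ?lerDl ?sumr_ge0 // => [l _|l _].
  exact: normc2_ge0.
rewrite -[in LHS](resolvent_herm X) adjmxE; move: (G X l i) => [a b].
by rewrite /normc2 /= sqrrN.
Qed.

(** The matrix G does not involve column j, whose entries are centred, independent and of unit
    variance. Resampling them one at a time turns the second moment into that of a part of a row of
    G. *)
Lemma partial_row_moment i k : (k <= p)%N ->
  (\int[P]_w (normc2 (partial_row j d e i k (Mw w)))%:E <= (e ^- 2)%:E)%E.
Proof.
move=> kp.
suff -> : (\int[P]_w (normc2 (partial_row j d e i k (Mw w)))%:E =
    \int[P]_w (\sum_(l < p | (l < k)%N) normc2 (G (Mw w) i l))%:E)%E.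
  apply: (@le_trans _ _ (\int[P]_w (e ^- 2)%:E)%E).
    apply: ge0_le_integral => //.
    - by move=> w _; rewrite lee_fin sumr_ge0 // => l _; exact: normc2_ge0.
    - apply/measurable_EFinP.
      rewrite (_ : (fun _ => _) = fun w => \sum_(l < p) (if (l < k)%N then normc2 (G (Mw w) i l) else 0)).
        apply: measurable_sum => l; case: (l < k)%N => //.
        exact: (measurableT_comp (mnormc2 (mG i l)) ms).
      by apply/funext => w; rewrite big_mkcond.
    - by move=> w _; rewrite lee_fin row_bound.
  by rewrite integral_cst // prob_setT mule1.
elim: k kp => [_|k IH kp].
  apply: eq_integral => w _; rewrite partial_row0 big_pred0 //.
  by rewrite /normc2 /= expr0n addr0.
pose ko := Ordinal kp.
have mgi : measurable_fun setT (fun w => normc2 (G (Mw w) i ko)).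
  exact: (measurableT_comp (mnormc2 (mG i ko)) ms).
have msum : measurable_fun setT (fun w => \sum_(l < p | (l < k)%N) normc2 (G (Mw w) i l)).
  rewrite (_ : (fun _ => _) = fun w => \sum_(l < p) (if (l < k)%N then normc2 (G (Mw w) i l) else 0)).
    apply: measurable_sum => l; case: (l < k)%N => //.
    exact: (measurableT_comp (mnormc2 (mG i l)) ms).
  by apply/funext => w; rewrite big_mkcond.
have -> : (\int[P]_w (\sum_(l < p | (l < k.+1)%N) normc2 (G (Mw w) i l))%:E =
   \int[P]_w (\sum_(l < p | (l < k)%N) normc2 (G (Mw w) i l))%:E +
   \int[P]_w (normc2 (G (Mw w) i ko))%:E)%E.
  rewrite -ge0_integralD //; first last.
  - exact/measurable_EFinP.
  - by move=> w _; rewrite lee_fin normc2_ge0.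
  - exact/measurable_EFinP.
  - by move=> w _; rewrite lee_fin sumr_ge0 // => l _; exact: normc2_ge0.
  apply: eq_integral => w _; rewrite -EFinD; congr EFin.
  rewrite (bigD1 ko) //= addrC; congr (_ + _); apply: eq_bigl => l.
  by rewrite ltnS [RHS]ltn_neqAle andbC -val_eqE.
rewrite -IH ?(ltnW kp) //.
pose F (x : C) z := normc2 (partial_row j d e i k (config_mx z) + G (config_mx z) i ko * x).
have FE z : normc2 (partial_row j d e i k.+1 (config_mx z)) = F (config_mx z ko j) z.
  by rewrite /F (partial_rowS _ _ _ _ ko).
have mF : measurable_fun setT (fun z => (F (config_mx z ko j) z)%:E).
  apply/measurable_EFinP; apply: mnormc2; apply: cmeasurableD => //.
  by apply: cmeasurableM => //; exact: mxmeasurable_config.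
under eq_integral do rewrite FE.
rewrite (integral_resample mZ indepZ (pred1 (ko, j)) mF); last first.
  by move=> z; rewrite lee_fin normc2_ge0.
rewrite -ge0_integralD //; first last.
- exact/measurable_EFinP.
- by move=> w _; rewrite lee_fin normc2_ge0.
- by apply/measurable_EFinP; exact: (measurableT_comp (mnormc2 (mpartial i k)) ms).
- by move=> w _; rewrite lee_fin normc2_ge0.
apply: eq_integral => w _; rewrite resample_entry; last first.
  move=> z' hz x; have h := off_entry hz.
  by rewrite /F (resolvent_off_entry d e h) (partial_row_off_entry d e (k := ko) h).
rewrite /F; move: (partial_row _ _ _ _ _ _) (G _ _ _) => [a1 a2] [g1 g2].
rewrite -EFinD -(entry_affine (mZ _ true) (mZ _ false) (Z0 ko true) (Z0 ko false) (Z1 ko) (Z2 ko)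
   (normc2 (Complex a1 a2)) (2 * (a1 * g1 + a2 * g2)) (2 * (a2 * g1 - a1 * g2))
   (normc2 (Complex g1 g2))).
apply: eq_integral => w' _; congr EFin; rewrite /normc2 /=; ring.
Qed.

(** Conditionally on the other entries, [entry_square] bounds the increment by 2 M g^2 + 8 times the
    squared modulus of the coupling coefficient, where g is a diagonal entry of G. Here g <= 1 / e,
    and the coefficient has second moment at most e^-2. *)
Lemma centered_form_moment k : (k <= p)%N ->
  (\int[P]_w (centered_form j d e k (Mw w) ^+ 2)%:E <= (k%:R * ((2 * M + 8) * e ^- 2))%:E)%E.
Proof.
elim: k => [_|k IH kp].
  rewrite mul0r integral0_eq // => w _.
  by rewrite centered_form0 expr0n.
pose ko := Ordinal kp.
pose F (x : C) z := (centered_form j d e k (config_mx z) +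
  Re (G (config_mx z) ko ko) * (normc2 x - 1) +
  2 * (Re (partial_row j d e ko k (config_mx z)) * Re x + Im (partial_row j d e ko k (config_mx z)) * Im x)) ^+ 2.
have FE z : centered_form j d e k.+1 (config_mx z) ^+ 2 = F (config_mx z ko j) z.
  by rewrite /F (centered_formS _ _ _ ko).
have mF : measurable_fun setT (fun z => (F (config_mx z ko j) z)%:E).
  apply/measurable_EFinP; rewrite (_ : (fun _ => _) = fun z => centered_form j d e k.+1 (config_mx z) ^+ 2).
    exact: measurable_funX.
  by apply/funext => z; rewrite FE.
under eq_integral do rewrite FE.
rewrite (integral_resample mZ indepZ (pred1 (ko, j)) mF); last first.
  by move=> z; rewrite lee_fin sqr_ge0.
pose A w := centered_form j d e k (Mw w) ^+ 2.
pose b w := normc2 (partial_row j d e ko k (Mw w)).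
have mA : measurable_fun setT (fun w => (A w)%:E).
  by apply/measurable_EFinP; apply: measurable_funX; exact: (measurableT_comp (mcentered k) ms).
have mb : measurable_fun setT (fun w => (b w)%:E).
  by apply/measurable_EFinP; exact: (measurableT_comp (mnormc2 (mpartial ko k)) ms).
have A0 w : (0 <= (A w)%:E)%E by rewrite lee_fin sqr_ge0.
have b0 w : (0 <= (b w)%:E)%E by rewrite lee_fin normc2_ge0.
have c0 : 0 <= 2 * M * e ^- 2 by rewrite !mulr_ge0 // invr_ge0 exprn_ge0 // ltW.
apply: (@le_trans _ _ (\int[P]_w ((A w)%:E + ((2 * M * e ^- 2)%:E + 8%:E * (b w)%:E)))%E).
  apply: ge0_le_integral => //.
  - by move=> w _; apply: resample_ge0 => z; rewrite lee_fin sqr_ge0.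
  - apply: (measurableT_comp _ ms); apply: measurable_resample => // z.
    by rewrite lee_fin sqr_ge0.
  - by apply: emeasurable_funD => //; apply: emeasurable_funD => //; apply: emeasurable_funM.
  move=> w _; rewrite resample_entry; last first.
    move=> z' hz x; have h := off_entry hz.
    rewrite /F (resolvent_off_entry d e h) (partial_row_off_entry d e (k := ko) h).
    by rewrite (centered_form_off_entry d e (k := ko) h).
  have dg := resolvent_diag_bound (Mw w) dj0 e0 ko.
  rewrite /F /A /b; move: dg (centered_form _ _ _ _ _).
  move: (Re (G _ _ _)) (partial_row _ _ _ _ _ _) => g [b1 b2] dg W.
  have := entry_square (mZ (ko, j) true) (mZ (ko, j) false) (Z0 ko true) (Z0 ko false) (Z1 ko) (Z2 ko) W g b1 b2.
  rewrite /normc2 /= => /le_trans; apply.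
  rewrite -!EFinM -!EFinD lee_fin -addrA lerD2l lerD2r ler_wpM2l ?mulr_ge0 //.
  move: dg => /andP[g0 ge]; rewrite -exprVn lerXn2r // nnegrE //.
  by rewrite invr_ge0 ltW.
rewrite ge0_integralD //; last 2 first.
- by move=> w _; rewrite -EFinM lee_fin addr_ge0 // mulr_ge0 // normc2_ge0.
- by apply: emeasurable_funD => //; apply: emeasurable_funM.
rewrite ge0_integralD //; last 2 first.
- by move=> w _; rewrite mule_ge0.
- by apply: emeasurable_funM.
rewrite ge0_integralZl // integral_cst // prob_setT mule1.
apply: (@le_trans _ _ ((k%:R * ((2 * M + 8) * e ^- 2))%:E + ((2 * M * e ^- 2)%:E + 8%:E * (e ^- 2)%:E))%E).
  apply: leeD; first by apply: IH; exact: ltnW.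
  rewrite leeD2l // lee_wpmul2l //.
  by apply: partial_row_moment; exact: ltnW.
rewrite -EFinM -!EFinD lee_fin -natr1; move: (e ^- 2) => u.
rewrite le_eqVlt; apply/orP; left; apply/eqP; ring.
Qed.

Lemma resform_variance :
  (\int[P]_w ((resform (Mw w) (drop_wt d j) e j - restrace (Mw w) (drop_wt d j) e) ^+ 2)%:E <=
   (p%:R * ((2 * M + 8) * e ^- 2))%:E)%E.
Proof.
apply: le_trans (centered_form_moment (leqnn p)).
by under eq_integral do rewrite -centered_form_full.
Qed.

End Moments.

End QuadraticForm.

(** * Singularity probability *)

Section RankMinors.
Variables (F : fieldType).

Lemma rowsub_free m n r (A : 'M[F]_(m, n)) (h : 'I_r -> 'I_m) :
  row_free A -> injective h -> row_free (rowsub h A).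
Proof.
move=> Af hi; have [B AB] := row_freeP Af.
apply/row_freeP; exists (B *m \matrix_(i, j) (i == h j)%:R).
rewrite mulmxA mul_rowsub_mx AB.
apply/matrixP => i j; rewrite mxE (bigD1 (h i)) //= big1 ?addr0 => [|k ki].
  by rewrite !mxE eqxx mul1r (inj_eq hi).
by rewrite !mxE eq_sym (negbTE ki) mul0r.
Qed.

(** Expresses the rank through finitely many determinants, which makes it measurable. *)
Lemma rank_minor m n r (A : 'M[F]_(m, n)) : (r <= \rank A)%N <->
  exists (f : {ffun 'I_r -> 'I_m}) (g : {ffun 'I_r -> 'I_n}), \det (mxsub f g A) != 0.
Proof.
split=> [rA|[f [g h]]].
  pose f := [ffun i => maxrankfun A (widen_ord rA i)].
  have wi : injective (widen_ord rA) by move=> i j /(congr1 val) /= /val_inj.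
  have ff : row_free (rowsub f A).
    rewrite (_ : rowsub f A = rowsub (widen_ord rA) (rowsub (maxrankfun A) A)).
      by apply: rowsub_free => //; exact: maxrowsub_free.
    by apply/matrixP => i j; rewrite !mxE ffunE.
  have tf : row_full (rowsub f A)^T by rewrite /row_full mxrank_tr.
  pose g := fullrankfun tf.
  exists f, g.
  have : rowsub g (rowsub f A)^T \in unitmx by exact: fullrowsub_unit.
  rewrite -unitmx_tr unitmxE unitfE.
  by rewrite (_ : _^T = mxsub f g A) //; apply/matrixP => i j; rewrite !mxE.
have u : mxsub f g A \in unitmx by rewrite unitmxE unitfE.
rewrite -(mxrank_unit u).
have -> : mxsub f g A = rowsub f A *m colsub g 1%:M.
  by rewrite -mxsub_mul mulmx1.
rewrite (leq_trans (mxrankM_maxl _ _)) //.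
exact: mxrankS (rowsub_sub f A).
Qed.

End RankMinors.

Section RankMeasurability.
Context (R : realType) d (T : measurableType d).
Local Notation C := R[i].

Lemma measurable_rank_ge m n (A : T -> 'M[C]_(m, n)) r : mxmeasurable A ->
  measurable [set w | (r <= \rank (A w))%N].
Proof.
move=> mA.
have -> : [set w | (r <= \rank (A w))%N] =
    \bigcup_(fg in [set: {ffun 'I_r -> 'I_m} * {ffun 'I_r -> 'I_n}])
      ~` [set w | \det (mxsub fg.1 fg.2 (A w)) = 0].
  apply/seteqP; split => w /=.
    by move=> /rank_minor [f [g h]]; exists (f, g) => //=; exact/eqP.
  by move=> [[f g] _ /= /eqP h]; apply/rank_minor; exists f, g.
apply: fin_bigcup_measurable => // fg _; apply: measurableC.
apply: measurable_eq0; apply: mxmeasurable_det => i j.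
rewrite (_ : (fun _ => _) = fun w => A w (fg.1 i) (fg.2 j)) //.
by apply/funext => w; rewrite mxE.
Qed.

(** Turns a function of the rank into a finite combination of indicators of rank events. *)
Lemma telescope_step (phi : nat -> R) k m : (k <= m)%N ->
  phi k = phi 0%N + \sum_(r < m) (phi r.+1 - phi r) * (r < k)%N%:R.
Proof.
elim: m => [|m IH]; first by rewrite leqn0 => /eqP ->; rewrite big_ord0 addr0.
rewrite leq_eqVlt big_ord_recr /= => /orP[/eqP ->|].
  rewrite ltnSn mulr1 addrA.
  rewrite (eq_bigr (fun r : 'I_m => (phi r.+1 - phi r) * (r < m)%N%:R)) => [|r _]; last first.
    by rewrite ltnS ltnW ltn_ord.
  have -> : phi 0%N + \sum_(r < m) (phi r.+1 - phi r) * (r < m)%N%:R = phi m.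
    rewrite (eq_bigr (fun r : 'I_m => phi r.+1 - phi r)) => [|r _]; last by rewrite ltn_ord mulr1.
    by rewrite -(big_mkord xpredT (fun i => phi i.+1 - phi i)) telescope_sumr // addrC subrK.
  by rewrite addrC subrK.
by rewrite ltnS => km; rewrite ltnNge km mulr0 addr0; exact: IH.
Qed.

Lemma measurable_rank_fun m n (A : T -> 'M[C]_(m, n)) (phi : nat -> R) : mxmeasurable A ->
  measurable_fun setT (fun w => phi (\rank (A w))).
Proof.
move=> mA.
have mi r : measurable_fun setT (fun w => \1_[set w | (r <= \rank (A w))%N] w : R).
  by apply: measurable_indic; exact: measurable_rank_ge.
rewrite (_ : (fun _ => _) = fun w => phi 0%N +
    \sum_(r < m) (phi r.+1 - phi r) * \1_[set w | (r.+1 <= \rank (A w))%N] w).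
  by apply: measurable_funD => //; apply: measurable_sum => r; apply: measurable_funM.
apply/funext => w; rewrite {1}(telescope_step phi (rank_leq_row (A w))); congr (_ + _).
apply: eq_bigr => r _; rewrite indicE; congr (_ * _).
have [h|h] := boolP (r < _)%N; first by rewrite mem_set.
by rewrite memNset //=; exact/negP.
Qed.

End RankMeasurability.

Section Singularity.
Context (R : realType) d (T : measurableType d) (P : probability T R).
Context (p m : nat) (Z : 'I_p * 'I_m -> bool -> T -> R).
Hypothesis mZ : forall i b, measurable_fun setT (Z i b).
Hypothesis indepZ : mutually_independent P Z.
Local Notation C := R[i].
Local Notation sample := (sample Z).
Local Notation Mw w := (config_mx (sample w)).
Variable q : R.
Hypothesis atomq : forall i u v,
  (P (Z i true @^-1` [set u] `&` Z i false @^-1` [set v]) <= q%:E)%E.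

Let ms := measurable_sample mZ.

Let msingle (i : 'I_p * 'I_m) b (u : R) : measurable (Z i b @^-1` [set u]).
Proof. by rewrite -[X in measurable X]setTI; exact: mZ. Qed.

Section SmallBall.
Variables (k : 'I_m) (n : nat) (K : 'M[C]_(p, n)).
Local Notation f := (maxrankfun K).
Local Notation vec z := (\row_i config_mx z i k).

(** When K is a cokernel matrix, this says that column k lies in a given row space, whose
    codimension is the rank of K. *)
Definition hyperplane_event : set (config R ('I_p * 'I_m)%type) :=
  [set z | vec z *m K = 0].

Lemma measurable_hyperplane_event : measurable hyperplane_event.
Proof.
have mK : mxmeasurable (fun z : config R ('I_p * 'I_m)%type => vec z *m K).
  apply: mxmeasurable_mul; last exact: mxmeasurable_cst.
  move=> i j; rewrite (_ : (fun _ => _) = fun z => config_mx z j k).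
    exact: mxmeasurable_config.
  by apply/funext => z; rewrite mxE.
rewrite (_ : hyperplane_event = \bigcap_(j in [set: 'I_n]) [set z | (vec z *m K) 0 j = 0]).
  by apply: fin_bigcap_measurable => // j _; apply: measurable_eq0.
apply/seteqP; split => z /=.
  by move=> h j _; have := congr1 (fun B : 'rV[C]_n => B 0 j) h; rewrite [RHS]mxE.
move=> h; apply/matrixP => i j; rewrite ord1 [RHS]mxE; exact: h.
Qed.

Let fs := [set f a | a : 'I_(\rank K)].
Let inJ : pred ('I_p * 'I_m) := fun i => (i.2 == k) && (i.1 \in fs).

(** The rows of K indexed by [fs] form a maximal independent family, so the equation determines the
    coordinates in [fs] from the remaining ones. *)
Let solve z : 'rV[C]_(\rank K) :=
  - (\sum_(i | i \notin fs) config_mx z i k *: row i K) *m pinvmx (rowsub f K).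

Let solveP z z' : hyperplane_event (mix inJ z z') ->
  forall a, config_mx z' (f a) k = solve z 0 a.
Proof.
rewrite /hyperplane_event /= => h a.
pose x' : 'rV[C]_(\rank K) := \row_a config_mx z' (f a) k.
suff -> : solve z = x' by rewrite [RHS]mxE.
have : x' *m rowsub f K = - \sum_(i | i \notin fs) config_mx z i k *: row i K.
  apply/eqP; rewrite -addr_eq0; apply/eqP; rewrite -[RHS]h [in RHS]mulmx_sum_row.
  rewrite [in RHS](bigID (fun i => i \in fs)) /=.
  have -> : x' *m rowsub f K = \sum_(i | i \in fs) (vec (mix inJ z z')) 0 i *: row i K.
    rewrite mulmx_sum_row big_imset /=; last by move=> ? ? _ _; exact: maxrankfun_inj.
    apply: eq_big => [b|b _]; first by rewrite inE.
    by rewrite row_rowsub !mxE /mix /inJ /= eqxx imset_f.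
  have -> // : \sum_(i | i \notin fs) config_mx z i k *: row i K =
    \sum_(i | i \notin fs) (vec (mix inJ z z')) 0 i *: row i K.
  apply: eq_bigr => i fi; rewrite !mxE /mix /inJ /= eqxx /=.
  by rewrite (negbTE fi).
by rewrite /solve => <-; rewrite mulmxKp //; exact: maxrowsub_free.
Qed.

(* Odlyzko: given the other entries, \rank K of the coordinates are forced, and each of them
   has atoms of mass at most q. *)
Lemma hyperplane_prob : (P (sample @^-1` hyperplane_event) <= (q ^+ \rank K)%:E)%E.
Proof.
have mH := measurable_hyperplane_event.
have -> : P (sample @^-1` hyperplane_event) =
    (\int[P]_w (\1_hyperplane_event (sample w))%:E)%E.
  have mS : measurable (sample @^-1` hyperplane_event).
    by rewrite -[X in measurable X]setTI; exact: ms.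
  by rewrite -(setIT (_ @^-1` _)) -integral_indic.
have m1 : measurable_fun setT (fun z => (\1_hyperplane_event z)%:E : \bar R).
  by apply/measurable_EFinP; exact: measurable_indic.
have p1 z : (0 <= (\1_hyperplane_event z)%:E :> \bar R)%E by rewrite lee_fin.
rewrite (integral_resample mZ indepZ inJ m1 p1).
apply: (@le_trans _ _ (\int[P]_w (q ^+ \rank K)%:E)%E); last first.
  by rewrite integral_cst // prob_setT mule1.
apply: ge0_le_integral => //.
- by move=> w _; exact: resample_ge0.
- by apply: (measurableT_comp _ ms); exact: measurable_resample.
move=> w _; move: (sample w) => z.
(* The rectangle that pins each forced coordinate to its value and leaves the others free. As [f] is
   injective, for i in [inJ] the sum has a single term. *)
pose A (i : 'I_p * 'I_m) b : set R := if inJ i then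
   (let x := \sum_(a | f a == i.1) solve z 0 a in
    if b then [set complex.Re x] else [set complex.Im x]) else setT.
have mA i b : measurable (A i b).
  by rewrite /A; case: (inJ i) => //; case: b => //; exact: measurable_set1.
have msA : measurable (sample @^-1` rectangle A).
  by rewrite -[X in measurable X]setTI; apply: ms => //; exact: measurable_rectangle.
apply: (@le_trans _ _ (P (sample @^-1` rectangle A))).
  rewrite /resample -(setIT (_ @^-1` _)) -integral_indic //.
  apply: ge0_le_integral => //.
  - by apply: (measurableT_comp m1); apply: measurable_mix.
  - by apply/measurable_EFinP; apply: measurable_indic.
  move=> w' _; rewrite lee_fin !indicE.
  have [h|_] := boolP (_ \in hyperplane_event); last by case: (_ \in _).
  rewrite mem_set // => -[i l] b; rewrite /A; case: ifPn => // /andP[/= /eqP -> /imsetP[a _ ->]].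
  rewrite (big_pred1 a) => [|a']; last by rewrite /= (inj_eq (@maxrankfun_inj _ _ _ K)).
  move: h; rewrite inE => /solveP /(_ a) <-.
  by rewrite mxE; case: b.
rewrite sample_rectangle // (bigID inJ) /= [X in (_ * X)%E]big1 ?mule1; last first.
  move=> i iJ; rewrite (_ : \bigcap_(b in _) _ = setT) ?probability_setT //.
  by apply/seteqP; split => // w' _ b _; rewrite /A (negbTE iJ).
have -> : \rank K = #|inJ|.
  have -> : #|inJ| = #|(pair^~ k @: fs)%SET|.
    apply: eq_card => -[i l]; rewrite /in_mem /= /inJ /=.
    apply/andP/imsetP => [[/eqP -> ifs]|[i' ifs [-> ->]]]; last by rewrite eqxx.
    by exists i.
  rewrite card_imset; last by move=> ? ? [].
  by rewrite card_imset ?card_ord //; exact: maxrankfun_inj.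
rewrite -prodr_const -prodEFin.
(* Non-negativity is carried through the induction, since products of extended reals are compared
   factor by factor only then. *)
apply: (proj2 (big_ind2 (fun x y : \bar R => (0 <= x)%E /\ (x <= y)%E) _ _ _)) => //.
  by move=> x1 x2 y1 y2 [x10 x12] [y10 y12]; split; [exact: mule_ge0|exact: lee_pmul].
move=> i iJ; split => //.
apply: (le_trans _ (atomq i (complex.Re (\sum_(a | f a == i.1) solve z 0 a))
   (complex.Im (\sum_(a | f a == i.1) solve z 0 a)))).
rewrite le_measure // ?inE.
- apply: fin_bigcap_measurable => // b _.
  by rewrite -[X in measurable X]setTI; apply: mZ.
- by apply: measurableI; exact: msingle.
- move=> w' h; split; first by have := h true Logic.I; rewrite /A iJ.
  by have := h false Logic.I; rewrite /A iJ.
Qed.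

End SmallBall.
End Singularity.

Section SingularityProbability.
Context (R : realType) d (T : measurableType d) (P : probability T R).
Context (p m : nat) (Z : 'I_p * 'I_m -> bool -> T -> R).
Hypothesis mZ : forall i b, measurable_fun setT (Z i b).
Hypothesis indepZ : mutually_independent P Z.
Local Notation C := R[i].
Local Notation sample := (sample Z).
Variable q : R.
Hypothesis atomq : forall i u v,
  (P (Z i true @^-1` [set u] `&` Z i false @^-1` [set v]) <= q%:E)%E.
Let ms := measurable_sample mZ.

(** The columns of the sample appear as rows, and later ones are zeroed, so that the format does not
    depend on k. *)
Definition initial_rows k (z : config R ('I_p * 'I_m)%type) : 'M[C]_(m, p) :=
  \matrix_(l, i) (if (l < k)%N then config_mx z i l else 0).
Definition corank k z := (p - \rank (initial_rows k z))%N.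

Lemma mxmeasurable_initial_rows k : mxmeasurable (initial_rows k).
Proof.
move=> l i; rewrite (_ : (fun _ => _) = fun z => if (l < k)%N then config_mx z i l else 0).
  by case: (l < k)%N; [exact: mxmeasurable_config|exact: cmeasurable_cst].
by apply/funext => z; rewrite mxE.
Qed.

Section Step.
Variables (k : 'I_m).
Local Notation J := (fun i : 'I_p * 'I_m => i.2 == k).

Lemma initial_rows_mix z z' : initial_rows k (mix J z z') = initial_rows k z.
Proof.
apply/matrixP => l i; rewrite !mxE /mix /=; case: ifP => // lk.
by rewrite -val_eqE /= ltn_eqF.
Qed.

Lemma initial_rows_sub z : (initial_rows k z <= initial_rows k.+1 z)%MS.
Proof.
apply/row_subP => l; have [lk|kl] := ltnP l k.
  rewrite (_ : row l _ = row l (initial_rows k.+1 z)) ?row_sub //.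
  by apply/matrixP => i i'; rewrite !mxE lk ltnS ltnW.
rewrite (_ : row l _ = 0) ?sub0mx //.
by apply/matrixP => i i'; rewrite !mxE ltnNge kl.
Qed.

(** Outside the event the new row leaves the span of the previous ones, for equal ranks would put it
    there, so the corank drops. On the event the corank is only bounded by its old value. *)
Lemma corank_step (phi : nat -> R) z z' : {homo phi : a b / (a <= b)%N >-> a <= b} ->
  0 <= phi 0%N ->
  phi (corank k.+1 (mix J z z')) <=
  phi (corank k z) * \1_(hyperplane_event k (cokermx (initial_rows k z))) z'
    + phi (corank k z).-1.
Proof.
move=> phi_homo phi0; have phi_ge0 c : 0 <= phi c by rewrite (le_trans phi0) // phi_homo.
have sub := initial_rows_sub (mix J z z'); rewrite initial_rows_mix in sub.
have rk := mxrankS sub.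
rewrite indicE; have [_|nH] := boolP (z' \in _).
  by rewrite mulr1 -[leLHS]addr0 lerD // phi_homo // leq_sub2l.
rewrite mulr0 add0r phi_homo // /corank -subnS leq_sub2l // ltn_neqAle rk andbT.
apply: contra nH => /eqP erk; rewrite inE /hyperplane_event /=.
have /andP[_ h] : (initial_rows k z == initial_rows k.+1 (mix J z z'))%MS.
  by rewrite -(mxrank_leqif_eq sub) erk.
have rs := submx_trans (row_sub k _) h.
rewrite submxE in rs; rewrite -(eqP rs); congr (_ *m _).
by apply/matrixP => i i'; rewrite !mxE /mix /= eqxx ltnSn.
Qed.

End Step.

Variables (phi : nat -> R) (s : R).
Hypothesis phi_homo : {homo phi : a b / (a <= b)%N >-> a <= b}.
Hypothesis phi_0 : phi 0%N = 0.
Hypothesis phi_1 : 1 <= phi 1%N.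
Hypothesis s0 : 0 < s.
Hypothesis phi_step : forall c, s * (q ^+ c * phi c + phi c.-1) <= phi c.

Let phi_ge0 c : 0 <= phi c.
Proof. by rewrite -phi_0 phi_homo. Qed.

Let mphi k : measurable_fun setT (fun z => (phi (corank k z))%:E : \bar R).
Proof.
apply/measurable_EFinP.
apply: (measurable_rank_fun (fun r => phi (p - r)%N) (mxmeasurable_initial_rows k)).
Qed.

(* Column k leaves the corank c unchanged with probability at most q ^ c, so phi (corank) / s
   decreases on average along the columns. *)
Lemma corank_potential_step (k : 'I_m) :
  (\int[P]_w (phi (corank k.+1 (sample w)))%:E <=
   s^-1%:E * \int[P]_w (phi (corank k (sample w)))%:E)%E.
Proof.
pose J (i : 'I_p * 'I_m) := i.2 == k.
have p0 l z : (0 <= (phi (corank l z))%:E :> \bar R)%E by rewrite lee_fin.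
have mc l : measurable_fun setT (fun w => (phi (corank l (sample w)))%:E : \bar R).
  exact: (measurableT_comp (mphi l) ms).
rewrite (integral_resample mZ indepZ J (mphi k.+1) (p0 _)).
rewrite -ge0_integralZl ?lee_fin ?invr_ge0 ?(ltW s0) //.
apply: ge0_le_integral => //.
- by move=> w _; exact: resample_ge0.
- by apply: (measurableT_comp _ ms); exact: measurable_resample.
- exact: measurable_funeM.
move=> w _; move: (sample w) => z; set c := corank k z.
pose H := hyperplane_event k (cokermx (initial_rows k z)).
have mH : measurable H by exact: measurable_hyperplane_event.
have mSH : measurable (sample @^-1` H).
  by rewrite -[X in measurable X]setTI; exact: ms.
apply: (@le_trans _ _ (\int[P]_w ((phi c)%:E * (\1_(sample @^-1` H) w)%:E + (phi c.-1)%:E))%E).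
  apply: ge0_le_integral => //.
  - by apply: (measurableT_comp (mphi _)); apply: measurable_mix.
  - apply: emeasurable_funD => //; apply: emeasurable_funM => //.
    by apply/measurable_EFinP; exact: measurable_indic.
  - by move=> w' _; rewrite -EFinM -EFinD lee_fin; exact: corank_step.
have mI : measurable_fun setT (fun w' => (\1_(sample @^-1` H) w')%:E : \bar R).
  by apply/measurable_EFinP; exact: measurable_indic.
have -> : (\int[P]_w ((phi c)%:E * (\1_(sample @^-1` H) w)%:E + (phi c.-1)%:E) =
    (phi c)%:E * \int[P]_w (\1_(sample @^-1` H) w)%:E + \int[P]_w (phi c.-1)%:E)%E.
  rewrite -ge0_integralZl ?lee_fin //.
  apply: ge0_integralD => //.
  - by move=> w' _; rewrite mule_ge0 ?lee_fin.
  - exact: measurable_funeM.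
  - by move=> w' _; rewrite lee_fin.
rewrite integral_indic // setIT integral_cst // prob_setT mule1.
have hq : (P (sample @^-1` H) <= (q ^+ c)%:E)%E.
  have := hyperplane_prob mZ indepZ atomq k (cokermx (initial_rows k z)).
  by rewrite mxrank_coker.
apply: (@le_trans _ _ ((phi c)%:E * (q ^+ c)%:E + (phi c.-1)%:E)%E).
  by rewrite leeD2r // lee_wpmul2l // lee_fin.
rewrite -!EFinM -EFinD lee_fin ler_pdivlMl // [phi c * _]mulrC.
exact: phi_step.
Qed.

(** Markov's inequality after the last column: deficient rank means corank at least 1, where phi is
    at least 1. Before any column is seen the corank is p. *)
Lemma singular_prob_potential :
  (P [set w | (\rank (config_mx (sample w)) < p)%N] <= (phi p * s ^- m)%:E)%E.
Proof.
have h k : (k <= m)%N ->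
    (\int[P]_w (phi (corank k (sample w)))%:E <= (phi p * s ^- k)%:E)%E.
  elim: k => [_|k IH km].
    have -> : (\int[P]_w (phi (corank 0 (sample w)))%:E = \int[P]_w (phi p)%:E)%E.
      apply: eq_integral => w _; rewrite /corank (_ : initial_rows 0 _ = 0) ?mxrank0 ?subn0 //.
      by apply/matrixP => i i'; rewrite !mxE.
    by rewrite integral_cst // prob_setT mule1 expr0 invr1 mulr1.
  apply: (le_trans (corank_potential_step (Ordinal km))).
  apply: (@le_trans _ _ (s^-1%:E * (phi p * s ^- k)%:E)%E).
    by rewrite lee_wpmul2l ?lee_fin ?invr_ge0 ?(ltW s0) // IH // ltnW.
  by rewrite -EFinM lee_fin mulrCA exprS invfM.
apply: le_trans (h m (leqnn m)).
set A := [set w | _].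
have AE : A = [set w | (0 < corank m (sample w))%N].
  apply/funext => w; rewrite /A /= /corank subn_gt0.
  have -> // : initial_rows m (sample w) = (config_mx (sample w))^T.
    by apply/matrixP => l i; rewrite !mxE ltn_ord.
  by rewrite mxrank_tr.
have mA : measurable A.
  have mR := @measurable_rank_ge _ _ _ _ _ (fun w => config_mx (sample w)) p.
  rewrite (_ : A = ~` [set w | (p <= \rank (config_mx (sample w)))%N]).
    apply: measurableC; apply: mR => i j; have [m1 m2] := @mxmeasurable_config R p m i j.
    by split; [exact: (measurableT_comp m1 ms)|exact: (measurableT_comp m2 ms)].
  by apply/seteqP; split => w /=; rewrite /A /= ltnNge => /negP.
rewrite -[A]setIT -integral_indic //; apply: ge0_le_integral => //.
- by apply/measurable_EFinP; exact: measurable_indic.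
- exact: (measurableT_comp (mphi m) ms).
move=> w _; rewrite lee_fin indicE; have [|_] := boolP (w \in A); last exact: phi_ge0.
by rewrite AE inE /= => h1; rewrite (le_trans phi_1) // phi_homo.
Qed.

End SingularityProbability.

Section Potential.
Context (R : realType).

(** For c >= 2 this solves [s (q^c phi c + phi (c - 1)) = phi c] exactly, normalised by phi 1 =
    1. *)
Fixpoint potential (q s : R) c : R :=
  match c with
  | 0 => 0
  | c'.+1 => if c' == 0%N then 1 else s / (1 - s * q ^+ c) * potential q s c'
  end.

(** The ratios phi (c + 1) / phi c tend to s because q^c tends to 0, so phi p grows at most like
    rho^p for any rho > s. When m exceeds p by a fixed proportion, rho can be taken so close to s
    that rho^p s^-m decays exponentially. *)
Lemma potential_exists (q : R) : 0 <= q -> q < 1 -> exists2 s : R, 1 < s &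
  forall rho : R, s < rho -> exists K : R, forall p m,
  exists phi : nat -> R, [/\ {homo phi : a b / (a <= b)%N >-> a <= b},
    phi 0%N = 0, 1 <= phi 1%N, forall c, s * (q ^+ c * phi c + phi c.-1) <= phi c &
    phi p * s ^- m <= K * (rho ^+ p * s ^- m)].
Proof.
move=> q0 q1.
(* Any s with s > 1 and s q < 1 would do; this choice also covers q = 0. *)
pose s := 2 / (1 + q).
have q10 : 0 < 1 + q by lra.
have s1 : 1 < s by rewrite /s ltr_pdivlMr //; lra.
have s0 : 0 < s by lra.
have sq1 : s * q < 1 by rewrite /s mulrAC ltr_pdivrMr //; lra.
have sqc c : s * q ^+ c.+1 <= s * q.
  rewrite ler_pM2l // exprS ler_piMr // exprn_ile1 // ltW //.
have den c : 0 < 1 - s * q ^+ c.+1 by have := sqc c; lra.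
pose ratio c := s / (1 - s * q ^+ c.+1).
have ratio1 c : 1 <= ratio c.
  rewrite /ratio ler_pdivlMr // mul1r.
  have : 0 <= s * q ^+ c.+1 by rewrite mulr_ge0 ?exprn_ge0 // ltW.
  by move: (s * q ^+ _) => u; lra.
exists s => // rho srho.
pose phi := potential q s.
have phiS c : phi c.+2 = ratio c.+1 * phi c.+1 by [].
have phi0E : phi 0%N = 0 by [].
have phi1E : phi 1%N = 1 by [].
have phi_ge0 c : 0 <= phi c.
  elim: c => [|[|c] IH]; [by rewrite phi0E|by rewrite phi1E|].
  by rewrite phiS mulr_ge0 // (le_trans ler01).
have phi_mono c : phi c <= phi c.+1.
  case: c => [|c]; first by rewrite phi1E phi0E.
  by rewrite phiS ler_peMl.
have phi_homo : {homo phi : a b / (a <= b)%N >-> a <= b}.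
  by apply: homo_leq => //; exact: le_trans.
have [J hJ] : exists J, forall c, (J <= c)%N -> ratio c <= rho.
  have : (fun c => s * q ^+ c.+1) @ \oo --> (s * 0 : R).
    apply: cvgM; first exact: cvg_cst.
    have h : (GRing.exp q) @ \oo --> (0 : R) by apply: cvg_expr; rewrite ger0_norm.
    by rewrite -cvg_shiftS in h.
  rewrite mulr0 => /cvgrPdist_lt /(_ (1 - s / rho)) [].
    by rewrite subr_gt0 ltr_pdivrMr ?mul1r //; lra.
  move=> J _ hJ; exists J => c Jc.
  have := hJ c Jc; rewrite /= sub0r normrN ger0_norm; last first.
    by rewrite mulr_ge0 ?exprn_ge0 // ltW.
  move=> h; rewrite /ratio ler_pdivrMr // mulrC -ler_pdivrMr; last by lra.
  by move: (s / rho) (s * _) h => u v; lra.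
have rho1 : 1 <= rho by lra.
(* From index J on each ratio is at most rho; the earlier ones are absorbed into the constant. *)
exists (phi J.+1) => p m; exists phi; split => //.
  case=> [|[|c]]; first by rewrite phi0E mulr0 addr0 mulr0.
    by rewrite phi1E phi0E addr0 mulr1 expr1 ltW.
  rewrite [_.-1]/= mulrDr mulrA -lerBrDl -[X in X - _]mul1r -mulrBl phiS /ratio.
  by rewrite mulrA mulrCA mulfV ?gt_eqF // mulr1.
rewrite mulrA ler_wpM2r ?invr_ge0 ?exprn_ge0 ?(ltW s0) //.
have [pJ|Jp] := leqP p J.+1.
  rewrite (le_trans (phi_homo _ _ pJ)) // ler_peMr // exprn_ege1 //.
rewrite -(subnK Jp) addnS -addSn; move: (p - J.+2)%N => k.
elim: k => [|k IH].
  rewrite add1n phiS exprS; rewrite mulrC.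
  rewrite ler_wpM2l // (le_trans (hJ _ _)) // ler_peMr ?exprn_ege1 //; lra.
rewrite addSn addSn phiS -addSn [rho ^+ _]exprS mulrCA ler_pM //.
  exact: le_trans (ratio1 _).
by apply: hJ; rewrite addSn ltnW // ltnS -addSnnS leq_addl.
Qed.

End Potential.

(** * The mean equation *)

Section MeanEquation.
Context (R : realType) d0 (T : measurableType d0) (P : probability T R).
Context (p m : nat) (Z : 'I_p * 'I_m -> bool -> T -> R).
Hypothesis mZ : forall i b, measurable_fun setT (Z i b).
Hypothesis indepZ : mutually_independent P Z.
Variables (d : 'I_m -> R) (e M : R).
Hypotheses (dge0 : forall k, 0 <= d k) (e0 : 0 < e) (M0 : 0 <= M).
Hypothesis Z0 : forall i b, (\int[P]_w (Z i b w)%:E = 0)%E.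
Hypothesis Z1 : forall i, (\int[P]_w (Z i true w ^+ 2 + Z i false w ^+ 2)%:E = 1)%E.
Hypothesis Z2 : forall i,
  (\int[P]_w ((Z i true w ^+ 2 + Z i false w ^+ 2) ^+ 2)%:E <= M%:E)%E.
Local Notation sample := (sample Z).
Local Notation Mw w := (config_mx (sample w)).
Local Notation colidx := (fun i : 'I_p * 'I_m => i.2).

Let ms := measurable_sample mZ.
Let mM : mxmeasurable (fun z : config R ('I_p * 'I_m)%type => config_mx z) := @mxmeasurable_config R p m.

Lemma agree_off_col j (z z' : config R ('I_p * 'I_m)%type) : agree_off colidx j z z' ->
  forall i k, k != j -> config_mx z i k = config_mx z' i k.
Proof. by move=> h i k kj; rewrite !mxE !h. Qed.

Lemma measurable_restrace_config e' (d' : 'I_m -> R) :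
  measurable_fun setT (fun z : config R ('I_p * 'I_m)%type => restrace (config_mx z) d' e').
Proof. exact: measurable_restrace. Qed.

Lemma restrace_config_bound (z : config R ('I_p * 'I_m)%type) :
  `|restrace (config_mx z) d e| <= p%:R / e.
Proof. by have /andP[h1 h2] := restrace_bound (config_mx z) dge0 e0; rewrite ger0_norm. Qed.

Lemma ressum_config_bound J (z : config R ('I_p * 'I_m)%type) :
  `|ressum (config_mx z) d e J| <= p%:R.
Proof. by have /andP[h1 h2] := ressum_bound (config_mx z) dge0 e0 J; rewrite ger0_norm. Qed.

Definition mean_restrace := \int[P]_w restrace (Mw w) d e.

Lemma mean_restrace_ge0 : 0 <= mean_restrace.
Proof.
by apply: Rintegral_ge0 => w _; have /andP[] := restrace_bound (Mw w) dge0 e0.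
Qed.

Lemma restrace_mean_deviation (l : R) : 0 < l ->
  \int[P]_w `|restrace (Mw w) d e - mean_restrace| <=
  2 * expR (2 * l ^+ 2 * (m%:R * e ^- 2)) / l.
Proof.
move=> l0.
have hd j z z' : agree_off colidx j z z' ->
    `|restrace (config_mx z) d e - restrace (config_mx z') d e| <= e^-1.
  by move=> /agree_off_col h; exact: restrace_diff h.
have := mean_deviation mZ indepZ (measurable_restrace_config e d) restrace_config_bound hd l0.
by rewrite sumr_const card_ord exprVn -[e ^- 2 *+ m]mulr_natl.
Qed.

Lemma restrace_tail (l t : R) : 0 < l ->
  (P [set w | (t <= `|restrace (Mw w) d e - mean_restrace|)%R] <=
   (2 * expR (2 * l ^+ 2 * (m%:R * e ^- 2) - l * t))%:E)%E.
Proof.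
move=> l0.
have hd j z z' : agree_off colidx j z z' ->
    `|restrace (config_mx z) d e - restrace (config_mx z') d e| <= e^-1.
  by move=> /agree_off_col h; exact: restrace_diff h.
have := tail_deviation mZ indepZ (measurable_restrace_config e d) restrace_config_bound hd t l0.
by rewrite sumr_const card_ord exprVn -[e ^- 2 *+ m]mulr_natl.
Qed.

Lemma ressum_tail J (l t : R) : 0 < l ->
  (P [set w | (t <= `|ressum (Mw w) d e J - \int[P]_w ressum (Mw w) d e J|)%R] <=
   (2 * expR (2 * l ^+ 2 * (m%:R * 4) - l * t))%:E)%E.
Proof.
move=> l0.
have hd j z z' : agree_off colidx j z z' ->
    `|ressum (config_mx z) d e J - ressum (config_mx z') d e J| <= 2.
  by move=> /agree_off_col h; exact: ressum_diff h J.
have mf : measurable_fun setT (fun z : config R ('I_p * 'I_m)%type => ressum (config_mx z) d e J).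
  exact: measurable_ressum.
have := tail_deviation mZ indepZ mf (ressum_config_bound J) hd t l0.
have -> : \sum_(j < m) (2 : R) ^+ 2 = m%:R * 4.
  by rewrite sumr_const card_ord -[_ *+ m]mulr_natl; congr (_ * _); rewrite expr2; ring.
by [].
Qed.

(** The first two terms come from [|v| <= v^2 / r + r] for the centred quadratic form v, the third
    from restoring column j in the trace, the last from the fluctuation of the trace. In
    [mean_error_small], r is of order p and l of order 1 / p. *)
Definition mean_error (r l : R) := p%:R * ((2 * M + 8) * e ^- 2) / r + r + e^-1
  + 2 * expR (2 * l ^+ 2 * (m%:R * e ^- 2)) / l.

Let sat (t : R) := t / (1 + t).

Let sat_lip s t : 0 <= s -> 0 <= t -> `|sat s - sat t| <= `|s - t|.
Proof.
move=> s0 t0; have s1 : 0 < 1 + s by lra.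
have t1 : 0 < 1 + t by lra.
have -> : sat s - sat t = (s - t) / ((1 + s) * (1 + t)).
  by rewrite /sat; field; rewrite !gt_eqF.
rewrite normrM normfV ler_pdivrMr ?normr_gt0 ?mulf_neq0 ?gt_eqF //.
have h : 1 <= (1 + s) * (1 + t).
  have st : 0 <= s * t by exact: mulr_ge0.
  have -> : (1 + s) * (1 + t) = 1 + s + t + s * t by ring.
  by move: (s * t) st => u u0; lra.
by rewrite ler_peMr // ger0_norm // (le_trans _ h).
Qed.

(* By Sherman-Morrison d x^*Gx = dq / (1 + dq), where q is a quadratic form in column j built from
   the remaining columns; q is close to the trace by resform_variance, and the trace to its mean. *)
Lemma mean_own_term (j : 'I_m) (r l : R) : 0 < r -> 0 < l ->
  `|\int[P]_w (d j * resform (Mw w) d e j) - d j * mean_restrace / (1 + d j * mean_restrace)|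
  <= d j * mean_error r l.
Proof.
move=> r0 l0; set tau := mean_restrace.
have tau0 : 0 <= tau := mean_restrace_ge0.
pose qf w := resform (Mw w) (drop_wt d j) e j.
pose tf w := restrace (Mw w) (drop_wt d j) e.
pose t w := restrace (Mw w) d e.
have mq : measurable_fun setT qf.
  exact: (measurableT_comp (measurable_resform (drop_wt d j) e j mM) ms).
have mtf : measurable_fun setT tf.
  exact: (measurableT_comp (measurable_restrace (drop_wt d j) e mM) ms).
have mt : measurable_fun setT t.
  exact: (measurableT_comp (measurable_restrace d e mM) ms).
have qf0 w : 0 <= qf w by apply: resform_ge0' => //; exact: drop_wt_ge0.
pose X w := d j * resform (Mw w) d e j.
have XE w : X w = sat (d j * qf w) by rewrite /X resform_own.
have mX : measurable_fun setT X.
  have mr := measurableT_comp (measurable_resform d e j mM) ms.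
  exact: (measurable_funM (measurable_cst (d j)) mr).
have X01 w : 0 <= X w <= 1.
  rewrite XE /sat; have h : 0 <= d j * qf w by rewrite mulr_ge0.
  by rewrite divr_ge0 ?addr_ge0 //= ler_pdivrMr ?mul1r ?lerDr ?ltr_pwDl.
have iX : P.-integrable setT (EFin \o X).
  apply: (@bounded_integrable _ _ _ _ _ 1) => // w.
  by have /andP[h1 h2] := X01 w; rewrite ger0_norm.
pose c := sat (d j * tau).
have mqt : measurable_fun setT (fun w => (qf w - tf w) ^+ 2).
  by apply: measurable_funX; exact: measurable_funB.
have vb : (\int[P]_w ((qf w - tf w) ^+ 2)%:E <= (p%:R * ((2 * M + 8) * e ^- 2))%:E)%E.
  exact: resform_variance.
have iqt : P.-integrable setT (EFin \o (fun w => (qf w - tf w) ^+ 2)).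
  apply/integrableP; split; first exact/measurable_EFinP.
  rewrite (eq_integral (fun w => ((qf w - tf w) ^+ 2)%:E)).
    by rewrite (le_lt_trans vb) // ltry.
  by move=> w _; rewrite /= ger0_norm // sqr_ge0.
have vR : \int[P]_w ((qf w - tf w) ^+ 2) <= p%:R * ((2 * M + 8) * e ^- 2).
  by rewrite -lee_fin (le_trans _ vb) // /Rintegral fineK //; exact: (integrable_fin_num measurableT iqt).
have mdev : measurable_fun setT (fun w => `|t w - tau|).
  by apply: measurableT_comp => //; exact: measurable_funB.
have idev : P.-integrable setT (EFin \o (fun w => `|t w - tau|)).
  apply: (@bounded_integrable _ _ _ _ _ (p%:R / e + `|tau|)) => // w /=.
  by rewrite normr_id (le_trans (ler_normB _ _)) // lerD2r; exact: restrace_config_bound.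
pose U w := d j * ((r^-1 * (qf w - tf w) ^+ 2 + `|t w - tau|) + (r + e^-1)).
have i1 : P.-integrable setT (EFin \o (fun w => r^-1 * (qf w - tf w) ^+ 2)) by exact: EFin_integrableZ.
have i2 : P.-integrable setT (EFin \o (fun w => r^-1 * (qf w - tf w) ^+ 2 + `|t w - tau|)).
  exact: EFin_integrableD.
have i3 : P.-integrable setT
    (EFin \o (fun w => (r^-1 * (qf w - tf w) ^+ 2 + `|t w - tau|) + (r + e^-1))).
  by apply: EFin_integrableD => //; exact: finite_measure_integrable_cst.
have iU : P.-integrable setT (EFin \o U) by exact: EFin_integrableZ.
have XU w : `|X w - c| <= U w.
  rewrite XE (le_trans (sat_lip _ _)) ?mulr_ge0 // -mulrBr normrM (ger0_norm (dge0 j)).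
  rewrite /U ler_wpM2l //.
  (* Stands in for Cauchy-Schwarz: when the modulus exceeds r it is at most its square divided by
     r. *)
  have h1 : `|qf w - tf w| <= r^-1 * (qf w - tf w) ^+ 2 + r.
    rewrite -[(_ - _) ^+ 2]real_normK ?num_real //; move: (`|qf w - tf w|) (normr_ge0 (qf w - tf w)) => x x0.
    have [xr|rx] := lerP x r.
      by rewrite -[leLHS]add0r lerD // mulr_ge0 ?invr_ge0 ?sqr_ge0 // ltW.
    by rewrite -[leLHS]addr0 lerD ?(ltW r0) // ler_pdivlMl // expr2 ler_wpM2r // ltW.
  have h2 : `|tf w - t w| <= e^-1.
    have /andP[h21 h22] := restrace_drop (Mw w) j dge0 e0.
    by rewrite ger0_norm.
  have -> : qf w - tau = (qf w - tf w) + (tf w - t w) + (t w - tau) by ring.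
  rewrite (le_trans (ler_normD _ _)) //.
  have h3 := ler_normD (qf w - tf w) (tf w - t w).
  move: h1 h2 h3; move: (r^-1 * _) (`|qf w - tf w|) (`|tf w - t w|) (`|_ + _|) (`|t w - tau|) => *; lra.
have XcE : \int[P]_w X w - c = \int[P]_w (X w - c).
  rewrite RintegralB //; last exact: finite_measure_integrable_cst.
  by rewrite Rintegral_prob_cst.
have mXc : measurable_fun setT (fun w => X w - c) by exact: measurable_funB.
have bXc w : `|X w - c| <= 1 + `|c|.
  by rewrite (le_trans (ler_normB _ _)) // lerD2r; have /andP[h1 h2] := X01 w; rewrite ger0_norm.
have iXc : P.-integrable setT (EFin \o (fun w => X w - c)) by exact: bounded_integrable bXc.
rewrite XcE (le_trans (le_normr_Rintegral _ iXc)) //.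
apply: (@le_trans _ _ (\int[P]_w U w)).
  apply: le_Rintegral => //.
  apply: (@bounded_integrable _ _ _ _ _ (1 + `|c|)); first exact: measurableT_comp.
  by move=> w; rewrite normr_id.
rewrite /U RintegralZl // ler_wpM2l //.
rewrite (RintegralD _ i2) //; last exact: finite_measure_integrable_cst.
rewrite (RintegralD _ i1 idev) // (RintegralZl _ _ iqt) // Rintegral_prob_cst /mean_error.
have hdev := restrace_mean_deviation l0; rewrite -/tau in hdev.
have hv : r^-1 * \int[P]_w ((qf w - tf w) ^+ 2) <= p%:R * ((2 * M + 8) * e ^- 2) / r.
  by rewrite mulrC ler_wpM2r // invr_ge0 ltW.
move: hv hdev; rewrite -/t.
move: (r^-1 * _) (\int[P]_w `|_|) (_ / r) (2 * _ / l) => a b a' b' h1 h2.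
lra.
Qed.

Lemma mean_ressum (J : pred 'I_m) (r l : R) : 0 < r -> 0 < l ->
  `|\int[P]_w ressum (Mw w) d e J -
    \sum_(j | J j) d j * mean_restrace / (1 + d j * mean_restrace)|
  <= (\sum_(j | J j) d j) * mean_error r l.
Proof.
move=> r0 l0.
have hb j w : 0 <= d j * resform (Mw w) d e j <= p%:R.
  have := ressum_bound (Mw w) dge0 e0 (pred1 j).
  by rewrite /ressum big_pred1_eq.
have mj j : measurable_fun setT (fun w => d j * resform (Mw w) d e j).
  apply: measurable_funM => //.
  exact: (measurableT_comp (measurable_resform d e j mM) ms).
have -> : \int[P]_w ressum (Mw w) d e J = \sum_(j | J j) \int[P]_w (d j * resform (Mw w) d e j).
  rewrite /ressum /index_enum; elim: (Finite.enum _) => [|j s IH].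
    rewrite big_nil -[RHS](Rintegral_prob_cst P); apply: eq_Rintegral => w _.
    by rewrite big_nil.
  rewrite big_cons; case: ifP => Jj; last first.
    by rewrite -IH; apply: eq_Rintegral => w _; rewrite big_cons Jj.
  rewrite -IH -RintegralD //.
  - by apply: eq_Rintegral => w _; rewrite big_cons Jj.
  - apply: (@bounded_integrable _ _ _ _ _ p%:R) => // w.
    by have /andP[h1 h2] := hb j w; rewrite ger0_norm.
  - apply: (@bounded_integrable _ _ _ _ _ (\sum_(i <- s | J i) p%:R)).
      rewrite (_ : (fun _ => _) = fun w => \sum_(i <- s) (if J i then d i * resform (Mw w) d e i else 0)).
        by apply: measurable_sum => i; case: (J i).
      by apply/funext => w; rewrite big_mkcond.
    move=> w; rewrite ger0_norm; last by apply: sumr_ge0 => i _; have /andP[] := hb i w.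
    by apply: ler_sum => i _; have /andP[] := hb i w.
rewrite -sumrB mulr_suml (le_trans (ler_norm_sum _ _ _)) //.
by apply: ler_sum => j _; exact: mean_own_term.
Qed.

(** This identity is exact; comparing it with the approximation of [mean_ressum] over all columns
    yields the equation for the mean trace. *)
Lemma ressum_all_mean :
  \int[P]_w ressum (Mw w) d e xpredT + e * mean_restrace = p%:R.
Proof.
have mt : measurable_fun setT (fun w => restrace (Mw w) d e).
  exact: (measurableT_comp (measurable_restrace d e mM) ms).
have it : P.-integrable setT (EFin \o (fun w => restrace (Mw w) d e)).
  by apply: (@bounded_integrable _ _ _ _ _ (p%:R / e)) => // w; exact: restrace_config_bound.
have is' : P.-integrable setT (EFin \o (fun w => ressum (Mw w) d e xpredT)).
  apply: (@bounded_integrable _ _ _ _ _ p%:R) => [|w]; last exact: ressum_config_bound.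
  exact: (measurableT_comp (measurable_ressum d e xpredT mM) ms).
rewrite /mean_restrace -RintegralZl // -RintegralD //.
- rewrite -[RHS](Rintegral_prob_cst P); apply: eq_Rintegral => w _.
  exact: (ressum_all (pencil_unit (Mw w) dge0 e0)).
- apply: (@bounded_integrable _ _ _ _ _ (e * (p%:R / e))); first exact: measurable_funM.
  by move=> w; rewrite normrM (gtr0_norm e0) ler_pM2l //; exact: restrace_config_bound.
Qed.

End MeanEquation.

(** * The limit distribution *)

Section ImproperFTC.
Context (R : realType).
Local Notation mu := (@lebesgue_measure R).

(* The primitive need not extend to the endpoints: exhaust ]l, r[ by compact intervals. *)
Lemma ge0_improper_FTC2 (g G : R -> R) (l r A B : R) : l < r ->
  (forall t, l < t < r -> 0 <= g t) ->
  (forall t, l < t < r -> {for t, continuous g}) ->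
  (forall t, l < t < r -> is_derive t 1 G (g t)) ->
  G x @[x --> l^'+] --> A -> G x @[x --> r^'-] --> B ->
  (\int[mu]_(t in `]l, r[) (g t)%:E = (B - A)%:E)%E.
Proof.
move=> lr g0 cg dG GA GB.
pose h : R := (r - l) / 3.
have h0 : 0 < h by rewrite divr_gt0 // subr_gt0.
pose an n : R := l + h / n.+1%:R.
pose bn n : R := r - h / n.+1%:R.
have hn n : 0 < h / n.+1%:R <= h.
  by rewrite divr_gt0 //= ler_pdivrMr // ler_peMr ?(ltW h0) // ler1n.
have abn n : an n < bn n.
  have /andP[_] := hn n; rewrite /an /bn; move: (h / n.+1%:R) => u; rewrite /h => ?; lra.
have inI n t : t \in `[an n, bn n] -> l < t < r.
  rewrite in_itv /= /an /bn => /andP[h1 h2]; have /andP[h3 _] := hn n.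
  by move: h1 h2 h3; move: (h / n.+1%:R) => u *; apply/andP; split; lra.
pose E n : set R := `[an n, bn n]%classic.
have Emono : nondecreasing_seq E.
  move=> n m nm; apply/subsetPset => t; rewrite /E /= !in_itv /= /an /bn => /andP[h1 h2].
  have hmn : h / m.+1%:R <= h / n.+1%:R.
    by rewrite ler_pM2l // lef_pV2 ?posrE // ler_nat ltnS.
  by move: h1 h2 hmn; move: (h / m.+1%:R) (h / n.+1%:R) => u v *; apply/andP; split; lra.
have hlim : h / n.+1%:R @[n --> \oo] --> (0 : R).
  by rewrite -[X in _ --> X](mulr0 h); apply: cvgMr; exact: cvg_harmonic.
have EU : \bigcup_n E n = `]l, r[%classic.
  apply/seteqP; split => t.
    by move=> [n _]; rewrite /E /= => /inI; rewrite in_itv.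
  rewrite /= in_itv /= => /andP[lt tr].
  have e0 : 0 < Num.min (t - l) (r - t) by rewrite lt_min !subr_gt0 lt tr.
  have [n _ /(_ n (leqnn n))] := (cvgrPdist_le _ _).1 hlim _ e0.
  rewrite /= sub0r normrN ger0_norm ?le_min; last by have /andP[/ltW] := hn n.
  move=> /andP[h1 h2]; exists n => //; rewrite /E /= in_itv /= /an /bn.
  by move: h1 h2; move: (h / n.+1%:R) => u *; apply/andP; split; lra.
have mg : measurable_fun `]l, r[ g.
  apply: open_continuous_measurable_fun => //.
  by move=> t; rewrite inE /= in_itv /= => /cg.
have cvg1 : (\int[mu]_(t in E n) (g t)%:E)%E @[n --> \oo] --> (\int[mu]_(t in \bigcup_n E n) (g t)%:E)%E.
  apply: ge0_nondecreasing_set_cvg_integral => //.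
  - by move=> n; exact: measurable_itv.
  - move=> n; apply/measurable_EFinP; apply: measurable_funS mg => //.
    by move=> t /=; rewrite /E /= => /inI; rewrite in_itv.
  - by move=> n t; rewrite /E /= => /inI ht; rewrite lee_fin; exact: g0.
have FTC n : (\int[mu]_(t in E n) (g t)%:E = (G (bn n) - G (an n))%:E)%E.
  have dGt t : t \in `[an n, bn n] -> is_derive t 1 G (g t) by move=> /inI; exact: dG.
  rewrite EFinB; apply: continuous_FTC2 => //.
  - by apply: continuous_in_subspaceT => t; rewrite inE /= => /inI; exact: cg.
  - split.
    + by move=> t tI; have ? := dGt t (subset_itv_oo_cc tI); exact: ex_derive.
    + apply: cvg_at_right_filter; apply: differentiable_continuous; apply/derivable1_diffP.
      by have := dGt (an n); rewrite in_itv /= lexx ltW //= => /(_ isT) ?; exact: ex_derive.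
    + apply: cvg_at_left_filter; apply: differentiable_continuous; apply/derivable1_diffP.
      by have := dGt (bn n); rewrite in_itv /= lexx ltW //= => /(_ isT) ?; exact: ex_derive.
  - by move=> t tI; rewrite derive1E; have ? := dGt t (subset_itv_oo_cc tI); exact: derive_val.
have cvg2 : (\int[mu]_(t in E n) (g t)%:E)%E @[n --> \oo] --> (B - A)%:E.
  rewrite (_ : (fun n => _) = (fun n => (G (bn n) - G (an n))%:E)); last first.
    by apply/funext => n; exact: FTC.
  apply: cvg_EFin; first exact: nearW.
  apply: cvgB.
  - move/cvg_at_leftP : GB; apply; split => [n|].
      by rewrite /bn ltrBlDr ltrDl; have /andP[] := hn n.
    by rewrite -[X in _ --> X]subr0; apply: cvgB => //; exact: cvg_cst.
  - move/cvg_at_rightP : GA; apply; split => [n|].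
      by rewrite /an ltrDl; have /andP[] := hn n.
    by rewrite -[X in _ --> X]addr0; apply: cvgD => //; exact: cvg_cst.
by rewrite -EU; exact: (cvg_unique _ cvg1 cvg2).
Qed.

Section ArcTerm.
Variables (l r : R).
Hypothesis lr : l < r.
Local Notation rho t := (Num.sqrt ((r - t) * (t - l))).

(* The substitution sigma^2 = (t - l) / (r - t) turns 1 / ((t + c) rho) into an arctangent. *)
Let sigma t := Num.sqrt ((t - l) / (r - t)).

Let is_derive_ratio t : t < r -> is_derive t 1 (fun t => (t - l) / (r - t)) ((r - l) / (r - t) ^+ 2).
Proof.
move=> tr; have rt : r - t != 0 by rewrite gt_eqF // subr_gt0.
have d1 : is_derive t 1 (fun t : R => t - l) 1.
  by apply: is_derive_eq; rewrite subr0.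
have d2 : is_derive t 1 (fun t : R => (r - t)^-1) (- (r - t) ^- 2 * (- 1)).
  apply: is_deriveV => //.
  by apply: is_derive_eq; rewrite add0r mul1r.
apply: (is_derive_eq (is_deriveM d1 d2)); rewrite /GRing.scale /=.
by field.
Qed.

Let is_derive_sigma t : l < t < r ->
  is_derive t 1 sigma ((r - l) / (2 * rho t * (r - t))).
Proof.
move=> /andP[lt tr].
have rt : 0 < r - t by rewrite subr_gt0.
have tl : 0 < t - l by rewrite subr_gt0.
have q0 : 0 < (t - l) / (r - t) by rewrite divr_gt0.
have d1 := is_derive_ratio tr; have d2 := is_derive1_sqrt q0.
apply: (is_derive_eq (@is_derive1_comp R Num.sqrt (fun t => (t - l) / (r - t)) t _ _ d2 d1)).
rewrite /GRing.scale /=.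
have -> : Num.sqrt ((t - l) / (r - t)) = rho t / (r - t).
  have -> : (t - l) / (r - t) = (r - t) * (t - l) * ((r - t)^-1) ^+ 2.
    by field; rewrite gt_eqF.
  by rewrite sqrtrM ?mulr_ge0 ?ltW // sqrtr_sqr gtr0_norm // invr_gt0.
have rho0 : 0 < rho t by rewrite sqrtr_gt0 mulr_gt0.
by field; rewrite !gt_eqF.
Qed.

Let cvg_sigma_left : sigma t @[t --> l^'+] --> (0 : R).
Proof.
have : sigma t @[t --> l] --> sigma l.
  apply: (@continuous_comp _ _ _ (fun t => (t - l) / (r - t)) Num.sqrt); last exact: sqrt_continuous.
  apply: differentiable_continuous; apply/derivable1_diffP.
  by have ? := is_derive_ratio lr; exact: ex_derive.
rewrite {2}/sigma subrr mul0r sqrtr0; exact: cvg_at_right_filter.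
Qed.

Let cvg_sigma_right : sigma t @[t --> r^'-] --> +oo.
Proof.
have cinv : (sigma t)^-1 @[t --> r^'-] --> (0 : R).
  have c0 : Num.sqrt ((r - t) / (t - l)) @[t --> r] --> Num.sqrt ((r - r) / (r - l)).
    apply: (@cvg_comp _ _ _ (fun t => (r - t) / (t - l)) Num.sqrt _ _ _ _ (@sqrt_continuous R _)).
    apply: cvgM; first by apply: cvgB; [exact: cvg_cst|exact: cvg_id].
    apply: cvgV; first by rewrite gt_eqF // subr_gt0.
    by apply: cvgB; [exact: cvg_id|exact: cvg_cst].
  rewrite subrr mul0r sqrtr0 in c0.
  rewrite (_ : (fun t => (sigma t)^-1) = fun t => Num.sqrt ((r - t) / (t - l))).
    exact: cvg_at_left_filter.
  apply/funext => t; rewrite /sigma -[(r - t) / _]invf_div.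
  have [u0|u0] := lerP 0 ((t - l) / (r - t)); first by rewrite sqrtrV.
  by rewrite !ltr0_sqrtr ?invr0 // invr_lt0.
have cpos : \forall t \near r^'-, 0 < sigma t.
  near=> t; have lt : l < t by near: t; exact: nbhs_left_gt.
  have tr : t < r by near: t; exact: nbhs_left_lt.
  by rewrite /sigma sqrtr_gt0 divr_gt0 // subr_gt0.
exact/(gtr0_cvgV0 cpos).
Unshelve. all: by end_near. Qed.

(** [arc_coef c * pi] will be the integral over []l, r[] of [(l + c) (r + c) / ((t + c) rho t)]; the
    sign records on which side of the interval the pole -c lies. *)
Definition arc_coef c := (if 0 < l + c then 1 else -1) * Num.sqrt ((l + c) * (r + c)).
Definition arc c t := 2 * arc_coef c * atan (Num.sqrt ((r + c) / (l + c)) * sigma t).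

Section Pole.
Variable c : R.
Hypothesis lrc : (0 <= l + c) || (r + c <= 0).

(** Keeping the factor [(l + c) (r + c)] covers a pole sitting at an endpoint, where both sides
    vanish. In the application this happens at 0 when y = 1 and at 1 when Y = 1. *)
Lemma is_derive_arc t : l < t < r ->
  is_derive t 1 (arc c) ((l + c) * (r + c) / (t + c) / rho t).
Proof.
move=> ltr; have /andP[lt tr] := ltr.
have rt : 0 < r - t by rewrite subr_gt0.
have tl : 0 < t - l by rewrite subr_gt0.
have rho0 : 0 < rho t by rewrite sqrtr_gt0 mulr_gt0.
pose k := Num.sqrt ((r + c) / (l + c)).
have ds := is_derive_sigma ltr.
have dk : is_derive t 1 (fun t => k * sigma t) (k * ((r - l) / (2 * rho t * (r - t)))).
  exact: (is_deriveZ k ds).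
have da := @is_derive1_comp R atan (fun t => k * sigma t) t _ _ (is_derive1_atan (k * sigma t)) dk.
apply: (is_derive_eq (is_deriveZ (2 * arc_coef c) da)); rewrite /GRing.scale /=.
have s2 : sigma t ^+ 2 = (t - l) / (r - t) by rewrite sqr_sqrtr // divr_ge0 // ltW.
have [pz|pn] := eqVneq ((l + c) * (r + c)) 0.
  by rewrite pz !mul0r /arc_coef pz sqrtr0 mulr0 mulr0 mul0r.
have lc : l + c != 0 by apply: contra pn => /eqP ->; rewrite mul0r.
have rc : r + c != 0 by apply: contra pn => /eqP ->; rewrite mulr0.
have pp : 0 < (l + c) * (r + c).
  case/orP: lrc => h.
    have lp : 0 < l + c by rewrite lt_neqAle eq_sym lc.
    by rewrite mulr_gt0 // (lt_trans lp) // ltrD2r.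
  have rn : r + c < 0 by rewrite lt_neqAle rc.
  by rewrite nmulr_rgt0 // (lt_trans _ rn) // ltrD2r.
have kp : 0 < (r + c) / (l + c).
  have -> : (r + c) / (l + c) = (l + c) * (r + c) / (l + c) ^+ 2 by field.
  by rewrite divr_gt0 // exprn_even_gt0.
have tc : t + c != 0.
  case/orP: lrc => h; first by rewrite gt_eqF // (le_lt_trans h) // ltrD2r.
  by rewrite lt_eqF // (lt_le_trans _ h) // ltrD2r.
have k2 : k ^+ 2 = (r + c) / (l + c) by rewrite sqr_sqrtr // ltW.
have kc : arc_coef c * k = r + c.
  rewrite /arc_coef -mulrA -sqrtrM ?(ltW pp) //.
  have -> : (l + c) * (r + c) * ((r + c) / (l + c)) = (r + c) ^+ 2 by field.
  rewrite sqrtr_sqr; case: ltrP => lc0.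
    by rewrite mul1r gtr0_norm // -(pmulr_rgt0 _ lc0).
  have lc1 : l + c < 0 by rewrite lt_neqAle lc.
  have rn : r + c < 0 by rewrite -(nmulr_rgt0 _ lc1).
  by rewrite ltr0_norm // mulN1r opprK.
rewrite exprMn k2 s2.
have -> : 1 + (r + c) / (l + c) * ((t - l) / (r - t)) = (r - l) * (t + c) / ((l + c) * (r - t)).
  by field; rewrite lc gt_eqF.
transitivity (arc_coef c * k * ((l + c) / (t + c) / rho t)).
  move: (arc_coef c) k {k2 da dk kc} => z k; field.
  by rewrite lc tc !gt_eqF // subr_gt0.
by rewrite kc; field; rewrite tc gt_eqF.
Qed.

Lemma cvg_arc_left : arc c t @[t --> l^'+] --> (0 : R).
Proof.
rewrite -[X in _ --> X](mulr0 (2 * arc_coef c)); apply: cvgMr.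
rewrite -[X in _ --> X]atan0 -[X in atan X](mulr0 (Num.sqrt ((r + c) / (l + c)))).
apply: (cvg_comp _ _ (cvgMr cvg_sigma_left)).
exact: continuous_atan.
Qed.

Lemma cvg_arc_right : arc c t @[t --> r^'-] --> arc_coef c * pi.
Proof.
have [pz|pn] := eqVneq ((l + c) * (r + c)) 0.
  have cz : arc_coef c = 0 by rewrite /arc_coef pz sqrtr0 mulr0.
  rewrite cz mul0r (_ : arc c = fun=> 0); first exact: cvg_cst.
  by apply/funext => t; rewrite /arc cz mulr0 mul0r.
have lc : l + c != 0 by apply: contra pn => /eqP ->; rewrite mul0r.
have rc : r + c != 0 by apply: contra pn => /eqP ->; rewrite mulr0.
have pp : 0 < (l + c) * (r + c).
  case/orP: lrc => h.
    have lp : 0 < l + c by rewrite lt_neqAle eq_sym lc.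
    by rewrite mulr_gt0 // (lt_trans lp) // ltrD2r.
  have rn : r + c < 0 by rewrite lt_neqAle rc.
  by rewrite nmulr_rgt0 // (lt_trans _ rn) // ltrD2r.
have kp : 0 < Num.sqrt ((r + c) / (l + c)).
  have -> : (r + c) / (l + c) = (l + c) * (r + c) / (l + c) ^+ 2 by field.
  by rewrite sqrtr_gt0 divr_gt0 // exprn_even_gt0.
have -> : arc_coef c * pi = 2 * arc_coef c * (pi / 2) by field.
apply: cvgMr; apply: (cvg_comp _ _ (gt0_cvgMry kp cvg_sigma_right)).
exact: cvgy_atan.
Qed.

End Pole.

End ArcTerm.
End ImproperFTC.

(** * The density and its Stieltjes transform *)

Section LimitDensity.
Context (R : realType).
Variables (a y Y : R).
Hypotheses (a0 : 0 < a) (y0 : 0 < y) (Y0 : 0 < Y).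
Hypothesis D0 : 0 < y - y * Y + Y.
Local Notation mu := (@lebesgue_measure R).
Local Notation K := (a * (1 - Y) - 1 + y).
Local Notation D := (y - y * Y + Y).
Local Notation l := (t_l a y Y).
Local Notation r := (t_r a y Y).
Local Notation C := (Defs.cst a y Y).
Local Notation b := (2 * a - (1 - y) * K).
Local Notation w := (a * Y - y).

Let C0 : 0 < C.
Proof. by rewrite /Defs.cst ltr_wpDl ?sqr_ge0 // mulr_gt0. Qed.

Let sD := Num.sqrt D.
Let sD0 : 0 < sD. Proof. by rewrite sqrtr_gt0. Qed.
Let sD2 : sD ^+ 2 = D. Proof. by rewrite sqr_sqrtr // ltW. Qed.
Let lE : C * l = b - 2 * a * sD.
Proof. by rewrite /t_l mulrCA divff ?mulr1 ?gt_eqF. Qed.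
Let rE : C * r = b + 2 * a * sD.
Proof. by rewrite /t_r mulrCA divff ?mulr1 ?gt_eqF. Qed.

(** In this form b is visibly positive, which gives r > 0. *)
Let bE : b = a * (1 + D) + (1 - y) ^+ 2.
Proof. by ring. Qed.

Lemma edges_lt : l < r.
Proof.
rewrite -(ltr_pM2l C0) lE rE; have := mulr_gt0 a0 sD0.
by rewrite -mulrA; move: (a * sD) b => u v; lra.
Qed.

(** The edges l and r are the roots of [C t^2 - 2 b t + (1 - y)^2], evaluated here at t = -c. At c =
    0 and c = -1 the value is a perfect square, which places the edges in [0, 1] and later produces
    [|1 - y|] and [|1 - Y|]. *)
Lemma edges_poly c : C * ((l + c) * (r + c)) = C * c ^+ 2 + 2 * b * c + (1 - y) ^+ 2.
Proof.
apply: (mulfI (lt0r_neq0 C0)).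
have -> : C * (C * ((l + c) * (r + c))) = (C * l + C * c) * (C * r + C * c) by ring.
rewrite lE rE.
have -> : (b - 2 * a * sD + C * c) * (b + 2 * a * sD + C * c) =
  (b + C * c) ^+ 2 - 4 * a ^+ 2 * sD ^+ 2 by ring.
rewrite sD2 /Defs.cst; ring.
Qed.

Lemma edge_l_ge0 : 0 <= l.
Proof.
have p := edges_poly 0; rewrite !addr0 expr0n /= !mulr0 !add0r in p.
have b0 : 0 < b.
  by rewrite bE ltr_wpDr ?sqr_ge0 // mulr_gt0 // addr_gt0.
have r0 : 0 < r.
  rewrite -(pmulr_rgt0 _ C0) rE addr_gt0 // mulr_gt0 // mulr_gt0 //.
rewrite -(pmulr_lge0 _ r0) -(pmulr_rge0 _ C0) p; exact: sqr_ge0.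
Qed.

Lemma edge_r_le1 : r <= 1.
Proof.
have p := edges_poly (- 1).
have p1 : C * ((1 - l) * (1 - r)) = (a * (1 - Y)) ^+ 2.
  have -> : C * ((1 - l) * (1 - r)) = C * ((l + -1) * (r + -1)) by ring.
  rewrite p /Defs.cst; ring.
have l1 : 0 < 1 - l.
  rewrite -(pmulr_rgt0 _ C0) mulrBr mulr1 lE /Defs.cst.
  have -> : K ^+ 2 + 4 * a - (b - 2 * a * sD) = a * (a * (1 - Y) ^+ 2 + 1 + D + 2 * sD) by ring.
  rewrite mulr_gt0 // addr_gt0 ?mulr_gt0 // addr_gt0 // ltr_wpDl //.
  by rewrite mulr_ge0 ?sqr_ge0 // ltW.
rewrite -subr_ge0 -(pmulr_rge0 _ l1) -(pmulr_rge0 _ C0) p1; exact: sqr_ge0.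
Qed.

Let ltr01 t : l < t < r -> 0 < t < 1.
Proof.
move=> /andP[lt tr]; rewrite (le_lt_trans edge_l_ge0 lt) /=.
exact: lt_le_trans tr edge_r_le1.
Qed.

Let W t : R := y * (1 - t) + a * t * Y.

Let W_gt0 t : 0 <= t <= 1 -> 0 < W t.
Proof.
move=> /andP[t0 t1]; have aY : 0 < a * Y by rewrite mulr_gt0.
have [->|tn] := eqVneq t 0; first by rewrite /W mulr0 mul0r addr0 subr0 mulr1.
rewrite /W ltr_wpDl // ?mulr_ge0 ?subr_ge0 // ?(ltW y0) //.
by rewrite mulrAC mulr_gt0 // lt_neqAle eq_sym tn.
Qed.

Definition dens_formula (t : R) :=
  Num.sqrt (C * (r - t) * (t - l)) / (2 * pi * t * (1 - t) * (y * (1 - t) + a * t * Y)).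

Lemma dens_formula_ge0 t : l < t < r -> 0 <= dens_formula t.
Proof.
move=> ltr; have /andP[t0 t1] := ltr01 ltr.
rewrite divr_ge0 ?sqrtr_ge0 // mulr_ge0 //; last first.
  by apply: ltW; apply: W_gt0; rewrite !ltW.
by rewrite !mulr_ge0 ?subr_ge0 ?ltW // pi_gt0.
Qed.

Lemma continuous_dens_formula t : l < t < r -> {for t, continuous dens_formula}.
Proof.
move=> ltr; have /andP[t0 t1] := ltr01 ltr.
have Wt : 0 < W t by apply: W_gt0; rewrite !ltW.
apply: cvgM.
  apply: (@cvg_comp _ _ _ (fun t => C * (r - t) * (t - l)) Num.sqrt _ _ _ _ (@sqrt_continuous R _)).
  apply: cvgM; last by apply: cvgB; [exact: cvg_id|exact: cvg_cst].
  by apply: cvgMr; apply: cvgB; [exact: cvg_cst|exact: cvg_id].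
apply: cvgV.
  have t1' : 0 < 1 - t by rewrite subr_gt0.
  by rewrite gt_eqF // !mulr_gt0 // pi_gt0.
apply: cvgM; first apply: cvgM; first by apply: cvgMr; exact: cvg_id.
  by apply: cvgB; [exact: cvg_cst|exact: cvg_id].
apply: cvgD.
  by apply: cvgMr; apply: cvgB; [exact: cvg_cst|exact: cvg_id].
by apply: cvgMl; apply: cvgMr; exact: cvg_id.
Qed.

Section Stieltjes.
Variable x : R.
Hypothesis x0 : 0 < x.
Hypothesis Wx : y - w * x != 0.
Local Notation S := (Num.sqrt (C * x ^+ 2 + 2 * b * x + (1 - y) ^+ 2)).

(** Closed form of the integral of [dens_formula t / (t + x)]. The four terms belong to the poles
    -x, -y / w, 0 and 1 of the integrand, in this order. *)
Definition stieltjes_ac : R :=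
  (S / (x * (1 + x) * (y - w * x)) - w * (y + Y) / (y * Y * (y - w * x))
   - `|1 - y| / (x * y) - `|1 - Y| / (Y * (1 + x))) / 2.

(* Partial fraction coefficients of rho^2 / (t (1 - t) W(t) (t + x)) at the poles 0, 1, -y/w and -x;
   the first two residues contribute |1 - y| and |1 - Y|. When w = 0, junk c3 = 0 is harmless since A3 = 0. *)
Let A0 : R := (y * x)^-1.
Let A1 : R := - (a * Y * (1 + x))^-1.
Let A3 : R := w ^+ 2 / (y * (a * Y) * (y - w * x)).
Let A4 : R := - (x * (1 + x) * (y - w * x))^-1.
Let c3 : R := y / w.
Let prim t : R := - (Num.sqrt C / (2 * pi)) *
  (A0 * arc l r 0 t + A1 * arc l r (- 1) t + A3 * arc l r c3 t + A4 * arc l r x t).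

Let lt_lr := edges_lt.

Let ok0 : (0 <= l + 0) || (r + 0 <= 0). Proof. by rewrite addr0 edge_l_ge0. Qed.
Let ok1 : (0 <= l + -1) || (r + -1 <= 0). Proof. by rewrite subr_le0 edge_r_le1 orbT. Qed.
Let ok4 : (0 <= l + x) || (r + x <= 0). Proof. by rewrite addr_ge0 ?edge_l_ge0 // ltW. Qed.

Let l01 : 0 <= l <= 1.
Proof. by rewrite edge_l_ge0 (le_trans (ltW lt_lr) edge_r_le1). Qed.
Let r01 : 0 <= r <= 1.
Proof. by rewrite (le_trans edge_l_ge0 (ltW lt_lr)) edge_r_le1. Qed.

Let shift_c3 t : w != 0 -> t + c3 = W t / w.
Proof. by move=> w0; rewrite /c3 /W; field. Qed.

Let ok3 : (0 <= l + c3) || (r + c3 <= 0).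
Proof.
have [wz|w0] := eqVneq w 0.
  by rewrite /c3 wz invr0 mulr0.
rewrite !shift_c3 //; have Wl := W_gt0 l01; have Wr := W_gt0 r01.
have [wp|wn] := ltrP 0 w; first by rewrite divr_ge0 // ltW.
apply/orP; right; rewrite mulr_ge0_le0 // ?ltW //.
by rewrite invr_lt0 lt_neqAle w0.
Qed.

Let is_derive_prim t : l < t < r -> is_derive t 1 prim (dens_formula t / (t + x)).
Proof.
move=> ltr; have /andP[t0 t1] := ltr01 ltr; have /andP[lt tr] := ltr.
have Wt : 0 < W t by apply: W_gt0; rewrite !ltW.
have d0 := is_derive_arc lt_lr ok0 ltr.
have d1 := is_derive_arc lt_lr ok1 ltr.
have d3 := is_derive_arc lt_lr ok3 ltr.
have d4 := is_derive_arc lt_lr ok4 ltr.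
have dd := is_deriveZ (- (Num.sqrt C / (2 * pi))) (is_deriveD (is_deriveD (is_deriveD
  (is_deriveZ A0 d0) (is_deriveZ A1 d1)) (is_deriveZ A3 d3)) (is_deriveZ A4 d4)).
apply: (is_derive_eq dd); rewrite /GRing.scale /= /dens_formula.
have -> : Num.sqrt (C * (r - t) * (t - l)) = Num.sqrt C * Num.sqrt ((r - t) * (t - l)).
  by rewrite -mulrA sqrtrM // ltW.
set rho := Num.sqrt ((r - t) * (t - l)).
have rho0 : 0 < rho by rewrite sqrtr_gt0 mulr_gt0 // subr_gt0.
(* Writing rho as rho^2 / rho makes the numerator polynomial, so that partial fractions apply. *)
have rho2 : rho = (r - t) * (t - l) / rho.
  by apply: (mulIf (lt0r_neq0 rho0)); rewrite mulfVK ?gt_eqF // -expr2 sqr_sqrtr // mulr_ge0 // subr_ge0 ltW.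
rewrite [in RHS]rho2.
have t1' : 0 < 1 - t by rewrite subr_gt0.
have tx : 0 < t + x by rewrite addr_gt0.
have x1 : 0 < 1 + x by rewrite addr_gt0.
have pf : A0 * ((l + 0) * (r + 0) / (t + 0)) + A1 * ((l + -1) * (r + -1) / (t + -1)) +
    A3 * ((l + c3) * (r + c3) / (t + c3)) + A4 * ((l + x) * (r + x) / (t + x)) =
    - ((r - t) * (t - l) / (t * (1 - t) * W t * (t + x))).
  have Wtn : y * (1 - t) + a * t * Y != 0 by rewrite gt_eqF.
  have t1n : t + -1 != 0 by rewrite subr_eq0 lt_eqF.
  (* When w = 0 the factor W is the constant y and its pole disappears. *)
  have [wz|w0] := eqVneq w 0.
    have aY : a * Y = y by move/eqP: wz; rewrite subr_eq0 => /eqP.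
    have Yv : Y = y / a by rewrite -aY mulrAC divff ?mul1r ?gt_eqF.
    rewrite /A0 /A1 /A3 /A4 wz expr0n /= mul0r mul0r mul0r subr0 addr0.
    rewrite /W [a * t * Y]mulrAC aY !addr0.
    have -> : y * (1 - t) + y * t = y by ring.
    by field; rewrite t1n !gt_eqF.
  rewrite (shift_c3 t w0) (shift_c3 l w0) (shift_c3 r w0) /A0 /A1 /A3 /A4 /W !addr0.
  field.
  by rewrite w0 Wtn Wx t1n !gt_eqF.
have := congr1 (fun z => - (Num.sqrt C / (2 * pi)) * (z / rho)) pf.
rewrite /W => pf'.
transitivity (- (Num.sqrt C / (2 * pi)) * ((A0 * ((l + 0) * (r + 0) / (t + 0)) + A1 * ((l + -1) * (r + -1) / (t + -1)) +
    A3 * ((l + c3) * (r + c3) / (t + c3)) + A4 * ((l + x) * (r + x) / (t + x))) / rho)).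
  by congr (_ * _); rewrite !(mulrDl _ _ rho^-1) !mulrA.
have pi0 : pi != 0 :> R by rewrite gt_eqF // pi_gt0.
rewrite pf'; move: (pi : R) pi0 => ppi pi0; field.
by rewrite pi0 !gt_eqF.
Qed.

Let sqrtC_arc c q : 0 <= q -> C * ((l + c) * (r + c)) = q ^+ 2 ->
  Num.sqrt C * arc_coef l r c = (if 0 < l + c then 1 else -1) * q.
Proof.
move=> q0 h; rewrite /arc_coef mulrCA -sqrtrM ?(ltW C0) // h sqrtr_sqr ger0_norm //.
Qed.

Lemma dens_formula_stieltjes :
  (\int[mu]_(t in `]l, r[) (dens_formula t / (t + x))%:E = stieltjes_ac%:E)%E.
Proof.
have x1 : 0 < 1 + x by rewrite addr_gt0.
have aY0 : 0 < a * Y by rewrite mulr_gt0.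
pose B := - (Num.sqrt C / (2 * pi)) * (A0 * (arc_coef l r 0 * pi) + A1 * (arc_coef l r (- 1) * pi)
   + A3 * (arc_coef l r c3 * pi) + A4 * (arc_coef l r x * pi)).
have cvgr : prim t @[t --> r^'-] --> B.
  apply: cvgMr; apply: cvgD; first apply: cvgD; first apply: cvgD.
  - by apply: cvgMr; exact: cvg_arc_right.
  - by apply: cvgMr; exact: cvg_arc_right.
  - by apply: cvgMr; exact: cvg_arc_right.
  - by apply: cvgMr; exact: cvg_arc_right.
have cvgl : prim t @[t --> l^'+] --> (0 : R).
  rewrite -[X in _ --> X](mulr0 (- (Num.sqrt C / (2 * pi)))); apply: cvgMr.
  have -> : (0 : R) = A0 * 0 + A1 * 0 + A3 * 0 + A4 * 0 by rewrite !mulr0 !addr0.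
  apply: cvgD; first apply: cvgD; first apply: cvgD.
  - by apply: cvgMr; exact: cvg_arc_left.
  - by apply: cvgMr; exact: cvg_arc_left.
  - by apply: cvgMr; exact: cvg_arc_left.
  - by apply: cvgMr; exact: cvg_arc_left.
rewrite (ge0_improper_FTC2 lt_lr _ _ is_derive_prim cvgl cvgr).
- rewrite subr0; congr EFin.
  have pi0 : pi != 0 :> R by rewrite gt_eqF // pi_gt0.
  have -> : B = - (A0 * (Num.sqrt C * arc_coef l r 0) + A1 * (Num.sqrt C * arc_coef l r (- 1))
      + A3 * (Num.sqrt C * arc_coef l r c3) + A4 * (Num.sqrt C * arc_coef l r x)) / 2.
    by rewrite /B; move: (pi : R) pi0 => ppi pi0; field.
  have h0 : Num.sqrt C * arc_coef l r 0 = `|1 - y|.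
    rewrite (sqrtC_arc (normr_ge0 (1 - y))); last first.
      by rewrite edges_poly real_normK ?num_real // expr0n /= !mulr0 !add0r.
    case: ifP => [_|/negbT]; first by rewrite mul1r.
    rewrite addr0 -leNgt => l0; have lz : l = 0 by apply/eqP; rewrite eq_le l0 edge_l_ge0.
    have := edges_poly 0; rewrite lz !addr0 mul0r mulr0 expr0n /= !mulr0 !add0r => /esym/eqP.
    by rewrite sqrf_eq0 => /eqP ->; rewrite normr0 mulr0.
  have h1 : Num.sqrt C * arc_coef l r (- 1) = - (a * `|1 - Y|).
    rewrite (@sqrtC_arc _ (a * `|1 - Y|)); last first.
    - rewrite edges_poly exprMn real_normK ?num_real // /Defs.cst; ring.
    - by rewrite mulr_ge0 // ltW.
    rewrite ifF ?mulN1r //; apply/negbTE; rewrite -leNgt subr_le0.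
    by have /andP[] := l01.
  have h4 : Num.sqrt C * arc_coef l r x = S.
    have q0 : 0 <= C * x ^+ 2 + 2 * b * x + (1 - y) ^+ 2.
      rewrite -edges_poly !mulr_ge0 ?(ltW C0) // addr_ge0 ?(ltW x0) //.
        exact: edge_l_ge0.
      by have /andP[] := r01.
    rewrite (@sqrtC_arc _ S) ?sqrtr_ge0 ?sqr_sqrtr ?edges_poly //.
    by rewrite ifT ?mul1r // ltr_wpDl // edge_l_ge0.
  (* At the pole of W the radicand is again a perfect square, and l + c3 = W l / w has the sign of
     w, which removes the absolute value. *)
  have h3 : A3 * (Num.sqrt C * arc_coef l r c3) = w * (y + Y) / (y * Y * (y - w * x)).
    have [wz|w0] := eqVneq w 0; first by rewrite /A3 wz expr0n /= !mul0r.
    have h : C * ((l + c3) * (r + c3)) = (a * (y + Y) / `|w|) ^+ 2.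
      rewrite edges_poly (expr_div_n _ `|w|) real_normK ?num_real // /c3 /Defs.cst; field.
      exact: w0.
    rewrite (sqrtC_arc _ h); last by rewrite divr_ge0 // mulr_ge0 ?addr_ge0 // ltW.
    have -> : (if 0 < l + c3 then 1 else -1) * (a * (y + Y) / `|w|) = a * (y + Y) / w.
      have Wl := W_gt0 l01; rewrite shift_c3 // pmulr_rgt0 // invr_gt0.
      have [wp|wn] := ltrP 0 w; first by rewrite mul1r gtr0_norm.
      have wn' : w < 0 by rewrite lt_neqAle w0.
      by rewrite ltr0_norm // invrN mulrN mulN1r opprK.
    rewrite /A3; field.
    by rewrite w0 Wx !gt_eqF.
  rewrite h3 h0 h1 h4 /stieltjes_ac /A0 /A1 /A4.
  move: (`|1 - y|) (`|1 - Y|) S => n1 n2 s; field.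
  by rewrite Wx !gt_eqF.
- move=> t ltr; have /andP[t0 _] := ltr01 ltr.
  by rewrite divr_ge0 ?dens_formula_ge0 // addr_ge0 // ltW.
- move=> t ltr; have /andP[t0 _] := ltr01 ltr.
  apply: cvgM; first exact: continuous_dens_formula.
  apply: cvgV; first by rewrite gt_eqF // addr_gt0.
  by apply: cvgD; [exact: cvg_id|exact: cvg_cst].
Qed.

End Stieltjes.
End LimitDensity.

(** * Test functions and positive functionals on the unit interval *)

Section TestFunctions.
Context (R : realType).
Implicit Types f g : R -> R.

(* Bounded on [0, 1], measurable inside. *)
Definition test_fun f := measurable_fun `](0 : R), 1[ f /\
  exists B, forall t, 0 <= t <= 1 -> `|f t| <= B.

Lemma test_cst c : test_fun (fun=> c).
Proof. by split; [exact: measurable_cst|exists `|c|]. Qed.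

Lemma test_id : test_fun id.
Proof.
split; first exact: measurable_id.
by exists 1 => t /andP[t0 t1]; rewrite ger0_norm.
Qed.

Lemma testD f g : test_fun f -> test_fun g -> test_fun (fun t => f t + g t).
Proof.
move=> [mf [A fA]] [mg [B gB]]; split; first exact: measurable_funD.
exists (A + B) => t t01; rewrite (le_trans (ler_normD _ _)) // lerD //.
  exact: fA.
exact: gB.
Qed.

Lemma testM f g : test_fun f -> test_fun g -> test_fun (fun t => f t * g t).
Proof.
move=> [mf [A fA]] [mg [B gB]]; split; first exact: measurable_funM.
exists (A * B) => t t01; rewrite normrM ler_pM //.
  exact: fA.
exact: gB.
Qed.

Lemma test_pole x : 0 < x -> test_fun (fun t => (t + x)^-1).
Proof.
move=> x0; split.
  apply: open_continuous_measurable_fun => // t; rewrite inE /= in_itv /= => /andP[t0 _].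
  apply: cvgV; first by rewrite gt_eqF // addr_gt0.
  by apply: cvgD; [exact: cvg_id|exact: cvg_cst].
exists x^-1 => t /andP[t0 _]; have tx : x <= t + x by rewrite lerDr.
by rewrite ger0_norm ?invr_ge0 ?(le_trans (ltW x0)) // lef_pV2 // posrE // (lt_le_trans x0).
Qed.

Lemma test_indic (u : R) : test_fun (fun t => (t <= u)%R%:R).
Proof.
split; last by exists 1 => t _; case: (t <= u); rewrite ?normr1 ?normr0.
rewrite (_ : (fun _ => _) = \1_`]-oo, u]); first exact: measurable_indic.
by apply/funext => t; rewrite indicE; congr (_ : bool)%:R; apply/idP/idP; rewrite inE /= in_itv.
Qed.

(** Common interface of the empirical spectral averages and of the limit law, so that one moment
    argument serves both. Monotonicity only looks at [0, 1], where the spectra and the limit law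
    live. *)
Definition pos_functional (L : (R -> R) -> R) := [/\
  (forall f g, test_fun f -> test_fun g -> L (fun t => f t + g t) = L f + L g),
  (forall c f, test_fun f -> L (fun t => c * f t) = c * L f) &
  (forall f g, test_fun f -> test_fun g -> (forall t, 0 <= t <= 1 -> f t <= g t) ->
     L f <= L g)].

End TestFunctions.

Section LimitFunctional.
Context (R : realType).
Variables (a y Y : R).
Hypotheses (a0 : 0 < a) (y0 : 0 < y) (Y0 : 0 < Y).
Hypothesis D0 : 0 < y - y * Y + Y.
Local Notation mu := (@lebesgue_measure R).
Local Notation l := (t_l a y Y).
Local Notation r := (t_r a y Y).
Local Notation w := (a * Y - y).
Local Notation df := (dens_formula a y Y).

Lemma edges_sub t : l < t < r -> 0 < t < 1.
Proof.
move=> /andP[lt tr]; rewrite (le_lt_trans (edge_l_ge0 a0 D0) lt) /=.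
exact: lt_le_trans tr (edge_r_le1 a0 D0).
Qed.

Lemma measurable_dens_formula : measurable_fun `]l, r[ df.
Proof.
apply: open_continuous_measurable_fun => // t; rewrite inE /= in_itv /= => ltr.
exact: (continuous_dens_formula a0 y0 Y0 D0).
Qed.

(** The density is at most 1 + x times the integrand of [dens_formula_stieltjes], whose integral is
    finite. The point x is 1 or 2, since y = w x cannot hold for both. *)
Lemma integrable_dens_formula : mu.-integrable `]l, r[ (EFin \o df).
Proof.
have [x x0 Wx] : exists2 x : R, 0 < x & y - w * x != 0.
  have [wy|wy] := eqVneq w y; last by exists 1; rewrite // mulr1 subr_eq0 eq_sym.
  by exists 2; rewrite // wy mulr2n mulrDr mulr1 opprD addNKr oppr_eq0 gt_eqF.
apply/integrableP; split; first by apply/measurable_EFinP; exact: measurable_dens_formula.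
have x1 : 0 < 1 + x by rewrite addr_gt0.
apply: (@le_lt_trans _ _ (\int[mu]_(t in `]l, r[) ((1 + x)%:E * (df t / (t + x))%:E))%E).
  apply: ge0_le_integral => //.
  - apply: measurableT_comp => //; apply/measurable_EFinP; exact: measurable_dens_formula.
  - apply: measurable_funeM; apply/measurable_EFinP; apply: measurable_funM.
      exact: measurable_dens_formula.
    have [+ _] := test_pole x0; apply: measurable_funS => // t /=.
    by rewrite !in_itv /= => /edges_sub.
  - move=> t /=; rewrite in_itv /= => ltr; have /andP[t0 t1] := edges_sub ltr.
    rewrite -EFinM lee_fin ger0_norm ?dens_formula_ge0 // mulrCA ler_peMr ?dens_formula_ge0 //.
    by rewrite ler_pdivlMr ?addr_gt0 // mul1r lerD2r ltW.
rewrite ge0_integralZl //.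
- by rewrite (dens_formula_stieltjes a0 y0 Y0 D0 x0 Wx) -EFinM ltry.
- apply/measurable_EFinP; apply: measurable_funM; first exact: measurable_dens_formula.
  have [+ _] := test_pole x0; apply: measurable_funS => // t /=.
  by rewrite !in_itv /= => /edges_sub.
- move=> t /= ; rewrite in_itv /= => ltr; have /andP[t0 _] := edges_sub ltr.
  by rewrite lee_fin divr_ge0 ?dens_formula_ge0 // addr_ge0 // ltW.
- by rewrite lee_fin ltW.
Qed.

Lemma integrable_test f : test_fun f ->
  mu.-integrable `]l, r[ (EFin \o (fun t => f t * df t)).
Proof.
move=> [mf [B fB]].
have B0 : 0 <= B by apply: le_trans (fB 0 _); rewrite ?normr_ge0 ?lexx ?ler01.
apply: (@le_integrable _ _ _ mu _ _ _ (fun t => B%:E * (EFin \o df) t)%E) => //.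
- apply/measurable_EFinP; apply: measurable_funM; last exact: measurable_dens_formula.
  by apply: measurable_funS mf => // t /=; rewrite !in_itv /= => /edges_sub.
- move=> t /=; rewrite in_itv /= => ltr; have /andP[t0 t1] := edges_sub ltr.
  rewrite lee_fin !normrM ler_wpM2r //.
  by rewrite (le_trans _ (ler_norm _)) // fB // !ltW.
- by apply: integrableZl => //; exact: integrable_dens_formula.
Qed.

Definition mass0 := if 1 < y then 1 - y^-1 else 0.
Definition mass1 := if 1 < Y then 1 - Y^-1 else 0.
Definition lim_functional f :=
  mass0 * f 0 + mass1 * f 1 + \int[mu]_(t in `]l, r[) (f t * df t).

(** A form without cases, whose absolute value cancels against the terms [|1 - y|] and [|1 - Y|] of
    [stieltjes_ac]. *)
Let atom_massE z : 0 < z -> (if 1 < z then 1 - z^-1 else 0) = (z - 1 + `|1 - z|) / (2 * z) :> R.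
Proof.
move=> z0; case: ltrP => z1.
  by field; rewrite gt_eqF.
by rewrite addrC subrKA subrr mul0r.
Qed.

Let atom_mass_ge0 z : 0 < z -> 0 <= (if 1 < z then 1 - z^-1 else 0) :> R.
Proof. by move=> z0; case: ltrP => // z1; rewrite subr_ge0 invf_le1 // ltW. Qed.

Lemma lim_functional_pos : pos_functional lim_functional.
Proof.
split.
- move=> f g tf tg; rewrite /lim_functional; under eq_Rintegral do rewrite mulrDl.
  rewrite RintegralD //; [|exact: integrable_test|exact: integrable_test].
  by ring.
- move=> c f tf; rewrite /lim_functional; under eq_Rintegral do rewrite -mulrA.
  rewrite RintegralZl //; last exact: integrable_test.
  by ring.
- move=> f g tf tg fg; rewrite /lim_functional; apply: lerD; first apply: lerD.
  + by apply: ler_wpM2l; [exact: atom_mass_ge0|apply: fg; rewrite lexx ler01].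
  + by apply: ler_wpM2l; [exact: atom_mass_ge0|apply: fg; rewrite lexx ler01].
  + apply: le_Rintegral => //; [exact: integrable_test|exact: integrable_test|].
    move=> t; rewrite /= in_itv /= => ltr; have /andP[t0 t1] := edges_sub ltr.
    by rewrite ler_wpM2r ?dens_formula_ge0 // fg // !ltW.
Qed.

(* g is the positive root of a quadratic whose discriminant is the radicand of stieltjes_ac. *)
Lemma lim_functional_pole x g : 0 < x -> y - w * x != 0 -> 0 < g ->
  (1 + x) * g / (1 + (1 + x) * y * g) + x * a * g / (1 + x * a * Y * g) = 1 ->
  lim_functional (fun t => (t + x)^-1) = (1 - g / (1 + (1 + x) * y * g)) / x.
Proof.
move=> x0 Wx g0 eqg.
have x1 : 0 < 1 + x by rewrite addr_gt0.
have d1 : 0 < 1 + (1 + x) * y * g by rewrite addr_gt0 // !mulr_gt0.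
have d2 : 0 < 1 + x * a * Y * g by rewrite addr_gt0 // !mulr_gt0.
pose D : R := y - y * Y + Y.
pose B := (1 + x) * (1 - y) + x * a * (1 - Y).
have quad : (1 + x) * (x * a) * D * g ^+ 2 + B * g - 1 = 0.
  have -> : (1 + x) * (x * a) * D * g ^+ 2 + B * g - 1 =
    (1 + (1 + x) * y * g) * (1 + x * a * Y * g) *
    ((1 + x) * g / (1 + (1 + x) * y * g) + x * a * g / (1 + x * a * Y * g) - 1).
    by rewrite /D /B; field; rewrite !gt_eqF.
  by rewrite eqg subrr mulr0.
(* The derivative of the quadratic at its root g: its square is the discriminant, and it is
   non-negative because g is the positive root. *)
pose S := 2 * ((1 + x) * (x * a) * D) * g + B.
have S0 : 0 <= S.
  rewrite -(pmulr_lge0 _ g0).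
  have -> : S * g = (1 + x) * (x * a) * D * g ^+ 2 + 1 +
     ((1 + x) * (x * a) * D * g ^+ 2 + B * g - 1) by rewrite /S; ring.
  by rewrite quad addr0 addr_ge0 // mulr_ge0 ?sqr_ge0 // ltW // !mulr_gt0.
have sqrtS : Num.sqrt (Defs.cst a y Y * x ^+ 2 +
    2 * (2 * a - (1 - y) * (a * (1 - Y) - 1 + y)) * x + (1 - y) ^+ 2) = S.
  rewrite -[RHS](ger0_norm S0) -sqrtr_sqr; congr Num.sqrt.
  have -> : S ^+ 2 = 4 * ((1 + x) * (x * a) * D) * ((1 + x) * (x * a) * D * g ^+ 2 + B * g - 1)
     + 4 * ((1 + x) * (x * a) * D) + B ^+ 2 by rewrite /S; ring.
  by rewrite quad /B /D /Defs.cst; ring.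
rewrite /lim_functional /mass0 /mass1 !atom_massE // add0r.
have -> : \int[mu]_(t in `]l, r[) ((t + x)^-1 * df t) = stieltjes_ac a y Y x.
  rewrite /Rintegral; under eq_integral do rewrite mulrC.
  by rewrite (dens_formula_stieltjes a0 y0 Y0 D0 x0 Wx).
rewrite /stieltjes_ac sqrtS; move: `|1 - y| `|1 - Y| => n1 n2.
apply/eqP; rewrite -subr_eq0; apply/eqP.
(* The difference of the two sides is a multiple of the quadratic that vanishes at g. *)
transitivity (((1 + x) * (x * a) * D * g ^+ 2 + B * g - 1) * y / (x * (y - w * x)) /
  (1 + (1 + x) * y * g)); last by rewrite quad !mul0r.
rewrite /S /B /D; field.
by rewrite Wx !gt_eqF.
Qed.

Lemma FlimE u : Flim a y Y u = lim_functional (fun t => (t <= u)%R%:R).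
Proof.
rewrite /Flim /lim_functional /mass0 /mass1; congr (_ + _ + _).
- by case: (1 < y); case: (0 <= u); rewrite /= ?mulr1 ?mulr0 ?mul0r.
- by case: (1 < Y); case: (1 <= u); rewrite /= ?mulr1 ?mulr0 ?mul0r.
rewrite /Rintegral; congr fine.
transitivity (\int[mu]_t ((fun t => (dens a y Y t)%:E) \_ `]-oo, u]) t)%E.
  exact: integral_mkcond.
transitivity (\int[mu]_t ((fun t => ((t <= u)%R%:R * df t)%:E) \_ `]l, r[) t)%E; last first.
  by apply/esym; exact: integral_mkcond.
apply: eq_integral => t _.
rewrite !patchE /dens; have -> : (t \in `]-oo, u]%classic) = (t <= u).
  by apply/idP/idP; rewrite inE /= in_itv.
have -> : (t \in `]l, r[%classic) = (l < t) && (t < r).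
  by apply/idP/idP; rewrite inE /= in_itv.
by case: (t <= u); case: ifP; rewrite ?mul1r ?mul0r.
Qed.

End LimitFunctional.

(** * Moments and distribution functions *)

Section PosFunctional.
Context (R : realType).
Implicit Types f g : R -> R.

Lemma test_exp j : test_fun (fun t : R => t ^+ j).
Proof.
elim: j => [|j IH]; first exact: test_cst.
by have := testM (@test_id R) IH; rewrite (_ : (fun t => id t * _) = fun t => t ^+ j.+1) //;
  apply/funext => t; rewrite exprS.
Qed.

Lemma test_horner (q : {poly R}) : test_fun (fun t => q.[t]).
Proof.
elim/poly_ind: q => [|q c IH].
  by rewrite (_ : (fun t => _) = fun=> 0); [exact: test_cst|apply/funext => t; rewrite horner0].
rewrite (_ : (fun t => _) = fun t => q.[t] * t + c).
  by apply: testD; [apply: testM => //; exact: test_id|exact: test_cst].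
by apply/funext => t; rewrite hornerMXaddC.
Qed.

Section Functional.
Variables (L : (R -> R) -> R) (posL : pos_functional L).

Lemma pos_functional_le f g c : test_fun f -> test_fun g ->
  (forall t, 0 <= t <= 1 -> f t <= g t + c) -> L f <= L g + c * L (fun=> 1).
Proof.
case: posL => LD LZ Lle tf tg fg; rewrite -LZ; last exact: test_cst.
have tc : test_fun (fun t : R => c * 1) by exact: test_cst.
by rewrite -LD //; apply: Lle => //; [exact: testD|move=> t /fg; rewrite mulr1].
Qed.

Lemma pos_functional_dist f g c : test_fun f -> test_fun g ->
  (forall t, 0 <= t <= 1 -> `|f t - g t| <= c) -> `|L f - L g| <= c * L (fun=> 1).
Proof.
move=> tf tg fg.
have h1 : L f <= L g + c * L (fun=> 1).
  apply: pos_functional_le => // t /fg; rewrite ler_norml => /andP[_]; lra.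
have h2 : L g <= L f + c * L (fun=> 1).
  apply: pos_functional_le => // t /fg; rewrite ler_norml => /andP[]; lra.
rewrite ler_norml; apply/andP; split; move: h1 h2; lra.
Qed.

Lemma pos_functional_ext f g : test_fun f -> test_fun g ->
  (forall t, 0 <= t <= 1 -> f t = g t) -> L f = L g.
Proof.
move=> tf tg fg; case: posL => _ _ Lle; apply/eqP.
by rewrite eq_le !Lle // => t /fg ->.
Qed.

Lemma pos_functional_ge0 : 0 <= L (fun=> 1).
Proof.
case: posL => LD LZ Lle.
have <- : L (fun=> 0 * 1) = 0 by rewrite LZ ?mul0r //; exact: test_cst.
by apply: Lle => [||t _]; [exact: test_cst|exact: test_cst|rewrite mul0r ler01].
Qed.

(* Division of t^j by t + k. *)
Lemma pos_functional_pole_rec j k : 0 < k ->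
  L (fun t => t ^+ j.+1 * (t + k)^-1) =
  L (fun t => t ^+ j) - k * L (fun t => t ^+ j * (t + k)^-1).
Proof.
move=> k0; have tp := test_pole k0; have tj := test_exp j.
case: posL => LD LZ _; rewrite -mulNr -LZ; last exact: testM.
rewrite -LD //; last by apply: testM; [exact: test_cst|exact: testM].
apply: pos_functional_ext.
- by apply: testM => //; exact: test_exp.
- by apply: testD => //; apply: testM; [exact: test_cst|exact: testM].
move=> t /andP[t0 _]; rewrite exprS; field.
by rewrite gt_eqF // ltr_wpDl.
Qed.

Lemma pos_functional_pole_approx j k : 0 < k ->
  `|L (fun t => t ^+ j) - k * L (fun t => t ^+ j * (t + k)^-1)| <= k^-1 * L (fun=> 1).
Proof.
move=> k0; have tp := test_pole k0; have tj := test_exp j.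
case: posL => LD LZ _; rewrite -LZ; last exact: testM.
apply: pos_functional_dist => //.
  by apply: testM; [exact: test_cst|exact: testM].
move=> t /andP[t0 t1]; have tk : 0 < t + k by rewrite ltr_wpDl.
have -> : t ^+ j - k * (t ^+ j * (t + k)^-1) = t ^+ j.+1 / (t + k).
  by rewrite exprS; field; rewrite gt_eqF.
rewrite ger0_norm ?divr_ge0 ?exprn_ge0 ?(ltW tk) //.
rewrite ler_pdivrMr // (@le_trans _ _ 1) ?exprn_ile1 //.
by rewrite mulrDr mulVf ?gt_eqF // lerDr mulr_ge0 // invr_ge0 ltW.
Qed.

End Functional.

(* With s affine, s(c) = 1/2 at the midpoint c of [u, v], the polynomial (1 - s^m)^(2^m) switches
   from 1 to 0 at c by Bernoulli's inequality. *)
Lemma indicator_approx (u v eta : R) : u < v -> 0 < eta ->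
  exists q : {poly R}, forall t, 0 <= t <= 1 ->
    (t <= u)%R%:R <= q.[t] + eta /\ q.[t] <= (t <= v)%R%:R + eta.
Proof.
move=> uv eta0.
pose c := (u + v) / 2; pose z := 2 + `|c|.
have z2 : 2 <= z by rewrite lerDl.
have z0 : 0 < z by rewrite (lt_le_trans _ z2).
(* [2 * s t] is at most 1 - d for t <= u and at least 1 + d for t > v; rho bounds the decay rate on
   both sides. *)
pose d := (v - u) / (2 * z).
have d0 : 0 < d by rewrite divr_gt0 ?subr_gt0 ?mulr_gt0.
pose rho := Num.max (1 - d) (1 + d)^-1.
have rho01 : 0 <= rho < 1.
  rewrite le_max invr_ge0 (_ : 0 <= 1 + d) ?orbT /=; last by rewrite addr_ge0 // ltW.
  by rewrite gt_max gtrBl d0 invf_lt1 ?ltrDl ?d0 // ltr_wpDl // ltW.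
have [m rm] : exists m, rho ^+ m <= eta.
  have cv : rho ^+ m @[m --> \oo] --> (0 : R).
    by apply: cvg_expr; case/andP: rho01 => r0 r1; rewrite ger0_norm.
  have [m _ /(_ m (leqnn m))] := (cvgrPdist_le _ _).1 cv _ eta0.
  by rewrite /= sub0r normrN => h; exists m; rewrite (le_trans (ler_norm _)).
pose s t : R := 2^-1 + (t - c) / (2 * z).
pose q : {poly R} := (1 - ((2 * z)^-1 *: ('X - c%:P) + (2^-1)%:P) ^+ m) ^+ (2 ^ m).
have qE t : q.[t] = (1 - s t ^+ m) ^+ (2 ^ m).
  by rewrite /q /s !hornerE; congr ((1 - _ ^+ m) ^+ _); rewrite addrC mulrC.
exists q => t /andP[t0 t1]; rewrite qE.
have sz : 0 <= s t <= 1.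
  have h : `|(t - c) / (2 * z)| <= 2^-1.
    rewrite normrM [`|(2 * z)^-1|]gtr0_norm ?invr_gt0 ?mulr_gt0 //.
    rewrite ler_pdivrMr ?mulr_gt0 // mulrA mulVf ?mul1r //.
    rewrite (le_trans (ler_normB _ _)) // ger0_norm // lerD2r //.
    by rewrite (le_trans t1) // ler1n.
  move: h; rewrite ler_norml /s; move: ((t - c) / _) => e /andP[h1 h2].
  by apply/andP; split; lra.
case/andP: sz => s0 s1.
have sm : 0 <= s t ^+ m <= 1 by rewrite exprn_ge0 // exprn_ile1.
case/andP: sm => sm0 sm1.
have q0 : 0 <= (1 - s t ^+ m) ^+ (2 ^ m) by rewrite exprn_ge0 // subr_ge0.
have q1 : (1 - s t ^+ m) ^+ (2 ^ m) <= 1 by rewrite exprn_ile1 ?subr_ge0 // gerBl.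
have pw : (2 ^ m)%:R * s t ^+ m = (2 * s t) ^+ m :> R by rewrite natrX exprMn.
have s2 : 2 * s t = 1 + (t - c) / z by rewrite /s; field; rewrite gt_eqF.
split.
- have [tu|tu] := leP t u; last by rewrite addr_ge0 // ltW.
  have h : 1 - (2 ^ m)%:R * s t ^+ m <= (1 - s t ^+ m) ^+ (2 ^ m).
    have B n : 1 - n%:R * s t ^+ m <= (1 - s t ^+ m) ^+ n.
      elim: n => [|n IH]; first by rewrite mul0r subr0 expr0.
      rewrite exprSr; apply: (@le_trans _ _ ((1 - n%:R * s t ^+ m) * (1 - s t ^+ m))); last first.
        by rewrite ler_wpM2r // subr_ge0.
      have -> : (1 - n%:R * s t ^+ m) * (1 - s t ^+ m) =
        1 - n.+1%:R * s t ^+ m + n%:R * (s t ^+ m) ^+ 2 by rewrite -natr1; ring.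
      by rewrite lerDl mulr_ge0 // sqr_ge0.
    exact: B.
  rewrite /= -lerBlDr (le_trans _ h) // pw lerD2l lerN2 (le_trans _ rm) //.
  rewrite lerXn2r ?nnegrE ?mulr_ge0 //; first by case/andP: rho01.
  rewrite s2 le_max; apply/orP; left.
  have : (t - c) / z <= - d.
    rewrite /d ler_pdivrMr // (_ : - ((v - u) / (2 * z)) * z = - ((v - u) / 2)); last first.
      by field; rewrite gt_eqF.
    by rewrite /c; lra.
  by move: (_ / z) => e; lra.
- have [tv|tv] := leP t v; first by rewrite /= (le_trans q1) // lerDl ltW.
  rewrite /= add0r (le_trans _ rm) //.
  have s20 : 1 + d <= 2 * s t.
    rewrite s2 lerD2l /d ler_pdivlMr // (_ : (v - u) / (2 * z) * z = (v - u) / 2); last first.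
      by field; rewrite gt_eqF.
    by rewrite /c; lra.
  have d1 : 0 < 1 + d by rewrite addr_gt0.
  have sp : 0 < 2 * s t by rewrite (lt_le_trans d1).
  apply: (@le_trans _ _ ((2 * s t) ^+ m)^-1); last first.
    rewrite -exprVn lerXn2r ?nnegrE ?invr_ge0 ?(ltW sp) //; first by case/andP: rho01.
    by rewrite le_max; apply/orP; right; rewrite lef_pV2.
  rewrite -[leRHS]mul1r ler_pdivlMr ?exprn_gt0 // -pw.
  (* With k = 2^m and z = s^m, combine Bernoulli's bound k z <= (1 + z)^k with (1 - z)^k (1 + z)^k
     <= 1. *)
  have h : (2 ^ m)%:R * s t ^+ m <= (1 + s t ^+ m) ^+ (2 ^ m).
    have B n : 1 + n%:R * s t ^+ m <= (1 + s t ^+ m) ^+ n.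
      elim: n => [|n IH]; first by rewrite mul0r addr0 expr0.
      rewrite exprSr; apply: (@le_trans _ _ ((1 + n%:R * s t ^+ m) * (1 + s t ^+ m))); last first.
        by rewrite ler_wpM2r // addr_ge0.
      have -> : (1 + n%:R * s t ^+ m) * (1 + s t ^+ m) =
        1 + n.+1%:R * s t ^+ m + n%:R * (s t ^+ m) ^+ 2 by rewrite -natr1; ring.
      by rewrite lerDl mulr_ge0 // sqr_ge0.
    by apply: le_trans (B _); rewrite lerDr.
  apply: le_trans (ler_wpM2l q0 h) _; rewrite -exprMn.
  have -> : (1 - s t ^+ m) * (1 + s t ^+ m) = 1 - (s t ^+ m) ^+ 2 by ring.
  by rewrite exprn_ile1 ?gerBl ?sqr_ge0 // subr_ge0 exprn_ile1.
Qed.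

Section Convergence.
Variables (Ln : nat -> (R -> R) -> R) (L : (R -> R) -> R).
Hypotheses (posLn : forall n, pos_functional (Ln n)) (posL : pos_functional L).
Hypothesis Ln1 : forall n, Ln n (fun=> 1) <= 1.
Variable k0 : nat.
Hypothesis k00 : (0 < k0)%N.
Hypothesis cvg_poles : forall k, (k0 <= k)%N ->
  Ln n (fun t => (t + k%:R)^-1) @[n --> \oo] --> L (fun t => (t + k%:R)^-1).

(* t^j k / (t + k) tends to t^j uniformly as k grows, so the poles determine the moments. *)
Lemma cvg_moments j :
  Ln n (fun t => t ^+ j) @[n --> \oo] --> L (fun t => t ^+ j) /\
  forall k, (k0 <= k)%N ->
  Ln n (fun t => t ^+ j * (t + k%:R)^-1) @[n --> \oo] --> L (fun t => t ^+ j * (t + k%:R)^-1).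
Proof.
have kp k : (k0 <= k)%N -> 0 < k%:R :> R by move=> h; rewrite ltr0n (leq_trans k00).
have pole_mom i : (forall k, (k0 <= k)%N ->
    Ln n (fun t => t ^+ i * (t + k%:R)^-1) @[n --> \oo] --> L (fun t => t ^+ i * (t + k%:R)^-1)) ->
    Ln n (fun t => t ^+ i) @[n --> \oo] --> L (fun t => t ^+ i).
  move=> h; apply/cvgrPdist_le => e e0.
  have L0 := pos_functional_ge0 posL.
  (* So large that replacing t^i by k t^i / (t + k) costs at most e / 2 for both functionals
     together; the first functional has mass at most 1. *)
  pose k := maxn k0 (Num.truncn ((1 + L (fun=> 1)) / (e / 2))).+1.
  have k0k : (k0 <= k)%N by exact: leq_maxl.
  have kL : (1 + L (fun=> 1)) / k%:R <= e / 2.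
    rewrite ler_pdivrMr ?kp // mulrC -ler_pdivrMr ?divr_gt0 //.
        apply: (@le_trans _ _ (Num.truncn ((1 + L (fun=> 1)) / (e / 2))).+1%:R).
      by apply: ltW; exact: truncnS_gt.
    by rewrite ler_nat leq_maxr.
  have e2 : 0 < e / 2 / k%:R by rewrite !divr_gt0 // kp.
  have [n0 _ hn0] := (cvgrPdist_le _ _).1 (h k k0k) _ e2; exists n0 => // n /hn0.
  have hL := pos_functional_pole_approx posL i (kp k k0k).
  have hn := pos_functional_pole_approx (posLn n) i (kp k k0k).
  have hn' : `|Ln n (fun t => t ^+ i) - k%:R * Ln n (fun t => t ^+ i * (t + k%:R)^-1)| <= k%:R^-1.
    by apply: le_trans hn _; rewrite ler_piMr // invr_ge0 ltW // kp.
  rewrite ler_pdivlMr ?kp // => hk.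
  have hk' : `|k%:R * L (fun t => t ^+ i * (t + k%:R)^-1) - k%:R * Ln n (fun t => t ^+ i * (t + k%:R)^-1)| <= e / 2.
    by rewrite -mulrBr normrM mulrC [`|k%:R|]gtr0_norm ?kp.
  move: hL hn' hk' kL; rewrite mulrDl mul1r [L (fun=> 1) / _]mulrC.
  move: (Ln n _) (L _) (k%:R * _) (k%:R * _) (k%:R^-1) (k%:R^-1 * _) => A B C D F G.
  rewrite !ler_norml => /andP[? ?] /andP[? ?] /andP[? ?] ?; apply/andP; split; lra.
have base : forall k, (k0 <= k)%N ->
    Ln n (fun t => t ^+ 0 * (t + k%:R)^-1) @[n --> \oo] --> L (fun t => t ^+ 0 * (t + k%:R)^-1).
  move=> k hk; rewrite (_ : (fun t => t ^+ 0 * _) = fun t => (t + k%:R)^-1); first exact: cvg_poles.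
  by apply/funext => t; rewrite mul1r.
elim: j => [|j [IH1 IH2]]; first by split; [exact: pole_mom|].
have step : forall k, (k0 <= k)%N ->
    Ln n (fun t => t ^+ j.+1 * (t + k%:R)^-1) @[n --> \oo] --> L (fun t => t ^+ j.+1 * (t + k%:R)^-1).
  move=> k hk; rewrite (pos_functional_pole_rec posL j (kp k hk)).
  under eq_fun do rewrite (pos_functional_pole_rec (posLn _) j (kp k hk)).
  by apply: cvgB => //; apply: cvgMr; exact: IH2.
by split; [exact: pole_mom|].
Qed.

Lemma cvg_horner (q : {poly R}) :
  Ln n (fun t => q.[t]) @[n --> \oo] --> L (fun t => q.[t]).
Proof.
have lin F : pos_functional F -> F (fun t => q.[t]) = \sum_(i < size q) q`_i * F (fun t => t ^+ i).
  case=> FD FZ _; rewrite (_ : (fun t => q.[t]) = fun t => \sum_(i < size q) q`_i * t ^+ i); last first.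
    by apply/funext => t; rewrite horner_coef.
  elim: (size q) => [|k IH].
    rewrite big_ord0; have := FZ 0 (fun=> 0) (test_cst 0); rewrite [RHS]mul0r => F0.
    by rewrite -[RHS]F0; congr F; apply/funext => t; rewrite big_ord0 mul0r.
  rewrite big_ord_recr /= -IH -FZ; last exact: test_exp.
  rewrite -FD; first by congr F; apply/funext => t; rewrite big_ord_recr.
  - elim: k {IH} => [|k IH].
      by rewrite (_ : (fun t => _) = fun=> 0); [exact: test_cst|apply/funext => t; rewrite big_ord0].
    rewrite (_ : (fun t => _) = fun t => \sum_(i < k) q`_i * t ^+ i + q`_k * t ^+ k); last first.
      by apply/funext => t; rewrite big_ord_recr.
    by apply: testD => //; apply: testM; [exact: test_cst|exact: test_exp].
  - by apply: testM; [exact: test_cst|exact: test_exp].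
rewrite lin //; under eq_fun do rewrite lin //.
elim: (size q) => [|k IH].
  by rewrite big_ord0; under eq_fun do rewrite big_ord0; exact: cvg_cst.
rewrite big_ord_recr /= (_ : (fun n => _) = fun n => \sum_(i < k) q`_i * Ln n (fun t => t ^+ i)
  + q`_k * Ln n (fun t => t ^+ k)); last by apply/funext => n; rewrite big_ord_recr.
by apply: cvgD => //; apply: cvgMr; exact: (cvg_moments k).1.
Qed.

(** Up to eta, the indicator at u lies above a polynomial that falls over [u - d/2, u] and below one
    that falls over [u, u + d/2]. Polynomials converge, and continuity at u makes the shift by d/2
    harmless. *)
Lemma cvg_indic (u : R) : {for u, continuous (fun v : R => L (fun t => (t <= v)%R%:R))} ->
  Ln n (fun t => (t <= u)%R%:R) @[n --> \oo] --> L (fun t => (t <= u)%R%:R).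
Proof.
move=> cu; apply/cvgrPdist_le => e e0.
have L0 := pos_functional_ge0 posL.
have e4 : 0 < e / 4 by rewrite divr_gt0.
have [d /= d0 hd] := (nbhs_ballP _ _).1 ((cvgrPdist_le _ _).1 cu _ e4).
have d2 : 0 < d / 2 by rewrite divr_gt0.
have near v : `|u - v| <= d / 2 -> `|L (fun t => (t <= u)%R%:R) - L (fun t => (t <= v)%R%:R)| <= e / 4.
  move=> h; apply: hd; rewrite /ball /= (le_lt_trans h) // ltr_pdivrMr // ltr_pMr //.
  by rewrite ltr1n.
have near1 := near (u - d / 2); have near2 := near (u + d / 2).
rewrite subKr gtr0_norm // lexx in near1; rewrite opprD addNKr normrN gtr0_norm // lexx in near2.
(* Each comparison uses the approximation twice, once under Ln, of mass at most 1, and once under L;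
   together they cost at most e / 4. *)
pose eta := e / (4 * (1 + L (fun=> 1))).
have eta0 : 0 < eta by rewrite divr_gt0 // mulr_gt0 // ltr_wpDr.
have etaL : eta + eta * L (fun=> 1) = e / 4.
  by rewrite /eta; field; rewrite gt_eqF // ltr_wpDr.
have u1 : u - d / 2 < u by rewrite gtrBl.
have u2 : u < u + d / 2 by rewrite ltrDl.
have [q1 hq1] := indicator_approx u1 eta0; have [q2 hq2] := indicator_approx u2 eta0.
have [n1 _ c1] := (cvgrPdist_le _ _).1 (@cvg_horner q1) _ e4.
have [n2 _ c2] := (cvgrPdist_le _ _).1 (@cvg_horner q2) _ e4.
exists (maxn n1 n2) => // n; rewrite /= geq_max => /andP[/c1 + /c2].
have Lneta : eta * Ln n (fun=> 1) <= eta by rewrite ler_piMr // ltW.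
have b1 : Ln n (fun t => (t <= u)%R%:R) <= Ln n (fun t => q2.[t]) + eta * Ln n (fun=> 1).
  by apply: pos_functional_le => //; [exact: test_indic|exact: test_horner|move=> t /hq2[]].
have b2 : L (fun t => q2.[t]) <= L (fun t => (t <= u + d / 2)%R%:R) + eta * L (fun=> 1).
  by apply: pos_functional_le => //; [exact: test_horner|exact: test_indic|move=> t /hq2[]].
have b3 : Ln n (fun t => q1.[t]) <= Ln n (fun t => (t <= u)%R%:R) + eta * Ln n (fun=> 1).
  by apply: pos_functional_le => //; [exact: test_horner|exact: test_indic|move=> t /hq1[]].
have b4 : L (fun t => (t <= u - d / 2)%R%:R) <= L (fun t => q1.[t]) + eta * L (fun=> 1).
  by apply: pos_functional_le => //; [exact: test_indic|exact: test_horner|move=> t /hq1[]].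
move: near1 near2 b1 b2 b3 b4 Lneta etaL => /(_ isT) + /(_ isT).
move: (eta * Ln n (fun=> 1)) (eta * L (fun=> 1)) => E1 E2.
move: (L _) (L _) (L _) (L _) (L _) (Ln n _) (Ln n _) (Ln n _) => A1 A2 A3 A4 A5 A6 A7 A8.
rewrite !ler_norml => /andP[? ?] /andP[? ?] ? ? ? ? ? ? /andP[? ?] /andP[? ?]; apply/andP; split; lra.
Qed.

End Convergence.
End PosFunctional.

(** * The fixed-point equation and the limit law *)

Section LimitDistribution.
Context (R : realType).
Variables (a y Y : R).
Hypotheses (a0 : 0 < a) (y0 : 0 < y) (Y0 : 0 < Y).
Hypothesis D0 : 0 < y - y * Y + Y.
Local Notation mu := (@lebesgue_measure R).
Local Notation L := (lim_functional a y Y).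
Local Notation posL := (lim_functional_pos a0 y0 Y0 D0).

(** Clearing denominators leaves [A g^2 + B g - 1 = 0]. Since A > 0, which is the condition y Y < y
    + Y, there is a positive root. *)
Lemma fixpoint_exists c1 c2 : 0 < c1 -> 0 < c2 -> exists2 g : R, 0 < g &
  c1 * g / (1 + c1 * y * g) + c2 * g / (1 + c2 * Y * g) = 1.
Proof.
move=> c10 c20; pose A := c1 * c2 * (y - y * Y + Y).
have A0 : 0 < A by rewrite !mulr_gt0.
pose B := c1 * (1 - y) + c2 * (1 - Y).
pose S := Num.sqrt (B ^+ 2 + 4 * A).
have S2 : S ^+ 2 = B ^+ 2 + 4 * A by rewrite sqr_sqrtr // addr_ge0 ?sqr_ge0 // mulr_ge0 // ltW.
have SB : 0 < S - B.
  rewrite subr_gt0 (le_lt_trans (ler_norm B)) // -[`|B|]sqrtr_sqr ?normr_id.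
  rewrite ltr_sqrt ?ltrDl ?mulr_gt0 //; last by rewrite ltr_wpDl ?sqr_ge0 ?mulr_gt0.
pose g := (S - B) / (2 * A).
have g0 : 0 < g by rewrite divr_gt0 // mulr_gt0.
exists g => //.
have quad : A * g ^+ 2 + B * g - 1 = 0.
  have -> : A * g ^+ 2 + B * g - 1 = (S ^+ 2 - B ^+ 2 - 4 * A) / (4 * A).
    by rewrite /g; field; rewrite gt_eqF.
  by rewrite S2; field; rewrite gt_eqF.
clearbody g.
have d1 : 0 < 1 + c1 * y * g by rewrite addr_gt0 // !mulr_gt0.
have d2 : 0 < 1 + c2 * Y * g by rewrite addr_gt0 // !mulr_gt0.
apply/eqP; rewrite -subr_eq0; apply/eqP.
transitivity ((A * g ^+ 2 + B * g - 1) / ((1 + c1 * y * g) * (1 + c2 * Y * g))).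
  by rewrite /A /B; field; rewrite !gt_eqF.
by rewrite quad mul0r.
Qed.

(** At x = k the poles -x and -y / w of the partial fractions must not coincide; at most one value
    of k is bad, and large k avoid it. *)
Lemma regular_poles : exists2 k0, (0 < k0)%N &
  forall k, (k0 <= k)%N -> y - (a * Y - y) * k%:R != 0.
Proof.
set w := a * Y - y; have [w0|w0] := eqVneq w 0.
  by exists 1%N => // k _; rewrite w0 mul0r subr0 gt_eqF.
exists (Num.truncn (y / `|w|)).+1 => // k hk.
rewrite subr_eq0; apply/eqP => yw.
have : y / `|w| < k%:R by rewrite (lt_le_trans (truncnS_gt _)) // ler_nat.
rewrite ltr_pdivrMr ?normr_gt0 // ltNge => /negP; apply.
by rewrite mulrC -[k%:R]ger0_norm // -normrM -yw gtr0_norm.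
Qed.

(** The total mass is read off from k times the value at 1 / (t + k) for large k. This is within O(1
    / k) of the mass, and by the closed form it is 1 - g / (1 + (1 + k) y g), where the fraction is
    at most 1 / (y k). *)
Lemma lim_functional1 : L (fun=> 1) = 1.
Proof.
have [k0 k00 reg] := regular_poles.
have hk k : (k0 <= k)%N -> `|L (fun=> 1) - 1| <= (L (fun=> 1) + y^-1) / k%:R.
  move=> kk; have kp : 0 < k%:R :> R by rewrite ltr0n (leq_trans k00).
  have k1 : 0 < 1 + k%:R :> R by rewrite addr_gt0.
  have [g g0 geq] := fixpoint_exists k1 (mulr_gt0 kp a0).
  have := pos_functional_pole_approx posL 0 kp.
  rewrite (_ : (fun t => t ^+ 0 * _) = fun t => (t + k%:R)^-1); last first.
    by apply/funext => t; rewrite mul1r.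
  rewrite (lim_functional_pole a0 y0 Y0 D0 kp (reg k kk) g0 geq).
  rewrite [k%:R * (_ / _)]mulrC divfK ?gt_eqF //.
  rewrite (_ : (fun t => t ^+ 0) = fun=> 1); last by apply/funext => t; rewrite expr0.
  rewrite [(L _ + _) / _]mulrDl [k%:R^-1 * _]mulrC.
  have s0 : 0 <= g / (1 + (1 + k%:R) * y * g) <= y^-1 / k%:R.
    have d0 : 0 < 1 + (1 + k%:R) * y * g by rewrite addr_gt0 // !mulr_gt0.
    rewrite divr_ge0 ?(ltW g0) ?(ltW d0) //= ler_pdivrMr // -invfM mulrC ler_pdivlMr ?mulr_gt0 //.
    by move: (mulr_gt0 y0 g0) (mulr_gt0 (mulr_gt0 y0 kp) g0) => *; nra.
  move: s0; move: (g / _) (L _ / _) (y^-1 / _) => s u v.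
  move: (L _) => z; rewrite !ler_norml => /andP[? ?] /andP[? ?]; apply/andP; split; lra.
apply/eqP; rewrite -subr_eq0 -normr_le0; apply/ler_addgt0Pr => e e0; rewrite add0r.
have Ly : 0 <= L (fun=> 1) + y^-1 by rewrite addr_ge0 ?(pos_functional_ge0 posL) // invr_ge0 ltW.
pose k := maxn k0 (Num.truncn ((L (fun=> 1) + y^-1) / e)).+1.
have kk : (k0 <= k)%N by exact: leq_maxl.
apply: le_trans (hk k kk) _; rewrite ler_pdivrMr ?ltr0n ?(leq_trans k00) //.
rewrite mulrC -ler_pdivrMr //.
apply: (@le_trans _ _ (Num.truncn ((L (fun=> 1) + y^-1) / e)).+1%:R).
  by apply: ltW; exact: truncnS_gt.
by rewrite ler_nat leq_maxr.
Qed.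

Lemma lim_functional_cvg (fn : nat -> R -> R) f :
  (forall n, test_fun (fn n)) -> test_fun f ->
  (forall n t, 0 <= t <= 1 -> `|fn n t| <= 1) ->
  (forall t, 0 <= t <= 1 -> fn n t @[n --> \oo] --> f t) ->
  L (fn n) @[n --> \oo] --> L f.
Proof.
move=> tfn tf b1 cf.
have o0 : 0 <= (0 : R) <= 1 by rewrite lexx ler01.
have o1 : 0 <= (1 : R) <= 1 by rewrite lexx ler01.
apply: cvgD; first by apply: cvgD; apply: cvgMr; exact: cf.
have idf := integrable_dens_formula a0 y0 Y0 D0.
have mf h : test_fun h -> measurable_fun `]t_l a y Y, t_r a y Y[
    (fun t => (h t * dens_formula a y Y t)%:E).
  by move=> th; have /integrableP[] := integrable_test a0 y0 Y0 D0 th.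
have cv : (\int[mu]_(t in `]t_l a y Y, t_r a y Y[) (fn n t * dens_formula a y Y t)%:E)%E @[n --> \oo] -->
    (\int[mu]_(t in `]t_l a y Y, t_r a y Y[) (f t * dens_formula a y Y t)%:E)%E.
  apply: (@dominated_cvg _ _ R mu _ (measurable_itv _)
    (fun n t => (fn n t * dens_formula a y Y t)%:E) _ (EFin \o dens_formula a y Y)).
  - by move=> n; exact: mf.
  - move=> t /=; rewrite in_itv /= => ltr; have /andP[t0 t1] := edges_sub a0 D0 ltr.
    apply: cvg_EFin; first exact: nearW.
    by apply: cvgMl; apply: cf; rewrite !ltW.
  - by [].
  - exact: idf.
  - move=> n t /=; rewrite in_itv /= => ltr; have /andP[t0 t1] := edges_sub a0 D0 ltr.
    have d0 := dens_formula_ge0 a0 y0 Y0 D0 ltr.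
    by rewrite lee_fin normrM (ger0_norm d0) ler_piMl // b1 // !ltW.
apply: (fine_cvg _); rewrite /Rintegral fineK //; apply: integrable_fin_num => //.
exact: integrable_test.
Qed.

Lemma distribution_function_Flim : distribution_function (Flim a y Y).
Proof.
have FE : Flim a y Y = fun u => L (fun t => (t <= u)%R%:R) by apply/funext => u; exact: FlimE.
have Fle u v : u <= v -> Flim a y Y u <= Flim a y Y v.
  move=> uv; rewrite FE; case: posL => _ _; apply; [exact: test_indic|exact: test_indic|].
  by move=> t _; rewrite ler_nat; case: (leP t u) => // tu; rewrite (le_trans tu uv).
have F0 u : u < 0 -> Flim a y Y u = 0.
  move=> u0; rewrite FE /=; transitivity (L (fun=> 0 * 1)); last first.
    by have [_ LZ _] := posL; rewrite (LZ 0 (fun=> 1)) ?mul0r //; exact: test_cst.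
  apply: (pos_functional_ext posL); [exact: test_indic|exact: test_cst|].
  by move=> t /andP[t0 _]; rewrite mul0r leNgt (lt_le_trans u0 t0).
have F1 u : 1 <= u -> Flim a y Y u = 1.
  move=> u1; rewrite FE /=; transitivity (L (fun=> 1)); last exact: lim_functional1.
  apply: (pos_functional_ext posL); [exact: test_indic|exact: test_cst|].
  by move=> t /andP[_ t1]; rewrite (le_trans t1 u1).
split => //.
- move=> u.
  (* By monotonicity, right continuity may be tested along u + 1 / (n + 1), where dominated
     convergence applies. *)
  have cu : Flim a y Y (u + n.+1%:R^-1) @[n --> \oo] --> Flim a y Y u.
    rewrite FE /=; apply: lim_functional_cvg; [by move=> n; exact: test_indic|exact: test_indic| |].
      move=> n t _. by case: (t <= _)%R; rewrite ?normr1 ?normr0.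
    move=> t _; case: (leP t u) => tu.
      rewrite (_ : (fun n => _) = fun=> 1); first exact: cvg_cst.
      by apply/funext => n; rewrite (le_trans tu) // lerDl invr_ge0.
    apply/cvgrPdist_le => e e0; have tu0 : 0 < t - u by rewrite subr_gt0.
    have [m _ hm] := (cvgrPdist_lt _ _).1 (@cvg_harmonic R) _ tu0.
    exists m => // n /hm; rewrite /= sub0r normrN ger0_norm ?invr_ge0 // => h.
    by rewrite [(t <= _)%R]leNgt (_ : _ < t) ?subrr ?normr0 ?(ltW e0) // addrC -ltrBrDr.
  apply/cvgrPdist_le => e e0; have [m _ hm] := (cvgrPdist_le _ _).1 cu _ e0.
  near=> v; have uv : u < v by near: v; exact: nbhs_right_gt.
  have vm : v <= u + m.+1%:R^-1.
    by near: v; apply: nbhs_right_le; rewrite ltrDl invr_gt0.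
  have /= := hm m (leqnn m); rewrite distrC ger0_norm ?subr_ge0 ?Fle ?lerDl ?invr_ge0 // => h.
  rewrite distrC ger0_norm ?subr_ge0 ?Fle ?(ltW uv) // (le_trans _ h) //.
  by rewrite lerD2r Fle.
- apply/cvgrPdist_le => e e0; near=> v.
  have v0 : v < 0 by near: v; exact: nbhs_ninfty_lt.
  by rewrite (F0 _ v0) subrr normr0 ltW.
- apply/cvgrPdist_le => e e0; near=> v.
  have v1 : 1 <= v by near: v; exact: nbhs_pinfty_ge.
  by rewrite (F1 _ v1) subrr normr0 ltW.
Unshelve. all: by end_near. Qed.

End LimitDistribution.

(** * Almost sure limits *)

Section BorelCantelli.
Context (R : realType) d (T : measurableType d) (P : probability T R).

Lemma borel_cantelli_exp (A : nat -> set T) (K c : R) n0 :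
  (forall n, measurable (A n)) -> 0 <= K -> 0 < c ->
  (forall n, (n0 <= n)%N -> (P (A n) <= (K * expR (- (c * n%:R)))%:E)%E) ->
  {ae P, forall w, exists n1, forall n, (n1 <= n)%N -> ~ A n w}.
Proof.
move=> mA K0 c0 PA.
pose F n := A (n0 + n)%N.
have mF n : measurable (F n) by exact: mA.
have PF n : (P (F n) <= (geometric K (expR (- c)) n)%:E)%E.
  apply: le_trans (PA _ (leq_addr _ _)) _; rewrite lee_fin /= ler_wpM2l //.
  rewrite -expRM_natl ler_expR mulrN lerN2 [leRHS]mulrC ler_pM2r // ler_nat.
  exact: leq_addl.
have lim0 : P (lim_sup_set F) = 0%E.
  apply: lim_sup_set_cvg0 => //.
  apply: (@le_lt_trans _ _ (K * (1 - expR (- c))^-1)%:E); last by rewrite ltry.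
  apply: lime_le; first by apply: is_cvg_nneseries => n _ _; exact: measure_ge0.
  apply: nearW => n; apply: (@le_trans _ _ (\sum_(0 <= i < n) (geometric K (expR (- c)) i)%:E)%E).
    by apply: lee_sum => i _; exact: PF.
  rewrite sumEFin lee_fin; apply: geometric_le_lim => //; first exact: expR_gt0.
  by rewrite ger0_norm ?expR_ge0 // expR_lt1 oppr_lt0.
exists (lim_sup_set F); split => //.
  by apply: bigcap_measurable => // n _; apply: bigcup_measurable => k _.
move=> w /= h n _; apply: contrapT => hn; apply: h; exists (n0 + n)%N => m hm Am; apply: hn.
exists (m - n0)%N => /=; first by rewrite leq_subRL // (leq_trans (leq_addr n n0)).
by rewrite /F subnKC // (leq_trans (leq_addr n n0)).
Qed.

End BorelCantelli.

Section Asymptotics.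
Context (R : realType).

Lemma cvg_eventually (u : nat -> R) c e : u @ \oo --> c -> 0 < e ->
  exists n0, forall n, (n0 <= n)%N -> `|c - u n| <= e.
Proof. by move=> uc e0; have [n0 _ h] := (cvgrPdist_le _ _).1 uc _ e0; exists n0. Qed.

(** With r = eta p and l = 1 / (eta p), the terms growing with p sum to at most (eta + 2 expR 1 eta)
    p, which is (dl / 2) p by the choice of eta. The other terms are constant and absorbed once p >=
    b1; p >= b2 keeps the exponent at most 1, thanks to m <= C p. *)
Lemma mean_error_small (e M C dl : R) : 0 < e -> 0 <= M -> 0 <= C -> 0 < dl ->
  exists p0, (0 < p0)%N /\ forall p m, (p0 <= p)%N -> m%:R <= C * p%:R ->
  exists r l, [/\ 0 < r, 0 < l & mean_error p m e M r l <= dl * p%:R].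
Proof.
move=> e0 M0 C0 d0.
have E0 : 0 < expR 1 :> R by exact: expR_gt0.
pose eta : R := dl / (2 * (1 + 2 * expR 1)).
have eta0 : 0 < eta by rewrite divr_gt0 // mulr_gt0 // addr_gt0 // mulr_gt0.
have etaE : eta + 2 * expR 1 * eta = dl / 2.
  by rewrite /eta; field; rewrite gt_eqF // addr_gt0 // mulr_gt0.
pose A := (2 * M + 8) * e ^- 2.
have A0 : 0 <= A by rewrite mulr_ge0 ?addr_ge0 ?mulr_ge0 // invr_ge0 exprn_ge0 // ltW.
pose b1 := (A / eta + e^-1) / (dl / 2).
pose b2 := 2 * C * e ^- 2 / eta ^+ 2.
exists (maxn (Num.truncn b1).+1 (Num.truncn b2).+1); split; first by rewrite leq_max.
move=> p m; rewrite geq_max => /andP[hp1 hp2] hm.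
have p0 : 0 < p%:R :> R by rewrite ltr0n (leq_trans _ hp1).
have {}hp1 : b1 <= p%:R by rewrite ltW // (lt_le_trans (truncnS_gt _)) // ler_nat.
have {}hp2 : b2 <= p%:R by rewrite ltW // (lt_le_trans (truncnS_gt _)) // ler_nat.
have r0 : 0 < eta * p%:R by rewrite mulr_gt0.
exists (eta * p%:R), (eta * p%:R)^-1; split => //; first by rewrite invr_gt0.
rewrite /mean_error invrK.
have -> : p%:R * ((2 * M + 8) * e ^- 2) / (eta * p%:R) = A / eta.
  by rewrite /A; field; rewrite !gt_eqF.
have ex : expR (2 * (eta * p%:R)^-1 ^+ 2 * (m%:R * e ^- 2)) <= expR 1.
  rewrite ler_expR; apply: (@le_trans _ _ (2 * (eta * p%:R)^-1 ^+ 2 * ((C * p%:R) * e ^- 2))).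
    apply: ler_wpM2l; first by rewrite mulr_ge0 // exprn_ge0 // invr_ge0 ltW.
    by apply: ler_wpM2r => //; rewrite invr_ge0 exprn_ge0 // ltW.
  have -> : 2 * (eta * p%:R)^-1 ^+ 2 * (C * p%:R * e ^- 2) = b2 / p%:R.
    by rewrite /b2; field; rewrite !gt_eqF.
  by rewrite ler_pdivrMr // mul1r.
have h1 : A / eta + e^-1 <= dl / 2 * p%:R.
  by rewrite [leRHS]mulrC -ler_pdivrMr ?divr_gt0.
have h2 : 2 * expR (2 * (eta * p%:R)^-1 ^+ 2 * (m%:R * e ^- 2)) * (eta * p%:R) <=
    2 * expR 1 * eta * p%:R.
  rewrite -[leRHS]mulrA ler_wpM2r ?(ltW r0) //.
  by rewrite ler_wpM2l.
have h3 : eta * p%:R + 2 * expR 1 * eta * p%:R = dl / 2 * p%:R by rewrite -mulrDl etaE.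
have -> : dl * p%:R = dl / 2 * p%:R + dl / 2 * p%:R by field.
rewrite (addrAC (A / eta)) -[leLHS]addrA; apply: lerD => //.
by rewrite -[leRHS]h3 lerD2l.
Qed.

(** Allows alpha_n, p / n and p / N to be replaced by their limits, uniformly over a bounded range
    of g. *)
Lemma saturation_diff (B c y c' y' g : R) : 0 <= g -> g <= B -> 0 <= c -> 0 <= y -> 0 <= c' -> 0 <= y' ->
  `|c * g / (1 + c * y * g) - c' * g / (1 + c' * y' * g)| <=
  `|c - c'| * B + c * c' * B ^+ 2 * `|y - y'|.
Proof.
move=> g0 gB c0 y0 c0' y0'.
have d1 : 1 <= 1 + c * y * g by rewrite lerDl !mulr_ge0.
have d2 : 1 <= 1 + c' * y' * g by rewrite lerDl !mulr_ge0.
have d1' : 0 < 1 + c * y * g by rewrite (lt_le_trans _ d1).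
have d2' : 0 < 1 + c' * y' * g by rewrite (lt_le_trans _ d2).
have -> : c * g / (1 + c * y * g) - c' * g / (1 + c' * y' * g) =
   ((c - c') * g - c * c' * g ^+ 2 * (y - y')) / ((1 + c * y * g) * (1 + c' * y' * g)).
  by field; rewrite !gt_eqF.
rewrite normrM normfV [`|_ * _ : R|]gtr0_norm ?mulr_gt0 // ler_pdivrMr ?mulr_gt0 //.
have Bge : 0 <= B by exact: le_trans gB.
apply: (@le_trans _ _ (`|c - c'| * B + c * c' * B ^+ 2 * `|y - y'|)).
  apply: le_trans (ler_normB _ _) _; apply: lerD.
    by rewrite normrM ler_wpM2l // ger0_norm.
  rewrite normrM ger0_norm ?mulr_ge0 ?sqr_ge0 // ler_wpM2r // ler_wpM2l ?mulr_ge0 //.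
  by rewrite lerXn2r // nnegrE.
rewrite ler_peMr ?addr_ge0 ?mulr_ge0 ?sqr_ge0 //.
by rewrite -[leLHS]mulr1 ler_pM.
Qed.

(* The regularised equation drags g below g0, and both saturated terms then increase to their
   values at g0, so the total defect controls each of them. *)
Lemma fixpoint_stability (c1 c2 y Y e g0 g s1 s2 eps : R) :
  0 <= c1 -> 0 <= c2 -> 0 <= y -> 0 <= Y -> 0 < e -> 0 < g0 -> 0 <= g ->
  c1 * g0 / (1 + c1 * y * g0) + c2 * g0 / (1 + c2 * Y * g0) = 1 ->
  `|s1 - c1 * g / (1 + c1 * y * g)| <= eps ->
  `|s2 - c2 * g / (1 + c2 * Y * g)| <= eps ->
  `|s1 + s2 + e * g - 1| <= eps -> 3 * eps <= e * g0 ->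
  `|s1 - c1 * g0 / (1 + c1 * y * g0)| <= 3 * (e * g0) /\ e * g <= e * g0.
Proof.
move=> c10 c20 y0 Y0 e0 g00 gge eq0 h1 h2 h3 he.
have sat_homo (c z u v : R) : 0 <= c -> 0 <= z -> 0 <= u -> u <= v ->
    c * u / (1 + c * z * u) <= c * v / (1 + c * z * v).
  move=> c0 z0 u0 uv; have v0 := le_trans u0 uv.
  rewrite ler_pdivrMr ?ltr_wpDr ?mulr_ge0 // mulrAC ler_pdivlMr ?ltr_wpDr ?mulr_ge0 //.
  have -> : c * u * (1 + c * z * v) = c * u + c * u * c * z * v by ring.
  have -> : c * v * (1 + c * z * u) = c * v + c * u * c * z * v by ring.
  by rewrite lerD2r ler_wpM2l.
have gg0 : g <= g0.
  rewrite leNgt; apply/negP => lt0.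
  have m1 := sat_homo c1 y g0 g c10 y0 (ltW g00) (ltW lt0).
  have m2 := sat_homo c2 Y g0 g c20 Y0 (ltW g00) (ltW lt0).
  have eg : e * g0 < e * g by rewrite ltr_pM2l.
  move: eq0 h1 h2 h3 he m1 m2 eg; move: (c1 * g / _) (c2 * g / _) (c1 * g0 / _) (c2 * g0 / _) (e * g) (e * g0).
  move=> a1 a2 b1 b2 u v; rewrite !ler_norml => ? /andP[? ?] /andP[? ?] /andP[? ?] ? ? ? ?; lra.
have m1 := sat_homo c1 y g g0 c10 y0 gge gg0.
have m2 := sat_homo c2 Y g g0 c20 Y0 gge gg0.
have eg : e * g <= e * g0 by rewrite ler_pM2l.
split => //.
have e0' : 0 <= e * g by rewrite mulr_ge0 // ltW.
move: eq0 h1 h2 h3 he m1 m2 eg e0'; move: (c1 * g / _) (c2 * g / _) (c1 * g0 / _) (c2 * g0 / _) (e * g) (e * g0).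
move=> a1 a2 b1 b2 u v; rewrite !ler_norml => ? /andP[? ?] /andP[? ?] /andP[? ?] ? ? ? ? ?; apply/andP; split; lra.
Qed.

End Asymptotics.

(** * Column weights and the approximate fixed-point equation *)

Section Weights.
Context (R : realType) (n N : nat).
Variables (x a : R).

Definition weight (k : 'I_(n + N)) : R :=
  if (k < n)%N then (1 + x) / n%:R else x * a / N%:R.
Definition first_cols : pred 'I_(n + N) := fun k => (k < n)%N.

Lemma weight_ge0 k : 0 <= x -> 0 <= a -> 0 <= weight k.
Proof. by move=> x0 a0; rewrite /weight; case: ifP; rewrite divr_ge0 // ?addr_ge0 ?mulr_ge0. Qed.

Lemma sum_first_cols (f : R -> R) :
  \sum_(k | first_cols k) f (weight k) = n%:R * f ((1 + x) / n%:R).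
Proof.
rewrite big_mkcond big_split_ord /= [X in _ + X]big1 ?addr0 => [|i _]; last first.
  by rewrite /first_cols /= ltnNge leq_addr.
under eq_bigr do rewrite /first_cols /weight /= ltn_ord.
by rewrite sumr_const card_ord mulr_natl.
Qed.

Lemma sum_weight (f : R -> R) :
  \sum_k f (weight k) = n%:R * f ((1 + x) / n%:R) + N%:R * f (x * a / N%:R).
Proof.
rewrite big_split_ord /=; congr (_ + _).
  under eq_bigr do rewrite /weight /= ltn_ord.
  by rewrite sumr_const card_ord mulr_natl.
under eq_bigr do rewrite /weight /= ltnNge leq_addr /=.
by rewrite sumr_const card_ord mulr_natl.
Qed.

End Weights.

Section MeanFixpoint.
Context (R : realType) d0 (T : measurableType d0) (P : probability T R).
Context (p n N : nat) (Z : 'I_p * 'I_(n + N) -> bool -> T -> R).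
Hypotheses (p0 : (0 < p)%N) (n0 : (0 < n)%N) (N0 : (0 < N)%N).
Hypothesis mZ : forall i b, measurable_fun setT (Z i b).
Hypothesis indepZ : mutually_independent P Z.
Variables (x a e M : R).
Hypotheses (x0 : 0 < x) (a0 : 0 < a) (e0 : 0 < e) (M0 : 0 <= M).
Hypothesis Z0 : forall i b, (\int[P]_w (Z i b w)%:E = 0)%E.
Hypothesis Z1 : forall i, (\int[P]_w (Z i true w ^+ 2 + Z i false w ^+ 2)%:E = 1)%E.
Hypothesis Z2 : forall i,
  (\int[P]_w ((Z i true w ^+ 2 + Z i false w ^+ 2) ^+ 2)%:E <= M%:E)%E.
Local Notation Mw w := (config_mx (sample Z w)).
Local Notation wt := (@weight R n N x a).
Local Notation J := (@first_cols n N).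
Local Notation g := (mean_restrace P Z wt e / p%:R).
Variables (r l dl : R).
Hypotheses (r0 : 0 < r) (l0 : 0 < l) (small : mean_error p (n + N) e M r l <= dl * p%:R).

Let wt0 k : 0 <= wt k. Proof. by apply: weight_ge0; exact: ltW. Qed.
Let pp : 0 < p%:R :> R. Proof. by rewrite ltr0n. Qed.
Let nn : 0 < n%:R :> R. Proof. by rewrite ltr0n. Qed.
Let NN : 0 < N%:R :> R. Proof. by rewrite ltr0n. Qed.

Let g0 : 0 <= g.
Proof. by rewrite divr_ge0 ?(ltW pp) //; apply: mean_restrace_ge0. Qed.

(** Writing the mean trace as p g turns a weight c / n times the trace into c (p / n) g; this is
    where the aspect ratios enter. *)
Let sat1 : n%:R * ((1 + x) / n%:R * mean_restrace P Z wt e / (1 + (1 + x) / n%:R * mean_restrace P Z wt e))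
  = p%:R * ((1 + x) * g / (1 + (1 + x) * (p%:R / n%:R) * g)).
Proof.
have -> : mean_restrace P Z wt e = p%:R * g by rewrite mulrC divfK // gt_eqF.
move: g g0 => u u0; field.
have h : 0 <= (1 + x) * p%:R * u by exact: mulr_ge0 (mulr_ge0 (addr_ge0 ler01 (ltW x0)) (ler0n _ _)) u0.
by rewrite !gt_eqF // ltr_wpDr.
Qed.

Let sat2 : N%:R * (x * a / N%:R * mean_restrace P Z wt e / (1 + x * a / N%:R * mean_restrace P Z wt e))
  = p%:R * (x * a * g / (1 + x * a * (p%:R / N%:R) * g)).
Proof.
have -> : mean_restrace P Z wt e = p%:R * g by rewrite mulrC divfK // gt_eqF.
move: g g0 => u u0; field.
have h : 0 <= x * a * p%:R * u by exact: mulr_ge0 (mulr_ge0 (mulr_ge0 (ltW x0) (ltW a0)) (ler0n _ _)) u0.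
by rewrite !gt_eqF // ltr_wpDr.
Qed.

Let divide_p b u v : 0 <= b -> `|u - p%:R * v| <= b * mean_error p (n + N) e M r l ->
  `|u / p%:R - v| <= b * dl.
Proof.
move=> b0 h; have -> : u / p%:R - v = (u - p%:R * v) / p%:R by field; rewrite gt_eqF.
rewrite normrM [`|_^-1|]gtr0_norm ?invr_gt0 // ler_pdivrMr // -mulrA.
by apply: le_trans h _; rewrite ler_wpM2l.
Qed.

Lemma mean_first_cols :
  `|(\int[P]_w ressum (Mw w) wt e J) / p%:R - (1 + x) * g / (1 + (1 + x) * (p%:R / n%:R) * g)|
  <= (1 + x) * dl.
Proof.
have := mean_ressum mZ indepZ wt0 e0 M0 Z0 Z1 Z2 J r0 l0.
rewrite (@sum_first_cols R n N x a (fun u => u * mean_restrace P Z wt e / (1 + u * mean_restrace P Z wt e))).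
rewrite (@sum_first_cols R n N x a id) sat1 [n%:R * id _]mulrC divfK ?gt_eqF // => h.
by apply: divide_p; [rewrite addr_ge0 // ltW|exact: h].
Qed.

(** The exact identity [ressum_all_mean] against the sum of the column approximations, divided by p:
    an approximate fixed-point equation for g. *)
Lemma mean_all_cols :
  `|(1 + x) * g / (1 + (1 + x) * (p%:R / n%:R) * g) +
    x * a * g / (1 + x * a * (p%:R / N%:R) * g) + e * g - 1|
  <= (1 + x + x * a) * dl.
Proof.
have := mean_ressum mZ indepZ wt0 e0 M0 Z0 Z1 Z2 predT r0 l0.
have := ressum_all_mean P mZ wt0 e0 => /(canRL (addrK _)) ->.
rewrite (@sum_weight R n N x a (fun u => u * mean_restrace P Z wt e / (1 + u * mean_restrace P Z wt e))).
rewrite (@sum_weight R n N x a id) sat1 sat2.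
rewrite [n%:R * id _]mulrC [N%:R * id _]mulrC !divfK ?gt_eqF // => h.
have b0 : 0 <= 1 + x + x * a by rewrite !addr_ge0 ?mulr_ge0 // ltW.
move: h; have -> : e * mean_restrace P Z wt e = e * g * p%:R by rewrite -mulrA divfK // gt_eqF.
move: (_ / (1 + (1 + x) * _ * _)) (_ / (1 + x * _ * _ * _)) (e * _) => u v z h.
rewrite -normrN -[X in `|X|]add0r -[X in `|X - _|](mul0r p%:R^-1); apply: divide_p => //.
by apply: le_trans h; rewrite le_eqVlt; apply/orP; left; apply/eqP; congr `|_|; ring.
Qed.

End MeanFixpoint.

Lemma dist_chain (R : realFieldType) (u v w A B q : R) :
  `|u - v| <= A -> `|v - w| <= B -> A <= q -> B <= q -> `|u - w| <= 4 * q.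
Proof.
by rewrite !ler_norml => /andP[? ?] /andP[? ?] ? ?; apply/andP; split; lra.
Qed.

(** A kernel vector makes the form vanish, hence is orthogonal to every column of X, against the
    full row rank. *)
Lemma pencil_full_rank (R : realType) p m (X : 'M[R[i]]_(p, m)) (d : 'I_m -> R) :
  (forall j, 0 < d j) -> \rank X = p -> pencil X d 0 \in unitmx.
Proof.
move=> d0 rk; rewrite -row_free_unit -kermx_eq0; apply/rowV0P => v /sub_kermxP hv.
have : qform (pencil X d 0) (adjmx v) = 0.
  by rewrite /qform -mulmxA -[pencil X d 0]pencil_herm -adjmxM hv /adjmx map_mx0 trmx0 mulmx0 mxE.
rewrite qform_pencil mul0r addr0 => /psumr_eq0P h.
have {}h j : v *m col j X = 0.
  have /eqP := h (fun j _ => mulr_ge0 (ltW (d0 j)) (normc2_ge0 _)) j isT.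
  rewrite mulf_eq0 gt_eqF //= => /eqP hn.
  rewrite -[LHS]adjmxK adjmxM (_ : _ *m _ = 0) /adjmx ?map_mx0 ?trmx0 //.
  by apply: vnorm2_eq0; rewrite /vnorm2 big_ord1.
have vX : v *m X = 0.
  by apply/matrixP => i j; have := congr1 (fun A : 'M[R[i]]_1 => A i 0) (h j); rewrite !mxE => h'; rewrite -[RHS]h';
    apply: eq_bigr => k _; rewrite mxE.
have /row_free_inj : row_free X by rewrite /row_free rk.
by apply; rewrite vX mul0mx.
Qed.

(** * Almost sure limit of the column sums *)

Section RandomPencils.
Context (R : realType) d0 (T : measurableType d0) (P : probability T R).
Variables (p N : nat -> nat) (alpha : nat -> R).
Variable Z : forall n, 'I_(p n) * 'I_(n + N n) -> bool -> T -> R.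
Variables (a y Y M : R).
Hypotheses (p0 : forall n, (0 < p n)%N) (N0 : forall n, (0 < N n)%N).
Hypothesis alpha0 : forall n, 0 < alpha n.
Hypothesis mZ : forall n i b, measurable_fun setT (@Z n i b).
Hypothesis indepZ : forall n, mutually_independent P (@Z n).
Hypothesis M1 : 1 <= M.
Hypothesis Z0 : forall n i b, (\int[P]_w (@Z n i b w)%:E = 0)%E.
Hypothesis Z1 : forall n i, (\int[P]_w (@Z n i true w ^+ 2 + @Z n i false w ^+ 2)%:E = 1)%E.
Hypothesis Z2 : forall n i,
  (\int[P]_w ((@Z n i true w ^+ 2 + @Z n i false w ^+ 2) ^+ 2)%:E <= M%:E)%E.
Hypotheses (a0 : 0 < a) (y0 : 0 < y) (Y0 : 0 < Y).
Hypothesis cvga : alpha @ \oo --> a.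
Hypothesis cvgy : (fun n => (p n)%:R / n%:R : R) @ \oo --> y.
Hypothesis cvgY : (fun n => (p n)%:R / (N n)%:R : R) @ \oo --> Y.
Local Notation Mw n w := (config_mx (sample (@Z n) w)).
Local Notation wt x n := (@weight R n (N n) x (alpha n)).
Local Notation J n := (@first_cols n (N n)).

Let pp n : 0 < (p n)%:R :> R. Proof. by rewrite ltr0n. Qed.
Let M0 : 0 <= M. Proof. exact: le_trans M1. Qed.

Lemma sizes_comparable : exists (C c : R) n0, [/\ 0 < C, 0 < c & forall n, (n0 <= n)%N ->
  [/\ (0 < n)%N, (n + N n)%:R <= C * (p n)%:R & c * n%:R <= (p n)%:R :> R]].
Proof.
have [n1 h1] := cvg_eventually cvgy (divr_gt0 y0 (ltr0n R 2)).
have [n2 h2] := cvg_eventually cvgY (divr_gt0 Y0 (ltr0n R 2)).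
exists (2 / y + 2 / Y), (y / 2), (maxn 1 (maxn n1 n2)); split.
- by rewrite addr_gt0 // divr_gt0.
- by rewrite divr_gt0.
move=> n; rewrite !geq_max => /andP[n0 /andP[/h1 b1 /h2 b2]].
have nn : 0 < n%:R :> R by rewrite ltr0n.
have NN : 0 < (N n)%:R :> R by rewrite ltr0n.
have c1 : y / 2 * n%:R <= (p n)%:R.
  rewrite -ler_pdivlMr //; move: b1; rewrite ler_norml => /andP[_]; move: (_ / n%:R) => u; lra.
have c2 : Y / 2 * (N n)%:R <= (p n)%:R.
  rewrite -ler_pdivlMr //; move: b2; rewrite ler_norml => /andP[_]; move: (_ / (N n)%:R) => u; lra.
split => //; rewrite natrD mulrDl lerD //.
  by rewrite -[2 / y]invf_div mulrC ler_pdivlMr ?divr_gt0 // mulrC.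
by rewrite -[2 / Y]invf_div mulrC ler_pdivlMr ?divr_gt0 // mulrC.
Qed.

Section Regularized.
Variables (x g0 e : R).
Hypotheses (x0 : 0 < x) (g00 : 0 < g0) (e0 : 0 < e).
Hypothesis fix0 : (1 + x) * g0 / (1 + (1 + x) * y * g0) + x * a * g0 / (1 + x * a * Y * g0) = 1.
Local Notation tau n := (mean_restrace P (@Z n) (wt x n) e).
Local Notation mean n := (\int[P]_w ressum (Mw n w) (wt x n) e (J n)).

Let wt0 n k : 0 <= wt x n k. Proof. by apply: weight_ge0; exact: ltW. Qed.

Lemma mean_restrace_le n : tau n / (p n)%:R <= e^-1.
Proof.
rewrite ler_pdivrMr // mulrC.
apply: (@Rintegral_le_cst _ _ _ P _ ((p n)%:R / e)).
- exact: measurableT_comp (@measurable_restrace_config R (p n) (n + N n) e (wt x n)) (measurable_sample (@mZ n)).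
- by move=> w; exact: (restrace_config_bound (@wt0 n) e0).
- by move=> w; have /andP[] := restrace_bound (Mw n w) (@wt0 n) e0.
Qed.

(** [fixpoint_stability] tolerates errors up to e g0 / 3, so for fixed e it suffices to take n
    large; e tends to 0 only afterwards. *)
Lemma mean_limit : exists n1, forall n, (n1 <= n)%N ->
  `|mean n / (p n)%:R - (1 + x) * g0 / (1 + (1 + x) * y * g0)| <= 3 * (e * g0) /\
  e * (tau n / (p n)%:R) <= e * g0.
Proof.
have x1 : 0 < 1 + x by rewrite addr_gt0.
have E0 : 0 < e * g0 by rewrite mulr_gt0.
(* [fixpoint_stability] wants 3 eps <= e g0, and each of its error premises will be bounded by eps =
   4 q. *)
pose q := e * g0 / 3 / 4.
have q0 : 0 < q by rewrite !divr_gt0.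
(* Bounds the total weight 1 + x + x alpha_n once alpha_n <= a + 1; the error per unit of weight is
   accordingly taken to be q / c. *)
pose c := 1 + x + x * (a + 1).
have c0 : 0 < c by rewrite addr_gt0 // mulr_gt0 // addr_gt0.
have [C [c1 [n1 [C0 c10 hC]]]] := sizes_comparable.
have [P0 [P00 hP]] := mean_error_small e0 M0 (ltW C0) (divr_gt0 q0 c0).
pose B := e^-1.
have B0 : 0 < B by rewrite invr_gt0.
have [n2 ha1] := cvg_eventually cvga ltr01.
have [n3 ha2] := cvg_eventually cvga (divr_gt0 q0 (mulr_gt0 x0 B0)).
have [n4 hy] := cvg_eventually cvgy (divr_gt0 q0 (mulr_gt0 (exprn_gt0 2 x1) (exprn_gt0 2 B0))).
have kY : 0 < x ^+ 2 * (a + 1) * a * B ^+ 2 by rewrite !mulr_gt0 ?exprn_gt0 // addr_gt0.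
have [n5 hY] := cvg_eventually cvgY (divr_gt0 q0 kY).
have [n6 hp] : exists n6, forall n, (n6 <= n)%N -> (P0 <= p n)%N.
  exists (maxn n1 (Num.truncn (P0%:R / c1)).+1) => n; rewrite geq_max => /andP[/hC[_ _ h1] h2].
  rewrite -(ler_nat R); apply: le_trans h1; rewrite mulrC -ler_pdivrMr //.
  by rewrite ltW // (lt_le_trans (truncnS_gt _)) // ler_nat.
exists (maxn (maxn (maxn n1 n2) (maxn n3 n4)) (maxn n5 n6)) => n.
rewrite !geq_max => /andP[/andP[/andP[/hC[nn hm _] /ha1 {}ha1] /andP[/ha2 {}ha2 /hy {}hy]]].
move=> /andP[/hY {}hY /hp {}hp].
have [r [l [r0 l0 small]]] := hP _ _ hp hm.
have an := alpha0 n.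
have a1 : alpha n <= a + 1 by move: ha1; rewrite ler_norml; lra.
have g1 := mean_restrace_le n.
have gge : 0 <= tau n / (p n)%:R by rewrite divr_ge0 ?(ltW (pp n)) //; exact: mean_restrace_ge0.
have m1 := mean_first_cols (p0 n) nn (@mZ n) (@indepZ n) x0 an e0 M0 (@Z0 n) (@Z1 n) (@Z2 n) r0 l0 small.
have m2 := mean_all_cols (p0 n) nn (N0 n) (@mZ n) (@indepZ n) x0 an e0 M0 (@Z0 n) (@Z1 n) (@Z2 n) r0 l0 small.
have dl1 : (1 + x) * (q / c) <= q.
  rewrite mulrCA ler_piMr ?(ltW q0) // ler_pdivrMr // mul1r lerDl mulr_ge0 ?(ltW x0) //.
  by rewrite addr_ge0 // ltW.
have dl2 : (1 + x + x * alpha n) * (q / c) <= q.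
  rewrite mulrCA ler_piMr ?(ltW q0) // ler_pdivrMr // mul1r lerD2l ler_wpM2l //.
  exact: ltW.
have xa : 0 <= x * alpha n by rewrite mulr_ge0 // ltW.
have xa' : 0 <= x * a by rewrite mulr_ge0 // ltW.
have NN : 0 < (N n)%:R :> R by rewrite ltr0n.
have yn0 : 0 <= (p n)%:R / n%:R :> R by rewrite divr_ge0.
have Yn0 : 0 <= (p n)%:R / (N n)%:R :> R by rewrite divr_ge0.
have s1 := saturation_diff gge g1 (ltW x1) yn0 (ltW x1) (ltW y0).
have s2 := saturation_diff gge g1 xa Yn0 xa' (ltW Y0).
have d1 : `|1 + x - (1 + x)| * e^-1 + (1 + x) * (1 + x) * e^-1 ^+ 2 * `|(p n)%:R / n%:R - y| <= q.
  rewrite subrr normr0 mul0r add0r distrC mulrC -ler_pdivlMr; last first.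
    by rewrite !mulr_gt0 ?exprn_gt0 // invr_gt0.
  by rewrite -expr2.
have d2 : `|x * alpha n - x * a| * e^-1 + x * alpha n * (x * a) * e^-1 ^+ 2 * `|(p n)%:R / (N n)%:R - Y| <= 2 * q.
  have -> : 2 * q = q + q by ring.
  apply: lerD.
    rewrite -mulrBr normrM gtr0_norm // distrC mulrAC mulrC -ler_pdivlMr //.
    by rewrite mulr_gt0 // invr_gt0.
  have kk : x * alpha n * (x * a) * e^-1 ^+ 2 <= x ^+ 2 * (a + 1) * a * B ^+ 2.
    rewrite ler_wpM2r ?sqr_ge0 // expr2 [x * alpha n * _]mulrACA -[x * x * _ * _]mulrA.
    by rewrite ler_wpM2l ?mulr_ge0 ?(ltW x0) // ler_wpM2r // ltW.
  rewrite distrC; apply: (@le_trans _ _ (x ^+ 2 * (a + 1) * a * B ^+ 2 * `|Y - (p n)%:R / (N n)%:R|)).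
    by rewrite ler_wpM2r.
  by rewrite mulrC -ler_pdivlMr.
have eq3 : 3 * (4 * q) = e * g0 by rewrite /q; field.
apply: (@fixpoint_stability _ (1 + x) (x * a) y Y e g0 _ _
  (x * alpha n * (tau n / (p n)%:R) / (1 + x * alpha n * ((p n)%:R / (N n)%:R) * (tau n / (p n)%:R))) (4 * q)) => //.
- exact: ltW.
- exact: ltW.
- exact: ltW.
- move: m1 s1 d1 dl1; move: (_ / (1 + (1 + x) * y * _)) (_ / (1 + (1 + x) * _ * _)) (mean n / _).
  move: (_ + _ * `|_|) ((1 + x) * (q / c)) => A A' u v w h1 h2 h3 h4.
  exact: dist_chain h1 h2 h4 h3.
- move: s2 d2; move: (_ / (1 + x * a * _ * _)) (_ / (1 + x * alpha n * _ * _)) (_ + _ * `|_|) => u v A.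
  by rewrite distrC => h1 h2; rewrite (le_trans h1) // (le_trans h2) // ler_wpM2r ?(ltW q0) // ler_nat.
- move: m1 m2 dl1 dl2; move: (_ / (1 + (1 + x) * _ * _)) (_ / (1 + x * _ * _ * _)) (mean n / _) (e * _).
  move: ((1 + x) * (q / c)) (_ * (q / c)) => A A' u v w z h1 h2 h3 h4.
  have -> : w + v + z - 1 = w - (1 - v - z) by ring.
  by apply: dist_chain h1 _ h3 h4; rewrite (_ : u - _ = u + v + z - 1) //; ring.
- by rewrite eq3.
Qed.

Lemma regularized_limit : {ae P, forall w, exists n1, forall n, (n1 <= n)%N ->
  `|ressum (Mw n w) (wt x n) e (J n) / (p n)%:R - (1 + x) * g0 / (1 + (1 + x) * y * g0)|
     <= 4 * (e * g0) /\
  e * (restrace (Mw n w) (wt x n) e / (p n)%:R) <= 2 * (e * g0)}.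
Proof.
have E0 : 0 < e * g0 by rewrite mulr_gt0.
have [C [c [n2 [C0 c0 hC]]]] := sizes_comparable.
pose A1 n := [set w | (e * g0 * (p n)%:R <= `|ressum (Mw n w) (wt x n) e (J n) - mean n|)%R].
pose A2 n := [set w | (g0 * (p n)%:R <= `|restrace (Mw n w) (wt x n) e - tau n|)%R].
have mle (f : T -> R) (t m : R) : measurable_fun setT f -> measurable [set w : T | (t <= `|f w - m|)%R].
  move=> mf; rewrite (_ : [set w | _] = (fun w => `|f w - m|) @^-1` `[t, +oo[).
    rewrite -[X in measurable X]setTI.
    have : measurable_fun setT (fun w => `|f w - m|).
      by apply: measurableT_comp => //; apply: measurable_funB.
    by apply.
  by apply/seteqP; split => w /=; rewrite in_itv /= andbT.
have mA1 n : measurable (A1 n).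
  have mr : measurable_fun setT (fun z : config R ('I_(p n) * 'I_(n + N n))%type =>
      ressum (config_mx z) (wt x n) e (J n)).
    by apply: measurable_ressum; exact: (@mxmeasurable_config R (p n)).
  exact: (mle _ _ _ (measurableT_comp mr (measurable_sample (@mZ n)))).
have mA2 n : measurable (A2 n).
  have mr := @measurable_restrace_config R (p n) (n + N n) e (wt x n).
  exact: (mle _ _ _ (measurableT_comp mr (measurable_sample (@mZ n)))).
(* [l1] and [l2] minimise the exponents [2 l^2 V - l t] of the two tail bounds, with n + N replaced
   by C p. Half of -l t remains, which is linear in p and hence in n. *)
pose l1 := e * g0 / (16 * C).
pose l2 := g0 * e ^+ 2 / (4 * C).
have l10 : 0 < l1 by rewrite divr_gt0 // mulr_gt0.
have l20 : 0 < l2 by rewrite divr_gt0 ?mulr_gt0 ?exprn_gt0.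
pose k1 := l1 * (e * g0) / 2 * c.
pose k2 := l2 * g0 / 2 * c.
have k10 : 0 < k1 by rewrite mulr_gt0 // divr_gt0 // mulr_gt0.
have k20 : 0 < k2 by rewrite mulr_gt0 // divr_gt0 // mulr_gt0.
have ae1 : {ae P, forall w, exists n1, forall n, (n1 <= n)%N -> ~ A1 n w}.
  apply: (@borel_cantelli_exp _ _ _ P A1 2 k1 n2) => // n /hC[_ hm hp].
  apply: le_trans (ressum_tail (@mZ n) (@indepZ n) (@wt0 n) e0 (J n) _ l10) _.
  rewrite lee_fin ler_wpM2l // ler_expR.
  apply: (@le_trans _ _ (2 * l1 ^+ 2 * (C * (p n)%:R * 4) - l1 * (e * g0 * (p n)%:R))).
    rewrite lerD2r; apply: ler_wpM2l; first by rewrite mulr_ge0 ?sqr_ge0.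
    by apply: ler_wpM2r.
  have -> : 2 * l1 ^+ 2 * (C * (p n)%:R * 4) - l1 * (e * g0 * (p n)%:R) = - (l1 * (e * g0) / 2 * (p n)%:R).
    by rewrite /l1; field; rewrite gt_eqF.
  by rewrite lerN2 /k1 -mulrA ler_wpM2l // ltW // divr_gt0 // mulr_gt0.
have ae2 : {ae P, forall w, exists n1, forall n, (n1 <= n)%N -> ~ A2 n w}.
  apply: (@borel_cantelli_exp _ _ _ P A2 2 k2 n2) => // n /hC[_ hm hp].
  apply: le_trans (restrace_tail (@mZ n) (@indepZ n) (@wt0 n) e0 _ l20) _.
  rewrite lee_fin ler_wpM2l // ler_expR.
  apply: (@le_trans _ _ (2 * l2 ^+ 2 * (C * (p n)%:R * e ^- 2) - l2 * (g0 * (p n)%:R))).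
    rewrite lerD2r; apply: ler_wpM2l; first by rewrite mulr_ge0 ?sqr_ge0.
    by apply: ler_wpM2r => //; rewrite invr_ge0 sqr_ge0.
  have -> : 2 * l2 ^+ 2 * (C * (p n)%:R * e ^- 2) - l2 * (g0 * (p n)%:R) = - (l2 * g0 / 2 * (p n)%:R).
    by rewrite /l2; field; rewrite !gt_eqF.
  by rewrite lerN2 /k2 -mulrA ler_wpM2l // ltW // divr_gt0 // mulr_gt0.
have [n3 lim] := mean_limit.
apply: filterS2 ae1 ae2 => w [m1 h1] [m2 h2].
exists (maxn n3 (maxn m1 m2)) => n; rewrite !geq_max => /andP[/lim[b1 b2] /andP[/h1 c1 /h2 c2]].
have {}c1 : `|ressum (Mw n w) (wt x n) e (J n) / (p n)%:R - mean n / (p n)%:R| <= e * g0.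
  rewrite -mulrBl normrM [`|_^-1|]gtr0_norm ?invr_gt0 // ler_pdivrMr // ltW // ltNge.
  by apply/negP => h; exact: c1.
have {}c2 : restrace (Mw n w) (wt x n) e / (p n)%:R - tau n / (p n)%:R <= g0.
  rewrite -mulrBl ler_pdivrMr // (le_trans (ler_norm _)) // ltW // ltNge.
  by apply/negP => h; exact: c2.
split.
  move: c1 b1; move: (ressum _ _ _ _ / _) (mean n / _) (_ / (1 + _)) (e * g0) => u v z t {}h1 {}h2.
  apply: le_trans (ler_distD v _ _) _; have -> : 4 * t = t + 3 * t by ring.
  exact: lerD.
rewrite -(subrK (tau n / (p n)%:R) (restrace _ _ _ / _)) mulrDr.
have -> : 2 * (e * g0) = e * g0 + e * g0 by ring.
by apply: lerD => //; rewrite ler_pM2l.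
Qed.

End Regularized.
Lemma full_rank_eventually (b : R) : b < 1 ->
  (fun n => (p n)%:R / (n + N n)%:R : R) @ \oo --> b ->
  {ae P, forall w, exists n1, forall n, (n1 <= n)%N -> \rank (Mw n w) = p n}.
Proof.
move=> b1 cvgb.
have M8 : 0 < 8 * M by rewrite mulr_gt0 // (lt_le_trans _ M1).
pose q := 1 - (8 * M)^-1.
have q0 : 0 <= q.
  rewrite subr_ge0 invf_le1 //; apply: (le_trans M1).
  by rewrite ler_peMl // ler1n.
have q1 : q < 1 by rewrite gtrBl invr_gt0.
have atomq n i u v : (P (@Z n i true @^-1` [set u] `&` @Z n i false @^-1` [set v]) <= q%:E)%E.
  exact: (entry_atom (mZ i true) (mZ i false) (Z0 i true) (Z0 i false) (Z1 i) (Z2 i) u v M1).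
have [s s1 hs] := potential_exists q0 q1.
have s0 : 0 < s by rewrite (lt_trans _ s1).
pose sg := ln s.
have sg0 : 0 < sg by exact: ln_gt0.
have sE : s = expR sg by rewrite lnK.
have [C [c [n2 [C0 c0 hC]]]] := sizes_comparable.
(* With rho = s^(1 + del) the bound is a constant times s^((1 + del) p - m), where m = n + N.
   Eventually p <= (b + del) m, and (1 + 2 del) (b + del) <= 1 leaves m - (1 + del) p >= del p. *)
pose del := (1 - b) / 4.
have del0 : 0 < del by rewrite divr_gt0 // subr_gt0.
have rho1 : s < expR (sg * (1 + del)).
  by rewrite {1}sE ltr_expR ltr_pMr // ltrDl.
have [K hK] := hs _ rho1.
have [n3 hb] := cvg_eventually cvgb del0.
pose k := sg * del * c.
have k0 : 0 < k by rewrite mulr_gt0 // mulr_gt0.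
have mr n : measurable [set w | (p n <= \rank (Mw n w))%N].
  apply: measurable_rank_ge => i j.
  have := @mxmeasurable_config R (p n) (n + N n) i j.
  by case=> h1 h2; split; [exact: measurableT_comp h1 (measurable_sample (@mZ n))|
    exact: measurableT_comp h2 (measurable_sample (@mZ n))].
pose A n := [set w | (\rank (Mw n w) < p n)%N].
have AE n : A n = ~` [set w | (p n <= \rank (Mw n w))%N].
  by apply/seteqP; split => w; rewrite /A /= ltnNge => /negP.
have : {ae P, forall w, exists n1, forall n, (n1 <= n)%N -> ~ A n w}.
  apply: (@borel_cantelli_exp _ _ _ P A `|K| k (maxn n2 n3)) => //.
    by move=> n; rewrite AE; exact: measurableC.
  move=> n; rewrite geq_max => /andP[/hC[nn _ hp] /hb {}hb].
  have [phi [ph ph0 ph1 phs phK]] := hK (p n) (n + N n)%N.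
  apply: le_trans (singular_prob_potential (@mZ n) (@indepZ n) (@atomq n) ph ph0 ph1 s0 phs) _.
  rewrite lee_fin; apply: le_trans phK _; apply: le_trans (ler_norm _) _.
  rewrite normrM ler_wpM2l // ger0_norm; last first.
    by rewrite mulr_ge0 ?exprn_ge0 ?invr_ge0 ?exprn_ge0 ?expR_ge0 // ltW.
  rewrite sE -!expRM_natl -expRN -expRD ler_expR.
  have mm : 0 < (n + N n)%:R :> R by rewrite ltr0n addn_gt0 nn.
  have pm : (p n)%:R <= (b + del) * (n + N n)%:R.
    by rewrite -ler_pdivrMr //; move: hb; rewrite ler_norml; move: (_ / _) => u /andP[? ?]; lra.
  have pm2 : (1 + 2 * del) * (p n)%:R <= (n + N n)%:R.
    apply: (@le_trans _ _ ((1 + 2 * del) * (b + del) * (n + N n)%:R)).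
      by rewrite -mulrA ler_wpM2l // addr_ge0 // mulr_ge0 // ltW.
    rewrite ler_piMl // ?(ltW mm) //.
    by rewrite /del; nra.
  rewrite -lerN2 opprK.
  have -> : - ((p n)%:R * (sg * (1 + del)) - (n + N n)%:R * sg) = sg * ((n + N n)%:R - (1 + del) * (p n)%:R) by ring.
  have -> : k * n%:R = sg * (del * (c * n%:R)) by rewrite /k; ring.
  rewrite ler_wpM2l ?(ltW sg0) //.
  have h : del * (c * n%:R) <= del * (p n)%:R by rewrite ler_pM2l.
  apply: (le_trans h); rewrite lerBrDl; apply: le_trans pm2; rewrite le_eqVlt; apply/orP; left; apply/eqP; ring.
apply: filterS => w [n1 h]; exists n1 => n /h; rewrite /A /= => /negP; rewrite -leqNgt => hr.
by apply/eqP; rewrite eqn_leq rank_leq_row.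
Qed.

(** The regularised limits for the countably many ridges e = 1 / (l + 1) hold on one almost sure
    event. There [ressum_reg] bounds the cost of removing the ridge by e tr G / p <= 2 e g0, and l
    is taken large. Invertibility is a pointwise premise, to be supplied by the full rank of the
    sample. *)
Lemma ressum_limit (x g0 : R) : 0 < x -> 0 < g0 ->
  (1 + x) * g0 / (1 + (1 + x) * y * g0) + x * a * g0 / (1 + x * a * Y * g0) = 1 ->
  {ae P, forall w,
    (exists n1, forall n, (n1 <= n)%N -> pencil (Mw n w) (wt x n) 0 \in unitmx) ->
    ressum (Mw n w) (wt x n) 0 (J n) / (p n)%:R @[n --> \oo] -->
      (1 + x) * g0 / (1 + (1 + x) * y * g0)}.
Proof.
move=> x0 g00 fix0.
have ei l : 0 < l.+1%:R^-1 :> R by rewrite invr_gt0.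
have := ae_foralln (fun l => regularized_limit x0 g00 (ei l) fix0).
apply: filterS => w h [n1 hu]; apply/cvgrPdist_le => dl dl0.
have dg : 0 < dl / (6 * g0) by rewrite divr_gt0 // mulr_gt0.
have [l _ /(_ l (leqnn l))] := (cvgrPdist_le _ _).1 (@cvg_harmonic R) _ dg.
rewrite /= sub0r normrN ger0_norm ?(ltW (ei l)) // ler_pdivlMr ?mulr_gt0 // => hl.
have [n2 {}h] := h l.
exists (maxn n1 n2) => // n; rewrite /= geq_max => /andP[/hu un /h[b1 b2]].
have wt0 k : 0 <= wt x n k by apply: weight_ge0; exact: ltW.
have /andP[r1 r2] := ressum_reg (J n) wt0 (ei l) un.
have r3 : `|ressum (Mw n w) (wt x n) 0 (J n) / (p n)%:R - ressum (Mw n w) (wt x n) l.+1%:R^-1 (J n) / (p n)%:R|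
    <= 2 * (l.+1%:R^-1 * g0).
  apply: le_trans b2; rewrite -mulrBl ger0_norm ?divr_ge0 // mulrA.
  by rewrite ler_wpM2r // invr_ge0.
apply: (@le_trans _ _ (6 * (l.+1%:R^-1 * g0))); last by rewrite mulrCA.
rewrite distrC; apply: le_trans (ler_distD (ressum (Mw n w) (wt x n) l.+1%:R^-1 (J n) / (p n)%:R) _ _) _.
have -> : 6 * (l.+1%:R^-1 * g0) = 2 * (l.+1%:R^-1 * g0) + 4 * (l.+1%:R^-1 * g0) by ring.
exact: lerD.
Qed.

End RandomPencils.

(** * Spectra *)

Section MergedEntries.
Context (R : realType) d (T : measurableType d) (P : probability T R).

Lemma mutually_independent_reindex (I J : finType) (h : I -> J) (Zc : J -> bool -> T -> R) :
  bijective h -> mutually_independent P Zc -> mutually_independent P (fun i => Zc (h i)).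
Proof.
move=> [g hK gK] ind A mA.
have := ind (fun j => A (g j)) (fun j => mA (g j)).
rewrite (reindex h) /=; last by exists g => x _; [exact: hK|exact: gK].
under eq_bigr do rewrite hK.
move=> <-; congr (P _); apply/seteqP; split => w H i _ b _ /=.
  by have := H (g i) Logic.I b Logic.I; rewrite /= gK.
by have := H (h i) Logic.I b Logic.I; rewrite /= hK.
Qed.

Definition merge_index (p n N : nat) (k : 'I_p * 'I_(n + N)) : ('I_p * 'I_n) + ('I_p * 'I_N) :=
  match fintype.split k.2 with inl j => inl (k.1, j) | inr j => inr (k.1, j) end.

Lemma merge_index_bij p n N : bijective (@merge_index p n N).
Proof.
exists (fun s => match s with inl q => (q.1, unsplit (inl q.2)) | inr q => (q.1, unsplit (inr q.2)) end).
  move=> [i j]; rewrite /merge_index /=.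
  by case E : (fintype.split j) => [k|k] ; congr (_, _); rewrite -[RHS]splitK E.
case=> [[i j]|[i j]]; rewrite /merge_index /=.
  by rewrite (unsplitK (inl j : 'I_n + 'I_N)%type).
by rewrite (unsplitK (inr j : 'I_n + 'I_N)%type).
Qed.

Lemma config_mx_merged p n N (xr xi : 'I_p -> 'I_n -> T -> R) (zr zi : 'I_p -> 'I_N -> T -> R) w :
  config_mx (sample (fun k => all_entries xr xi zr zi (merge_index k)) w) =
  row_mx (cmx xr xi w) (cmx zr zi w).
Proof.
apply/matrixP => i k; rewrite !mxE /sample /merge_index /=.
by case: (fintype.split k) => j; rewrite mxE.
Qed.

End MergedEntries.

Section SpectralFunctional.
Context (R : realType).
Local Notation C := R[i].
Local Notation "x %:C" := (real_complex R x).
Local Notation Re := (@complex.Re R).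
Local Notation Im := (@complex.Im R).
Variable p : nat.
Hypothesis p0 : (0 < p)%N.

Definition unit_spectrum (B : 'M[C]_p) :=
  all (fun z => (Im z == 0) && (0 <= Re z <= 1)) (eigseq B).

(* The second branch only serves to keep the functional positive on all matrices. *)
Definition spectral_functional (B : 'M[C]_p) (f : R -> R) : R :=
  if unit_spectrum B then (\sum_(z <- eigseq B) f (Re z)) / p%:R else f 0.

Lemma spectral_functional_pos B : pos_functional (spectral_functional B).
Proof.
rewrite /spectral_functional; case uB: (unit_spectrum B); [have hB := allP uB|]; split => //.
- by move=> f g _ _; rewrite big_split mulrDl.
- by move=> c f _; rewrite -mulr_sumr mulrA.
- move=> f g _ _ fg; apply: ler_wpM2r; first by rewrite invr_ge0.
  rewrite big_seq_cond [X in _ <= X]big_seq_cond.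
  by apply: ler_sum => z /andP[/hB /andP[_ hz] _]; exact: fg.
- by move=> f g _ _ fg; apply: fg; rewrite lexx ler01.
Qed.

Lemma spectral_functional1 B : spectral_functional B (fun=> 1) = 1.
Proof.
rewrite /spectral_functional; case: (unit_spectrum B) => //.
by rewrite big_const_seq count_predT size_eigseq iter_addr addr0 divff // pnatr_eq0 -lt0n.
Qed.

Lemma esd_spectral_functional B u : unit_spectrum B ->
  esd B u = spectral_functional B (fun t => (t <= u)%R%:R).
Proof.
move=> uB; rewrite /esd /spectral_functional uB; congr (_ / _).
rewrite -sum1_count natr_sum big_mkcond big_seq [RHS]big_seq /=; apply: eq_bigr => z zB.
by have /andP[-> _] := allP uB z zB; rewrite /=; case: (_ <= u).
Qed.

Section Bmat.
Variables (n N : nat) (X : 'M[C]_(p, n)) (XX : 'M[C]_(p, N)) (a : R).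
Hypotheses (n0 : (0 < n)%N) (N0 : (0 < N)%N) (a0 : 0 < a).
Local Notation M := (row_mx X XX).
Let wS (k : 'I_(n + N)) : R := if (k < n)%N then n%:R^-1 else 0.
Let wA (k : 'I_(n + N)) : R := if (k < n)%N then n%:R^-1 else a / N%:R.

Lemma pencil_row_mx c c' :
  pencil M (fun k => if (k < n)%N then c else c') 0 =
  c%:C *: (X *m adjmx X) + c'%:C *: (XX *m adjmx XX).
Proof.
rewrite pencil_sum (_ : (0%:C)%:M = 0); last by apply/matrixP => i l; rewrite !mxE mul0rn.
rewrite addr0 big_split_ord /=; congr (_ + _).
  under eq_bigr do rewrite ltn_ord colKl.
  rewrite -scaler_sumr; congr (_ *: _); apply/matrixP => i l; rewrite summxE mxE.
  by apply: eq_bigr => k _; rewrite mxE big_ord1 !mxE.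
under eq_bigr do rewrite ltnNge leq_addr /= colKr.
rewrite -scaler_sumr; congr (_ *: _); apply/matrixP => i l; rewrite summxE mxE.
by apply: eq_bigr => k _; rewrite mxE big_ord1 !mxE.
Qed.

Lemma Bmat_pencil : Bmat X XX a = pencil M wS 0 *m invmx (pencil M wA 0).
Proof.
rewrite /Bmat /wS /wA !pencil_row_mx scale0r addr0.
have cV k : (k%:R)^-1 = (k%:R^-1 : R)%:C :> C by rewrite fmorphV rmorph_nat.
by rewrite !cV scalerA rmorphM.
Qed.

Hypothesis regular : pencil M wA 0 \in unitmx.
Let wS0 k : 0 <= wS k. Proof. by rewrite /wS; case: ifP; rewrite ?invr_ge0. Qed.
Let wSA k : wS k <= wA k.
Proof. by rewrite /wS /wA; case: ifP => // _; rewrite divr_ge0 // ltW. Qed.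

Lemma unit_spectrum_Bmat : unit_spectrum (Bmat X XX a).
Proof.
apply/allP => z; rewrite Bmat_pencil => /(eigseq_unit_interval wS0 wSA regular)[-> -> ->].
by rewrite eqxx.
Qed.

Lemma spectral_functional_pole x : 0 < x ->
  spectral_functional (Bmat X XX a) (fun t => (t + x)^-1) =
  (1 - ressum M (@weight R n N x a) 0 (@first_cols n N) / p%:R / (1 + x)) / x.
Proof.
move=> x0; rewrite /spectral_functional unit_spectrum_Bmat.
have pp : 0 < p%:R :> R by rewrite ltr0n.
have x1 : 0 < 1 + x by rewrite addr_gt0.
apply: (mulfI (lt0r_neq0 x0)); rewrite Bmat_pencil mulrA.
rewrite (sum_eigseq wS0 wSA regular p0 x0) [in RHS]mulrCA mulfV ?gt_eqF // mulr1.
have -> : (fun j => wS j + x * wA j) = @weight R n N x a.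
  apply/funext => k; rewrite /wS /wA /weight; case: ifP => _.
    by rewrite mulrDl mul1r.
  by rewrite add0r mulrA.
rewrite mulrBl mulfV ?gt_eqF //; congr (_ - _).
rewrite mulrAC; congr (_ / _).
(* On the first columns [wS] is [weight] divided by 1 + x, elsewhere it is 0; this produces the
   factor 1 / (1 + x). *)
rewrite /ressum mulr_suml [RHS]big_mkcond; apply: eq_bigr => k _.
rewrite /first_cols /wS /weight; case: ifP => _; last by rewrite mul0r.
have nn : 0 < n%:R :> R by rewrite ltr0n.
by move: (resform _ _ _ _) => q; field; rewrite !gt_eqF.
Qed.

End Bmat.
End SpectralFunctional.

Theorem theorem1p1 (R : realType) (d : measure_display) (T : measurableType d)
  (P : probability T R) (p N : nat -> nat) (alpha : nat -> R)
  (xr xi : forall n : nat, 'I_(p n) -> 'I_n -> {RV P >-> R})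
  (zr zi : forall n : nat, 'I_(p n) -> 'I_(N n) -> {RV P >-> R})
  (a y Y : R) :
  (forall n, (0 < p n)%N) -> (forall n, (0 < N n)%N) -> (forall n, 0 < alpha n) ->
  (* X_n and XX_N independent, each with independent entries *)
  (forall n, mutually_independent P
     (all_entries (fun i j => xr n i j : T -> R) (fun i j => xi n i j : T -> R)
                  (fun i j => zr n i j : T -> R) (fun i j => zi n i j : T -> R))) ->
  (* (i) *)
  (forall n i j i' j', same_law P (xr n i j) (xi n i j) (xr n i' j') (xi n i' j')) ->
  (forall n i j, ('E_P[xr n i j])%E = 0%E /\ ('E_P[xi n i j])%E = 0%E) ->
  (forall n i j, (\int[P]_w ((xr n i j w) ^+ 2 + (xi n i j w) ^+ 2)%:E = 1)%E) ->
  (* (ii) *)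
  alpha @ \oo --> a -> 0 < a ->
  (fun n => (p n)%:R / n%:R : R) @ \oo --> y -> 0 < y ->
  (* (iii) *)
  (forall n i j i' j', same_law P (zr n i j) (zi n i j) (zr n i' j') (zi n i' j')) ->
  (forall n i j, ('E_P[zr n i j])%E = 0%E /\ ('E_P[zi n i j])%E = 0%E) ->
  (forall n i j, (\int[P]_w ((zr n i j w) ^+ 2 + (zi n i j w) ^+ 2)%:E = 1)%E) ->
  (* (iv) *)
  (fun n => (p n)%:R / (N n)%:R : R) @ \oo --> Y -> 0 < Y ->
  (fun n => (p n)%:R / (n + N n)%:R : R) @ \oo --> y * Y / (y + Y) ->
  0 < y * Y / (y + Y) < 1 ->
  (* (v) *)
  (exists M : R, forall n i j,
     (\int[P]_w ((((xr n i j w) ^+ 2 + (xi n i j w) ^+ 2) ^+ 2)%:E) <= M%:E)%E) ->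
  (exists M : R, forall n i j,
     (\int[P]_w ((((zr n i j w) ^+ 2 + (zi n i j w) ^+ 2) ^+ 2)%:E) <= M%:E)%E) ->
  distribution_function (Flim a y Y) /\
  {ae P, forall w, forall x : R, {for x, continuous (Flim a y Y)} ->
     (fun n => esd (Bmat (cmx (fun i j => xr n i j : T -> R) (fun i j => xi n i j : T -> R) w)
                         (cmx (fun i j => zr n i j : T -> R) (fun i j => zi n i j : T -> R) w)
                         (alpha n)) x)
       @ \oo --> Flim a y Y x}.
Proof.
move=> p0 N0 al0 ind _ mx vx cva a0 cvy y0 _ mz vz cvY Y0 cvb /andP[_ b1] [Mx hMx] [Mz hMz].
have D0 : 0 < y - y * Y + Y.
  have s0 : 0 < y + Y by rewrite addr_gt0.
  by move: b1; rewrite (ltr_pdivrMr _ _ s0) mul1r; lra.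
split; first exact: distribution_function_Flim.
pose Z n (k : 'I_(p n) * 'I_(n + N n)) := all_entries
  (fun i j => xr n i j : T -> R) (fun i j => xi n i j : T -> R)
  (fun i j => zr n i j : T -> R) (fun i j => zi n i j : T -> R) (merge_index k).
(* A single fourth-moment bound for both samples, made at least 1 as [entry_atom] requires. *)
pose M := 1 + (`|Mx| + `|Mz|).
have mean0 (X : {RV P >-> R}) : ('E_P[X] = 0)%E -> (\int[P]_w (X w)%:E = 0)%E by rewrite unlock.
have mZ n k b : measurable_fun setT (Z n k b).
  by rewrite /Z /all_entries; case: (merge_index k) => [[i j]|[i j]]; case: b.
have indZ n : mutually_independent P (Z n).
  exact: mutually_independent_reindex (merge_index_bij _ _ _) (ind n).
have Z0 n k b : (\int[P]_w (Z n k b w)%:E = 0)%E.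
  rewrite /Z /all_entries; case: (merge_index k) => [[i j]|[i j]].
    by have [h1 h2] := mx n i j; case: b; exact: mean0.
  by have [h1 h2] := mz n i j; case: b; exact: mean0.
have Z1 n k : (\int[P]_w (Z n k true w ^+ 2 + Z n k false w ^+ 2)%:E = 1)%E.
  by rewrite /Z /all_entries; case: (merge_index k) => [[i j]|[i j]].
have Z2 n k : (\int[P]_w ((Z n k true w ^+ 2 + Z n k false w ^+ 2) ^+ 2)%:E <= M%:E)%E.
  rewrite /Z /all_entries /M; case: (merge_index k) => [[i j]|[i j]].
    apply: le_trans (hMx n i j) _; rewrite lee_fin (le_trans (ler_norm Mx)) //.
    by rewrite addrCA lerDl addr_ge0.
  apply: le_trans (hMz n i j) _; rewrite lee_fin (le_trans (ler_norm Mz)) //.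
  by rewrite addrA lerDr addr_ge0.
have M1 : 1 <= M by rewrite lerDl addr_ge0.
have full := full_rank_eventually N0 mZ indZ M1 Z0 Z1 Z2 y0 Y0 cvy cvY b1 cvb.
(* Integer poles suffice, so only countably many almost sure statements are intersected. *)
have /choice[g gP] : forall k, exists g : R, 0 < g /\
    (1 + k.+1%:R) * g / (1 + (1 + k.+1%:R) * y * g) +
    k.+1%:R * a * g / (1 + k.+1%:R * a * Y * g) = 1.
  move=> k; have [g g0 e] := fixpoint_exists y0 Y0 D0 (addr_gt0 ltr01 (ltr0Sn R k))
    (mulr_gt0 (ltr0Sn R k) a0).
  by exists g.
have lims := ae_foralln (fun k => ressum_limit p0 N0 al0 mZ indZ M1 Z0 Z1 Z2 a0 y0 Y0 cva cvy cvY
  (ltr0Sn R k) (gP k).1 (gP k).2).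
(* With w fixed in both events, the rest of the argument is deterministic. *)
apply: filterS2 full lims => w [n1 rk] lims u cu.
set X := fun n => cmx (fun i j => xr n i j : T -> R) (fun i j => xi n i j : T -> R) w.
set XX := fun n => cmx (fun i j => zr n i j : T -> R) (fun i j => zi n i j : T -> R) w.
have Mrow n : config_mx (sample (Z n) w) = row_mx (X n) (XX n) by exact: config_mx_merged.
have regular n : (n1 <= n)%N -> pencil (row_mx (X n) (XX n))
    (fun k : 'I_(n + N n) => if (k < n)%N then n%:R^-1 else alpha n / (N n)%:R) 0 \in unitmx.
  move=> hn; apply: pencil_full_rank => [k|]; last by rewrite -Mrow; exact: rk.
  case: ifP => kn; last by rewrite divr_gt0 // ltr0n.
  by rewrite invr_gt0 ltr0n (leq_ltn_trans _ kn).
have size0 n k : (k < n)%N -> (0 < n)%N by exact: leq_ltn_trans.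
pose Ln n := spectral_functional (Bmat (X n) (XX n) (alpha n)).
have [k0 k00 reg] := regular_poles a Y y0.
have cvLn : Ln n (fun t => (t <= u)%R%:R) @[n --> \oo] --> lim_functional a y Y (fun t => (t <= u)%R%:R).
  apply: (@cvg_indic R Ln _ _ _ _ k0) => //.
  - by move=> n; exact: spectral_functional_pos.
  - exact: lim_functional_pos.
  - by move=> n; rewrite /Ln spectral_functional1.
  - case=> [hk|k hk]; first by move: k00; rewrite ltnNge hk.
    rewrite (lim_functional_pole a0 y0 Y0 D0 (ltr0Sn R k) (reg _ hk) (gP k).1 (gP k).2).
    have kp : 0 < k.+1%:R :> R by [].
    have k1 : 0 < 1 + k.+1%:R :> R by rewrite addr_gt0.
    pose S n := ressum (row_mx (X n) (XX n)) (@weight R n (N n) k.+1%:R (alpha n)) 0 (@first_cols n (N n)).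
    have cS : S n / (p n)%:R @[n --> \oo] -->
        (1 + k.+1%:R) * g k / (1 + (1 + k.+1%:R) * y * g k).
      have := lims k; rewrite (_ : (fun n => ressum _ _ _ _ / _) = fun n => S n / (p n)%:R); last first.
        by apply/funext => n; rewrite Mrow.
      (* The index n = 0 is discarded because the weights divide by n. *)
      apply; exists (maxn 1 n1) => n; rewrite geq_max => /andP[n0 hn].
      apply: pencil_full_rank => [i|]; last exact: rk.
      by rewrite /weight; case: ifP => _; rewrite divr_gt0 ?ltr0n // mulr_gt0.
    have -> : (1 - g k / (1 + (1 + k.+1%:R) * y * g k)) / k.+1%:R =
        (1 - (1 + k.+1%:R) * g k / (1 + (1 + k.+1%:R) * y * g k) / (1 + k.+1%:R)) / k.+1%:R.
      congr ((1 - _) / _); rewrite [RHS]mulrAC [(1 + k.+1%:R) * g k]mulrC mulfK // lt0r_neq0.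
    have : (1 - S n / (p n)%:R / (1 + k.+1%:R)) / k.+1%:R @[n --> \oo] -->
        (1 - (1 + k.+1%:R) * g k / (1 + (1 + k.+1%:R) * y * g k) / (1 + k.+1%:R)) / k.+1%:R.
      by apply: cvgMl; apply: cvgB; [exact: cvg_cst|apply: cvgMl].
    apply: cvg_trans; apply: near_eq_cvg; exists (maxn 1 n1) => // n.
    rewrite /= geq_max => /andP[n0 hn].
    by rewrite /Ln spectral_functional_pole //; exact: regular.
  - by rewrite (_ : (fun v => _) = Flim a y Y) //; apply/funext => v; rewrite FlimE.
rewrite FlimE //; apply: cvg_trans cvLn; apply: near_eq_cvg.
exists (maxn 1 n1) => // n; rewrite /= geq_max => /andP[n0 hn].
rewrite /Ln -esd_spectral_functional //.
by apply: unit_spectrum_Bmat; [exact: al0|exact: regular].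
Qed.
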